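(* Let $f$ be a Gaussian random field on $T\subset\mathbb R^d$, and let $\sigma\in(0,\infty)$ and $\mu$ be such that conditions (C1)–(C6) listed in the context hold. Let $v(b)=P\bigl(\int_Te^{\sigma f(t)+\mu(t)}\,dt>b\bigr)$ and let $v_M(b)=P(\mathcal I_M(T)>b)$, where $\mathcal I_M(T)$ is the lattice approximation with mesh $1/N$ defined in the context. Then for any $\varepsilon_0>0$ there exists $\kappa_0$ such that for any $\varepsilon\in(0,1)$ and any $b>2$, if $N\ge\kappa_0\,\varepsilon^{-1-\varepsilon_0}(\log b)^{2+\varepsilon_0}$, then $$\frac{|v_M(b)-v(b)|}{v(b)}<\varepsilon .$$
   Context: **Setting.** $f$ is a real Gaussian random field under $P$, $C(t-s)=\operatorname{Cov}(f(t),f(s))$; $\sigma\in(0,\infty)$; $\mu$ is a deterministic function. $\operatorname{mes}$ is Lebesgue measure, $\partial$ the gradient, $\Delta$ the Hessian, and $\partial^2f$ the $d(d+1)/2$-vector of the second derivatives $\partial^2_{ij}f$, $i\le j$. The joint law of $(f(t),\partial^2 f(t))$ is nondegenerate. **Conditions.** (C1) $f$ is stationary, $Ef(t)=0$, $Ef^2(t)=1$. (C2) $f$ is almost surely at least two times differentiable in $t$. (C3) $T$ is a $d$-dimensional compact subset of $\mathbb R^d$ with piecewise smooth boundary. (C4) The Hessian of $C$ at the origin is $-I$ ($I$ the $d\times d$ identity), and as $t\to0$, $C(t)=1-\frac12t^\top t+C_4(t)+R_C(t)$, where $C_4(t)=\frac1{24}\sum_{ijkl}\partial^4_{ijkl}C(0)t_it_jt_kt_l$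 and $R_C(t)=O(|t|^{4+\delta_0})$ for some $\delta_0>0$. (C5) For each $t\in\mathbb R^d$, $C(\lambda t)$ is nonincreasing in $\lambda\in\mathbb R^+$. (C6) Either (a) $\mu\equiv0$; or (b) the maximum of $\mu$ over $T$ is unique and attained at a point $t_*$ in the interior of $T$, $\mu(t+\varepsilon)-\mu(t)=\varepsilon^\top\partial\mu(t)+\frac12\varepsilon^\top\Delta\mu(t)\varepsilon+O(|\varepsilon|^{2+\delta_0})$ as $\varepsilon\to0$, and $\Delta\mu(t_* )$ is negative definite. **Discretization.** For a positive integer $N$ let $G_{N,d}=\{(i_1/N,\dots,i_d/N):i_1,\dots,i_d\in\mathbb Z\}$. For $t=(t^1,\dots,t^d)\in G_{N,d}$ let $T_N(t)=\{(s^1,\dots,s^d)\in T:\ s^j\in(t^j-1/N,t^j],\ j=1,\dots,d\}$, and let $T_N=\{t\in G_{N,d}:T_N(t)\ne\varnothing\}=\{t_1,\dots,t_M\}$ (a finite set, $M=O(N^d)$). Define $$\mathcal I_M(T)=\sum_{i=1}^M\operatorname{mes}(T_N(t_i))\,e^{\sigma f(t_i)+\mu(t_i)} .$$ Since lattice points $t_i$ may fall slightly outside $T$, $f$ and $\mu$ are understood to be defined, with the same regularity, on a neighbourhood of $T$ containing these points. *)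

(* Defs.v *)
From HB Require Import structures.
From mathcomp Require Import all_boot all_order all_algebra.
From mathcomp Require Import all_classical all_reals all_analysis.

Set Implicit Arguments.
Unset Strict Implicit.
Unset Printing Implicit Defensive.

Import Order.TTheory GRing.Theory Num.Theory.
Import numFieldNormedType.Exports.

Local Open Scope classical_set_scope.
Local Open Scope ring_scope.

(* 'rV[R]_n carries the sigma-algebra generated by its coordinates, as the    *)
(* library does for n.-tuple R; it is the Borel sigma-algebra.                *)
Section measurable_rV.
Context {R : realType} {n : nat}.

Let coord (i : 'I_n) (x : 'rV[R]_n) : measurableTypeR R := x ord0 i.

Let measurable_rV0 : g_sigma_preimage coord set0.
Proof. exact: sigma_algebra0. Qed.

Let measurable_rVC A :
  g_sigma_preimage coord A -> g_sigma_preimage coord (~` A).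
Proof. exact: sigma_algebraC. Qed.

Let measurable_rV_bigcup (F : (set 'rV[R]_n)^nat) :
  (forall i, g_sigma_preimage coord (F i)) ->
  g_sigma_preimage coord (\bigcup_i F i).
Proof. exact: sigma_algebra_bigcup. Qed.

HB.instance Definition _ := @isMeasurable.Build default_measure_display
  'rV[R]_n (g_sigma_preimage coord)
  measurable_rV0 measurable_rVC measurable_rV_bigcup.

Lemma measurable_rV_coord (i : 'I_n) :
  measurable_fun setT (fun x : 'rV[R]_n => x ord0 i : measurableTypeR R).
Proof.
move=> _ Y mY; rewrite setTI; apply: sub_sigma_algebra => /=.
rewrite -bigcup_seq/=; exists i => /=; first by rewrite mem_index_enum.
by exists Y => //; rewrite setTI.
Qed.

End measurable_rV.

Lemma measurable_fun_rVP (R : realType) n d (T : measurableType d)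
    (g : T -> 'rV[R]_n) :
  (forall i, measurable_fun setT (fun t => g t ord0 i : measurableTypeR R)) ->
  measurable_fun setT g.
Proof.
move=> mg; pose coord i (x : 'rV[R]_n) : measurableTypeR R := x ord0 i.
have prefS : g_sigma_preimage (fun i => coord i \o g) `<=` measurable.
  apply: smallest_sub; first exact: sigma_algebra_measurable.
  case: n => [|n] in g mg coord *; first by rewrite big_ord0.
  rewrite -bigcup_mkord_ord; apply: bigcup_sub => i Ii.
  by move=> A [B mB <-]; exact: mg.
by rewrite g_sigma_preimage_comp in prefS => _ A mA; apply: prefS; exists A.
Qed.

Section lebesgue_rV.
Context {R : realType}.

Definition rcons_rV n (p : 'rV[R]_n * measurableTypeR R) : 'rV[R]_n.+1 :=
  \row_i (if unlift ord_max i is Some j then p.1 ord0 j else p.2).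

Lemma measurable_rcons_rV n : measurable_fun setT (@rcons_rV n).
Proof.
apply: measurable_fun_rVP => i; rewrite /rcons_rV.
case: (unliftP ord_max i) => [j|] ->.
- under eq_fun do rewrite mxE liftK.
  exact: (measurableT_comp (measurable_rV_coord j) measurable_fst).
- under eq_fun do rewrite mxE unlift_none.
  exact: measurable_snd.
Qed.

Section step.
Variables (n : nat) (m : {measure set 'rV[R]_n -> \bar R}).

Definition lebesgue_rVS : set 'rV[R]_n.+1 -> \bar R :=
  pushforward (m \x @lebesgue_measure R)%E (@rcons_rV n).

Let lebesgue_rVS0 : lebesgue_rVS set0 = 0%E.
Proof. by rewrite /lebesgue_rVS /pushforward preimage_set0 measure0. Qed.

Let lebesgue_rVS_ge0 A : (0 <= lebesgue_rVS A)%E.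
Proof. by rewrite /lebesgue_rVS /pushforward measure_ge0. Qed.

Let lebesgue_rVS_sigma_additive : semi_sigma_additive lebesgue_rVS.
Proof.
move=> F mF tF mUF; rewrite /lebesgue_rVS /pushforward preimage_bigcup.
have mpre A : measurable A -> measurable (@rcons_rV n @^-1` A).
  by move=> mA; rewrite -[X in measurable X]setTI; exact: measurable_rcons_rV.
apply: measure_semi_sigma_additive => [k||].
- exact: mpre.
- apply/trivIsetP => i j _ _ ij; rewrite -preimage_setI.
  by move/trivIsetP : tF => /(_ _ _ _ _ ij) ->//; rewrite preimage_set0.
- by rewrite -preimage_bigcup; exact: mpre.
Qed.

HB.instance Definition _ := isMeasure.Build _ _ _ lebesgue_rVS
  lebesgue_rVS0 lebesgue_rVS_ge0 lebesgue_rVS_sigma_additive.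
End step.

(* R^(n+1) is identified with R^n * R by splitting off the last coordinate. *)
Fixpoint lebesgue_rV n : {measure set 'rV[R]_n -> \bar R} :=
  match n with
  | 0 => \d_(0 : 'rV[R]_0)
  | m.+1 => lebesgue_rVS (lebesgue_rV m)
  end.

Lemma lebesgue_rV_box n (a b : 'rV[R]_n) : (forall i, a ord0 i <= b ord0 i) ->
  lebesgue_rV n [set x : 'rV[R]_n | forall i, a ord0 i < x ord0 i <= b ord0 i] =
  (\prod_i (b ord0 i - a ord0 i))%:E.
Proof.
elim: n a b => [|n IH] a b ab.
  by rewrite big_ord0 /= diracE mem_set//= => -[].
pose w (x : 'rV[R]_n.+1) : 'rV[R]_n := \row_j x ord0 (widen_ord (leqnSn n) j).
have liftE (j : 'I_n) : lift ord_max j = widen_ord (leqnSn n) j.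
  by apply/val_inj; rewrite /= /bump leqNgt ltn_ord.
rewrite /= /lebesgue_rVS /pushforward.
transitivity ((lebesgue_rV n \x @lebesgue_measure R)%E
    ([set x : 'rV[R]_n | forall i, w a ord0 i < x ord0 i <= w b ord0 i] `*`
     (`]a ord0 ord_max, b ord0 ord_max] : set (measurableTypeR R)))).
  congr (_ _); apply/seteqP; split => -[x y] /=.
  - move=> H; split => [i|].
      by have := H (lift ord_max i); rewrite !mxE liftK liftE.
    by have := H ord_max; rewrite !mxE unlift_none in_itv.
  - move=> [Hx Hy] i; rewrite mxE; case: (unliftP ord_max i) => [j|] ->.
      by have := Hx j; rewrite !mxE liftE.
    by move: Hy; rewrite in_itv.
rewrite product_measure1E//=.
- rewrite IH; last by move=> i; rewrite !mxE.
  rewrite lebesgue_measure_itv/= big_ord_recr/= EFinM.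
  congr (_ * _)%E.
    by congr EFin; apply: eq_bigr => i _; rewrite !mxE.
  have := ab ord_max; rewrite le_eqVlt lte_fin => /predU1P[->|->//].
  by rewrite ltxx subrr.
- rewrite (_ : [set x | _] = \bigcap_(i in [set: 'I_n])
      ((fun x : 'rV[R]_n => x ord0 i : measurableTypeR R) @^-1`
        `]w a ord0 i, w b ord0 i])).
    apply: fin_bigcap_measurable => // i _; rewrite -[X in measurable X]setTI.
    exact: measurable_rV_coord.
  apply/seteqP; split => x /= H i; first by move=> _; rewrite /= in_itv/=.
  by have := H i Logic.I; rewrite /= in_itv.
Qed.

End lebesgue_rV.

Section calculus.
Context {R : realType} {d : nat}.
Implicit Types (g : 'rV[R]_d -> R) (t x y : 'rV[R]_d).

(* The norm `|x| on 'rV[R]_d is the sup norm; it is used only inside O(.).    *)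
Definition dotv x y : R := (x *m y^T) ord0 ord0.

Definition partial (i : 'I_d) g : 'rV[R]_d -> R :=
  fun t => 'D_(delta_mx ord0 i) g t.

Definition gradient g t : 'rV[R]_d := \row_i partial i g t.

Definition hessian g t : 'M[R]_d := \matrix_(i, j) partial i (partial j g) t.

Definition quadform (A : 'M[R]_d) x : R := (x *m A *m x^T) ord0 ord0.

(* Frechet differentiability of order k at t; for k > 1 the derivatives of    *)
(* order below k must exist on a neighbourhood of t.                          *)
Fixpoint times_differentiable (k : nat) g t : Prop :=
  match k with
  | 0 => True
  | 1 => differentiable g t
  | k'.+1 => (\forall s \near t, differentiable g s) /\
             forall i, times_differentiable k' (partial i g) t
  end.

Definition negative_definite (A : 'M[R]_d) :=
  forall x, x != 0 -> quadform A x < 0.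

End calculus.

Section random_fields.
Context {R : realType} {dO : measure_display} {O : measurableType dO}.
Variable P : probability O R.

(* normal_prob m 0 is not the point mass at m, so that the degenerate case is *)
(* singled out; s is the standard deviation.                                  *)
Definition gaussian_rv (X : O -> R) := exists m s : R, 0 <= s /\
  forall A : set (measurableTypeR R), measurable A ->
    P (X @^-1` A) = if s == 0 then \d_m A else normal_prob m s A.

Definition nondegenerate_law (I : finType) (X : I -> O -> R) :=
  forall c : I -> R, (exists i, c i != 0) ->
  forall k : R, ~ {ae P, forall w, \sum_i c i * X i w = k}.

Context {d : nat}.
Variable U : set 'rV[R]_d.
Variable f : 'rV[R]_d -> {RV P >-> R}.

Definition gaussian_field := forall n (t : 'I_n -> 'rV[R]_d) (a : 'I_n -> R),
  (forall i, U (t i)) -> gaussian_rv (fun w => \sum_i a i * f (t i) w).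

Definition stationary_field :=
  forall n (t : 'I_n -> 'rV[R]_d) (h : 'rV[R]_d),
  (forall i, U (t i)) -> (forall i, U (t i + h)) ->
  forall A : 'I_n -> set (measurableTypeR R), (forall i, measurable (A i)) ->
    P [set w | forall i, A i (f (t i + h) w)] =
    P [set w | forall i, A i (f (t i) w)].

Definition covariance_function (C : 'rV[R]_d -> R) := forall s t, U s -> U t ->
  covariance P (f t) (f s) = (C (t - s))%:E.

Definition sample_path (w : O) : 'rV[R]_d -> R := fun t => f t w.

Definition jet2 (t : 'rV[R]_d)
    (k : option {ij : 'I_d * 'I_d | (ij.1 <= ij.2)%N}) (w : O) : R :=
  if k is Some ij then partial (val ij).1 (partial (val ij).2 (sample_path w)) t
  else f t w.

End random_fields.

Section conditions.
Context {R : realType} {dO : measure_display} {O : measurableType dO}.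
Variable P : probability O R.
Context {d : nat}.
Implicit Types (T U : set 'rV[R]_d) (f : 'rV[R]_d -> {RV P >-> R}).

Definition centered_unit_stationary U f := [/\ stationary_field U f,
  forall t, U t -> ('E_P[f t] = 0)%E &
  forall t, U t -> ('E_P[(f t : O -> R) ^+ 2] = 1)%E].

Definition as_twice_differentiable U f :=
  {ae P, forall w, forall t, U t -> times_differentiable 2 (sample_path f w) t}.

Definition unit_cube n : set 'rV[R]_n := [set x | forall i, 0 <= x ord0 i <= 1].

Definition open_unit_cube n : set 'rV[R]_n :=
  [set x | forall i, 0 < x ord0 i < 1].

(* A piece of boundary of dimension d - 1, with smooth meaning C^1: it may    *)
(* degenerate only on the boundary of the parameter cube (as polar            *)
(* coordinates do at the tip of a cone). For d = 1 it is a single point.      *)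
Definition smooth_patch (phi : 'rV[R]_d.-1 -> 'rV[R]_d) := exists W,
  [/\ open W, @unit_cube d.-1 `<=` W,
      forall x, W x ->
        differentiable phi x /\ {for x, continuous (jacobian phi)},
      {in @open_unit_cube d.-1 &, injective phi} &
      forall x, open_unit_cube x -> row_free (jacobian phi x)].

Definition piecewise_smooth_boundary T :=
  exists n (phi : 'I_n -> 'rV[R]_d.-1 -> 'rV[R]_d),
    (forall k, smooth_patch (phi k)) /\
    closure T `\` T^° = \bigcup_k (phi k @` @unit_cube d.-1).

(* A subset of R^d has topological dimension d iff its interior is nonempty.  *)
Definition full_dim_piecewise_smooth T :=
  [/\ compact T, T^° !=set0 & piecewise_smooth_boundary T].

Definition fourth_order_form (C : 'rV[R]_d -> R) (t : 'rV[R]_d) : R :=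
  24%:R^-1 * \sum_i \sum_j \sum_k \sum_l
    partial i (partial j (partial k (partial l C))) 0 *
    t ord0 i * t ord0 j * t ord0 k * t ord0 l.

Definition covariance_expansion (delta0 : R) (C : 'rV[R]_d -> R) :=
  [/\ times_differentiable 4 C 0, hessian C 0 = - 1%:M &
      (fun t => C t - (1 - 2%:R^-1 * dotv t t + fourth_order_form C t))
        =O_ (0 : 'rV[R]_d) (fun t => `|t| `^ (4%:R + delta0))].

Definition radially_nonincreasing (C : 'rV[R]_d -> R) :=
  forall (t : 'rV[R]_d) (x y : R), 0 <= x -> x <= y -> C (y *: t) <= C (x *: t).

Definition zero_drift U (mu : 'rV[R]_d -> R) := forall t, U t -> mu t = 0.

Definition peaked_drift T U (delta0 : R) (mu : 'rV[R]_d -> R) :=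
  (forall t, U t -> times_differentiable 2 mu t /\
    (fun e => mu (t + e) - mu t -
              (dotv e (gradient mu t) + 2%:R^-1 * quadform (hessian mu t) e))
      =O_ (0 : 'rV[R]_d) (fun e => `|e| `^ (2%:R + delta0))) /\
  exists ts, [/\ T^° ts, forall t, T t -> t != ts -> mu t < mu ts &
                 negative_definite (hessian mu ts)].

Definition drift_condition T U (delta0 : R) (mu : 'rV[R]_d -> R) :=
  zero_drift U mu \/ peaked_drift T U delta0 mu.

End conditions.

Section exponential_integral.
Context {R : realType} {dO : measure_display} {O : measurableType dO}.
Variable P : probability O R.
Context {d : nat}.
Variables (T : set 'rV[R]_d) (f : 'rV[R]_d -> {RV P >-> R}).
Variables (sigma : R) (mu : 'rV[R]_d -> R).

Definition exp_field (t : 'rV[R]_d) (w : O) : R := expR (sigma * f t w + mu t).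

Definition exp_integral (w : O) : \bar R :=
  (\int[lebesgue_rV d]_(t in T) (exp_field t w)%:E)%E.

Definition lattice (N : nat) : set 'rV[R]_d :=
  [set t | forall j, exists i : int, t ord0 j = i%:~R / N%:R].

Definition cell (N : nat) (t : 'rV[R]_d) : set 'rV[R]_d :=
  [set s | T s /\ forall j, t ord0 j - N%:R^-1 < s ord0 j <= t ord0 j].

Definition lattice_points (N : nat) : set 'rV[R]_d :=
  [set t | lattice N t /\ cell N t !=set0].

Definition lattice_sum (N : nat) (w : O) : \bar R :=
  (\sum_(t \in lattice_points N)
     lebesgue_rV d (cell N t) * (exp_field t w)%:E)%E.

(* Paths are regular only almost surely, so that the event below belongs to   *)
(* the completion of the sigma-algebra of P: its probability is taken with    *)
(* the outer measure of P, which extends both P and its completion.           *)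
Definition tail_prob (b : R) : R :=
  fine (mu_ext P [set w | (b%:E < exp_integral w)%E]).

Definition lattice_tail_prob (N : nat) (b : R) : R :=
  fine (P [set w | (b%:E < lattice_sum N w)%E]).

End exponential_integral.

(* Main.v *)
Require Import Defs.
From HB Require Import structures.
From mathcomp Require Import all_boot all_order all_algebra.
From mathcomp Require Import all_classical all_reals all_analysis.
From mathcomp Require Import measurable_realfun ring lra.

Set Implicit Arguments.
Unset Strict Implicit.
Unset Printing Implicit Defensive.

Import Order.TTheory GRing.Theory Num.Theory.
Import numFieldNormedType.Exports.

Local Open Scope classical_set_scope.
Local Open Scope ring_scope.

(** Write [I] for the integral of [exp (sigma f + mu)] over [T], [I_N] for its
    lattice sum and [L = ln b]. The relative error is controlled by three
    estimates that hold for all small meshes.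

    Comparison. Chaining along the lattices of mesh [1 / (N 4^k)] bounds the
    distance from [f] at a point of [T] to [f] at the corner of its cell by
    [2 K / N], outside an event whose probability is at most
    [Q N^(2d) exp (- K^2 / (4 A))] ([chaining]). Off this event [ln I] and
    [ln I_N] differ by at most [delta = (2 sigma K + Lmu) / N], so that the tail
    of [I] at [b] lies between those of [I_N] at [b exp delta] and at
    [b exp (- delta)], up to that probability ([tail_comparison]).

    Anticoncentration. These two tails of [I_N] have to be close to its tail at
    [b]. Some combination [Z] of finitely many values of [f] has variance [1] and
    covariance at least [c > 0] with every [f p], [p] near [T]
    ([positive_direction]). By the Cameron-Martin formula, adding
    [s Cov (f p, Z)] to every [f p] changes probabilities by a factor at most
    [exp (s K')], up to a Gaussian tail beyond [K' - s] ([cameron_martin_le]). It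
    also multiplies [I_N] by at least [exp (sigma c s)]. Choosing [s] with
    [sigma c s = delta], a change of level by the factor [exp delta] costs a
    factor [exp (s K')] and a Gaussian tail ([exp_sum_anticoncentration]).

    Lower bound. The additive errors are compared with the tail of [I] itself. By
    Jensen, [ln I_N] exceeds, up to a constant, [sigma] times a weighted mean of
    the values of [f]; the variance of such a mean is bounded below by a constant
    ([cov_form_lower_bound]), so the tail at [b] is at least
    [c1 exp (- E L^2)] ([tail_lower_bound]).

    With [a] of order [ln N + ln (1 / eps) + L^2] and [K], [K'] of order [sqrt a], all
    additive errors are at most [eps / 8] times the tail of [I], and the
    multiplicative loss [exp (s K')], where [s K'] is of order [a / N], is at most
    [1 + eps / 8] as soon as [a] is small compared with [eps N]. This is what the
    condition on [N] provides ([sample_size], [tail_estimate]).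

    The monotonicity of [C] along rays enters in the bound on variances: if a
    mean of values of [f] had a small variance, so would its images under
    dilations, by monotonicity, and then its covariances with [f y] before and
    after a dilation about [y] would both be small; but they differ by a
    definite amount because [C] decreases strictly near the origin.

    Gaussianity of the field is a statement on real linear combinations. The law
    of a vector of values is recovered from it through characteristic functions:
    a law on [R^n] is determined by the means of [cos (a . x + c)]
    ([cramer_wold]), and those of a Gaussian variable come from the differential
    equation given by Stein's identity ([gaussian_characteristic]). *)

(** * Bounded and finite-sum integrands *)

Section bounded_measurable.
Context {R : realType} {d : measure_display} {T : measurableType d}.

Definition bounded_measurable (g : T -> R) :=
  measurable_fun setT g /\ exists M, forall x, `|g x| <= M.

Lemma bounded_measurable_integrable (m : probability T R) g :
  bounded_measurable g -> m.-integrable setT (EFin \o g).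
Proof.
move=> [mg [M gM]]; apply: measurable_bounded_integrable => //.
  by rewrite (le_lt_trans (probability_le1 _ _)) ?ltry.
exists M; split; first exact: num_real.
by move=> x /ltW Mx y _; exact: le_trans (gM y) Mx.
Qed.

(** Dominated convergence, a constant being integrable for a probability. *)
Lemma Rintegral_bounded_cvg (m : probability T R) (g_ : nat -> T -> R)
    (g : T -> R) (M : R) :
  (forall k, measurable_fun setT (g_ k)) -> measurable_fun setT g ->
  (forall k x, `|g_ k x| <= M) ->
  (forall x, g_ ^~ x @ \oo --> g x) ->
  \int[m]_x g_ k x @[k --> \oo] --> \int[m]_x g x.
Proof.
move=> mg_ mg gM cg; apply: fine_cvg.
have ig : m.-integrable setT (EFin \o g).
  apply: bounded_measurable_integrable; split => //; exists M => x.
  apply: (@closed_cvg _ _ \oo _ (fun k => g_ k x) [set y | `|y| <= M]) => //.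
    apply: (@closed_comp _ _ (fun y : R => `|y|) [set y | y <= M]).
      by move=> *; exact: norm_continuous.
    exact: closed_le.
  by apply: nearW => k; exact: gM.
rewrite fineK; last first.
  by apply: integrable_fin_num.
apply: (@dominated_cvg _ _ _ _ _ _ _ _ (fun=> M%:E)) => //.
- by move=> k; exact/measurable_EFinP.
- move=> x _; apply/fine_cvgP; split; first exact: nearW.
  exact: cg.
- apply: (@bounded_measurable_integrable _ (fun=> M)).
  by split => //; exists `|M|.
- by move=> k x _; rewrite lee_fin.
Qed.

End bounded_measurable.

Section Rintegral_sum.
Context {R : realType} {d : measure_display} {O : measurableType d}.
Variable P : probability O R.

Lemma integrable_Rsum (I : Type) (s : seq I) (g : I -> O -> R) :
  (forall i, P.-integrable setT (EFin \o g i)) ->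
  P.-integrable setT (EFin \o (fun w => \sum_(i <- s) g i w)).
Proof.
move=> ig; elim: s => [|i s IH].
  rewrite (_ : EFin \o _ = fun=> 0%E); first exact: integrable0.
  by apply/funext => w /=; rewrite big_nil.
rewrite (_ : EFin \o _ = ((EFin \o g i) \+ (EFin \o (fun w => (\sum_(i <- s) g i w)%R)))%E).
  exact: integrableD.
by apply/funext => w /=; rewrite big_cons EFinD.
Qed.

Lemma Rintegral_sum (I : Type) (s : seq I) (g : I -> O -> R) :
  (forall i, P.-integrable setT (EFin \o g i)) ->
  \int[P]_w (\sum_(i <- s) g i w) = \sum_(i <- s) \int[P]_w g i w.
Proof.
move=> ig; elim: s => [|i s IH].
  rewrite big_nil; under eq_Rintegral do rewrite big_nil.
  by rewrite Rintegral_cst// mul0r.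
rewrite big_cons -IH -RintegralD//; last exact: integrable_Rsum.
by apply: eq_Rintegral => w _; rewrite big_cons.
Qed.

Lemma integrable_Rscale (c : R) (g : O -> R) :
  P.-integrable setT (EFin \o g) -> P.-integrable setT (EFin \o (fun w => c * g w)).
Proof.
move=> ig; rewrite (_ : EFin \o _ = fun w => (c%:E * (EFin \o g) w)%E).
  exact: integrableZl.
by apply/funext => w /=; rewrite EFinM.
Qed.

End Rintegral_sum.

(** * Trigonometric approximation of the step function *)

Section step_approximation.
Context {R : realType}.

(** With [y = (1 - u) / 2] this polynomial in [u] is close to
    [exp (- k (2 y)^k)]: it tends to [1] if [2 y < 1] and to [0] if [2 y >= 1], the
    factor [k] settling the case [u = 0]. *)
Definition step_approx (k : nat) (u : R) :=
  (1 - ((1 - u) / 2) ^+ k) ^+ (k * 2 ^ k).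

Lemma bernoulli_onem (t : R) n : 0 <= t <= 1 -> 1 - n%:R * t <= (1 - t) ^+ n.
Proof.
move=> /andP[t0 t1]; elim: n => [|n IH]; first by rewrite mul0r subr0 expr0.
rewrite exprS; have : (1 - t) * (1 - n%:R * t) <= (1 - t) * (1 - t) ^+ n.
  by apply: ler_wpM2l => //; lra.
apply: le_trans; rewrite -natr1.
have : 0 <= n%:R * t ^+ 2 :> R by rewrite mulr_ge0// sqr_ge0.
nra.
Qed.

Lemma onem_expn_le (t : R) n : t <= 1 -> (1 - t) ^+ n <= expR (- (t * n%:R)).
Proof.
move=> t1; rewrite -mulNr mulrC expRM_natl.
apply: lerXn2r; rewrite ?nnegrE ?expR_ge0//; first by lra.
exact: expR_ge1Dx.
Qed.

Lemma step_approx01 k u : `|u| <= 1 -> 0 <= step_approx k u <= 1.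
Proof.
rewrite ler_norml => /andP[u1 u2].
have y01 : 0 <= (1 - u) / 2 <= 1 by apply/andP; split; lra.
have /andP[y0 y1] : 0 <= ((1 - u) / 2) ^+ k <= 1.
  by case/andP: y01 => *; rewrite exprn_ge0//= exprn_ile1.
by rewrite /step_approx exprn_ge0 ?subr_ge0//= exprn_ile1 ?subr_ge0// gerBl.
Qed.

(** For [u > 0] Bernoulli's inequality bounds the distance to [1] by
    [k (1 - u)^k]; for [u <= 0] the value is at most [exp (- k)]. *)
Lemma cvg_step_approx u : `|u| <= 1 ->
  step_approx k u @[k --> \oo] --> ((0 < u)%R%:R : R).
Proof.
move=> u1; have /andP[ul ur] : -1 <= u <= 1 by rewrite -ler_norml.
have cvgV c : c / k.+1%:R @[k --> \oo] --> (0 : R).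
  by rewrite -[X in _ --> X](mulr0 c); apply: cvgMr; exact: cvg_harmonic.
rewrite -cvg_shiftS; have [u0|u0] := ltP 0 u.
- apply: (@squeeze_cvgr _ _ _ _ (fun k => 1 - (4 / u ^+ 2) / k.+1%:R) (fun=> 1)).
  + apply: nearW => k.
    case/andP: (step_approx01 k.+1 u1) => _ ->; rewrite andbT.
    have y01 : 0 <= ((1 - u) / 2) ^+ k.+1 <= 1.
      by rewrite exprn_ge0 ?exprn_ile1//=; lra.
    apply: le_trans (bernoulli_onem _ y01); rewrite lerD2l lerN2.
    rewrite natrM natrX -mulrA -exprMn mulrC [2 * _]mulrC divfK//.
    have uk := onem_expn_le k.+1 ur.
    have e1 : expR (- (u * k.+1%:R)) <= 4 / (u * k.+1%:R) ^+ 2.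
      have x0 : 0 < u * k.+1%:R by rewrite mulr_gt0.
      rewrite expRN -[leRHS]invrK lef_pV2 ?posrE ?expR_gt0 ?invr_gt0 ?divr_gt0 ?exprn_gt0//.
      rewrite invf_div; apply: le_trans (expR_ge1Dxn 1 (ltW x0)).
      rewrite (_ : (2`!)%:R = 2 :> R)//.
      have := sqr_ge0 (u * k.+1%:R); lra.
    apply: le_trans (ler_wpM2r (ler0n R k.+1) (le_trans uk e1)) _.
    rewrite exprMn; have := gt_eqF u0; have : k.+1%:R != 0 :> R by rewrite pnatr_eq0.
    move=> k0 /negbT uu; rewrite le_eqVlt; apply/orP; left; apply/eqP.
    by field; rewrite uu nat1r k0.
  + rewrite -[X in _ --> X]subr0; apply: cvgB; first exact: cvg_cst.
    exact: cvgV.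
  + exact: cvg_cst.
- apply: (@squeeze_cvgr _ _ _ _ (fun=> 0) (fun k => 1 / k.+1%:R)).
  + apply: nearW => k.
    case/andP: (step_approx01 k.+1 u1) => -> _ /=.
    have y1 : ((1 - u) / 2) ^+ k.+1 <= 1 by rewrite exprn_ile1//; lra.
    apply: le_trans (onem_expn_le _ y1) _.
    rewrite natrM natrX mulrCA -exprMn expRN div1r lef_pV2 ?posrE ?expR_gt0//.
    apply: le_trans (expR_ge1Dx _).
    have : k.+1%:R * 1 <= k.+1%:R * ((1 - u) / 2 * 2) ^+ k.+1 :> R.
      by apply: ler_wpM2l => //; rewrite exprn_ege1//; lra.
    by rewrite mulr1; lra.
  + exact: cvg_cst.
  + exact: cvgV.
Qed.

End step_approximation.

(** * A law on R^n is determined by the means of its cosines *)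

Section cramer_wold.
Context {R : realType} {n : nat}.
Implicit Types (a x : 'rV[R]_n) (p q : 'rV[R]_n -> R).

Lemma dotvE a x : dotv a x = \sum_i a ord0 i * x ord0 i.
Proof. by rewrite /dotv mxE; apply: eq_bigr => i _; rewrite mxE. Qed.

Lemma dotvDl a b x : dotv (a + b) x = dotv a x + dotv b x.
Proof. by rewrite /dotv mulmxDl mxE. Qed.

Lemma dotvNl a x : dotv (- a) x = - dotv a x.
Proof. by rewrite /dotv mulNmx mxE. Qed.

Lemma dotvZl (k : R) a x : dotv (k *: a) x = k * dotv a x.
Proof. by rewrite /dotv -scalemxAl mxE. Qed.

Lemma dotvC a x : dotv a x = dotv x a.
Proof. by rewrite !dotvE; apply: eq_bigr => i _; rewrite mulrC. Qed.

Lemma measurable_dotv a : measurable_fun setT (dotv a).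
Proof.
rewrite (_ : dotv a = fun x => \sum_i a ord0 i * x ord0 i); last first.
  by apply/funext => x; rewrite dotvE.
apply: measurable_sum => i; apply: measurable_funM => //.
exact: measurable_rV_coord.
Qed.

Lemma measurable_cosR : measurable_fun setT (@cos R).
Proof.
by apply: open_continuous_measurable_fun => //; [exact: openT|move=> x _; exact: continuous_cos].
Qed.

(** The phase [c] makes the family contain constants and sines; product formulas
    make it an algebra, so that polynomials of sines belong to it. *)
Inductive trig_poly : ('rV[R]_n -> R) -> Prop :=
| trig_cos a (c : R) : trig_poly (fun x => cos (dotv a x + c))
| trig_add p q : trig_poly p -> trig_poly q -> trig_poly (fun x => p x + q x)
| trig_scale (k : R) p : trig_poly p -> trig_poly (fun x => k * p x).

Lemma trig_cst (k : R) : trig_poly (fun=> k).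
Proof.
rewrite (_ : (fun _ => k) = fun x => k * cos (dotv 0 x + 0)).
  exact/trig_scale/trig_cos.
by apply/funext => x; rewrite /dotv mul0mx mxE addr0 cos0 mulr1.
Qed.

Lemma trig_mul p q : trig_poly p -> trig_poly q -> trig_poly (fun x => p x * q x).
Proof.
move=> tp; elim: tp q => {p} [a c|p1 p2 _ IH1 _ IH2|k p _ IH] q tq.
- elim: tq => {q} [b e|q1 q2 _ IH1 _ IH2|k q _ IH].
  + rewrite (_ : (fun x => _) = fun x => 2^-1 * cos (dotv (a + b) x + (c + e))
                                + 2^-1 * cos (dotv (a - b) x + (c - e))).
      by apply: trig_add; apply/trig_scale/trig_cos.
    apply/funext => x; rewrite !dotvDl dotvNl addrACA [X in _ = _ * X + _]cosD.
    rewrite (_ : dotv a x - dotv b x + (c - e) = dotv a x + c - (dotv b x + e));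
      last by ring.
    by rewrite cosB; field.
  + rewrite (_ : (fun x => _) = fun x => cos (dotv a x + c) * q1 x +
      cos (dotv a x + c) * q2 x); last by apply/funext => x; rewrite mulrDr.
    exact: trig_add.
  + rewrite (_ : (fun x => _) = fun x => k * (cos (dotv a x + c) * q x));
      last by apply/funext => x; rewrite mulrCA.
    exact: trig_scale.
- rewrite (_ : (fun x => _) = fun x => p1 x * q x + p2 x * q x);
    last by apply/funext => x; rewrite mulrDl.
  by apply: trig_add; [exact: IH1|exact: IH2].
- rewrite (_ : (fun x => _) = fun x => k * (p x * q x));
    last by apply/funext => x; rewrite mulrA.
  by apply: trig_scale; exact: IH.
Qed.

Lemma trig_exp p k : trig_poly p -> trig_poly (fun x => p x ^+ k).
Proof.
move=> tp; elim: k => [|k IH].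
  by under eq_fun do rewrite expr0; exact: trig_cst.
by under eq_fun do rewrite exprS; exact: trig_mul.
Qed.

Lemma trig_prod (I : Type) (s : seq I) (p : I -> 'rV[R]_n -> R) :
  (forall i, trig_poly (p i)) -> trig_poly (fun x => \prod_(i <- s) p i x).
Proof.
move=> tp; elim: s => [|i s IH].
  by under eq_fun do rewrite big_nil; exact: trig_cst.
by under eq_fun do rewrite big_cons; exact: trig_mul.
Qed.

Lemma trig_bounded p : trig_poly p -> bounded_measurable p.
Proof.
elim=> {p} [a c|p q _ [mp [M pM]] _ [mq [N qN]]|k p _ [mp [M pM]]]; split.
- apply: measurableT_comp; first exact: measurable_cosR.
  by apply: measurable_funD => //; exact: measurable_dotv.
- by exists 1 => x; rewrite ler_norml cos_geN1 cos_le1.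
- exact: measurable_funD.
- by exists (M + N) => x; apply: (le_trans (ler_normD _ _)); exact: lerD.
- by apply: measurable_funM.
- by exists (`|k| * M) => x; rewrite normrM ler_wpM2l.
Qed.

Variables m1 m2 : probability 'rV[R]_n R.
Hypothesis cosE : forall a c,
  \int[m1]_x cos (dotv a x + c) = \int[m2]_x cos (dotv a x + c).

Let trigE p : trig_poly p -> \int[m1]_x p x = \int[m2]_x p x.
Proof.
elim=> {p} [a c|p q tp pE tq qE|k p tp pE]; first exact: cosE.
- by rewrite !RintegralD//; [rewrite pE qE|exact/bounded_measurable_integrable/trig_bounded..].
- by rewrite !RintegralZl//; [rewrite pE|exact/bounded_measurable_integrable/trig_bounded..].
Qed.

(** A step function of a sine is a bounded limit of polynomials of that sine. *)
Let sin_indicE (c : 'rV[R]_n) (alpha : R) :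
  \int[m1]_x \prod_i (0 < sin (alpha * (x ord0 i - c ord0 i)))%R%:R =
  \int[m2]_x \prod_i (0 < sin (alpha * (x ord0 i - c ord0 i)))%R%:R.
Proof.
pose p k (x : 'rV[R]_n) := \prod_i step_approx k (sin (alpha * (x ord0 i - c ord0 i))).
pose g (x : 'rV[R]_n) : R := \prod_i (0 < sin (alpha * (x ord0 i - c ord0 i)))%R%:R.
have tp k : trig_poly (p k).
  apply: trig_prod => i; apply: trig_exp.
  rewrite (_ : (fun x => _) = fun x => 1 + (-1) *
     (2^-1 + (- 2^-1) * cos (dotv (alpha *: delta_mx ord0 i) x + (- (alpha * c ord0 i) - pi / 2))) ^+ k).
    apply: trig_add; first exact: trig_cst.
    apply: trig_scale; apply: trig_exp; apply: trig_add; first exact: trig_cst.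
    by apply: trig_scale; exact: trig_cos.
  apply/funext => x; rewrite dotvZl addrA cosBpihalf.
  rewrite (_ : dotv _ _ = x ord0 i); last first.
    by rewrite /dotv -rowE !mxE.
  by rewrite mulN1r -mulrBr; congr (1 - _ ^+ k); field.
have pg x : p ^~ x @ \oo --> g x.
  apply: (@cvg_big _ _ _ _ _ _ _ _ _ (fun i k => step_approx k (sin (alpha * (x ord0 i - c ord0 i))))) => //.
    exact: mul_continuous.
  by move=> i _; apply: cvg_step_approx; rewrite ler_norml sin_geN1 sin_le1.
have p1 k x : `|p k x| <= 1.
  rewrite normr_prod; apply: prodr_ile1 => i _.
  have /andP[h0 h1] : 0 <= step_approx k (sin (alpha * (x ord0 i - c ord0 i))) <= 1.
    by apply: step_approx01; rewrite ler_norml sin_geN1 sin_le1.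
  by rewrite ger0_norm// h0.
have mp k : measurable_fun setT (p k) by have [] := trig_bounded (tp k).
have mg : measurable_fun setT g.
  apply: (measurable_fun_cvg mp) => x _; exact: pg.
have c1 := Rintegral_bounded_cvg (m := m1) mp mg p1 pg.
have c2 := Rintegral_bounded_cvg (m := m2) mp mg p1 pg.
have eqp : (fun k => \int[m1]_x p k x) = (fun k => \int[m2]_x p k x).
  by apply/funext => k; exact: trigE.
by rewrite eqp in c1; exact: (cvg_unique _ c1 c2).
Qed.

Definition orthant (c : 'rV[R]_n) : set 'rV[R]_n :=
  [set x | forall i, c ord0 i < x ord0 i].

Lemma measurable_orthant c : measurable (orthant c).
Proof.
rewrite (_ : orthant c = \bigcap_(i in [set: 'I_n])
    ((fun x : 'rV[R]_n => x ord0 i : measurableTypeR R) @^-1` `]c ord0 i, +oo[)).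
  apply: fin_bigcap_measurable => // i _; rewrite -[X in measurable X]setTI.
  by apply: measurable_rV_coord => //; exact: measurable_itv.
apply/seteqP; split => x /= H i; first by move=> _; rewrite /= in_itv/= andbT.
by have := H i Logic.I; rewrite /= in_itv/= andbT.
Qed.

(** As the frequency tends to [0], the sign of [sin (alpha (x_i - c_i))] is
    eventually that of [x_i - c_i]. *)
Let orthantE c : m1 (orthant c) = m2 (orthant c).
Proof.
pose p k (x : 'rV[R]_n) : R :=
  \prod_i (0 < sin (k.+1%:R^-1 * (x ord0 i - c ord0 i)))%R%:R.
pose g (x : 'rV[R]_n) : R := \prod_i (c ord0 i < x ord0 i)%R%:R.
have gE x : g x = \1_(orthant c) x.
  rewrite indicE; have [/asboolP h|/asboolP h] := boolP `[<orthant c x>].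
    by rewrite mem_set// /g big1// => i _; rewrite h.
  rewrite memNset//; apply/eqP; rewrite prodf_seq_eq0.
  have /existsNP[i /negP ci] : ~ (forall i, c ord0 i < x ord0 i) := h.
  by apply/hasP; exists i; rewrite ?mem_index_enum//= (negbTE ci).
have pg x : p ^~ x @ \oo --> (\1_(orthant c) x : R).
  rewrite -gE.
  apply: (@cvg_big _ _ _ _ _ _ _ _ _
      (fun i k => (0 < sin (k.+1%:R^-1 * (x ord0 i - c ord0 i)))%R%:R : R)) => //.
    exact: mul_continuous.
  move=> i _; have c0 : k.+1%:R^-1 * (x ord0 i - c ord0 i) @[k --> \oo] --> (0 : R).
    by rewrite -[X in _ --> X](mul0r (x ord0 i - c ord0 i)); apply: cvgMl; exact: cvg_harmonic.
  apply: cvg_near_cst; near=> k.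
  have : `|k.+1%:R^-1 * (x ord0 i - c ord0 i)| < 2.
    by near: k; apply: cvgr0_norm_lt => //; exact: c0.
  have k0 : 0 < k.+1%:R^-1 :> R by rewrite invr_gt0.
  rewrite ltr_norml => /andP[h1 h2]; congr (nat_of_bool _)%:R.
  have [ci|ci] := ltP (c ord0 i) (x ord0 i).
    by apply: sin2_gt0; rewrite h2 mulr_gt0// subr_gt0.
  apply/negbTE; rewrite -leNgt.
  have [->|ne] := eqVneq (x ord0 i) (c ord0 i); first by rewrite subrr mulr0 sin0.
  rewrite -oppr_ge0 -sinN ltW// sin2_gt0//; apply/andP; split; last by rewrite ltrNl.
  by rewrite oppr_gt0 pmulr_rlt0// subr_lt0 lt_neqAle ne.
have mp k : measurable_fun setT (p k).
  apply: measurable_prod => i _.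
  have ms : measurable_fun setT (fun x : 'rV[R]_n => sin (k.+1%:R^-1 * (x ord0 i - c ord0 i))).
    under eq_fun do rewrite -cosBpihalf.
    apply: measurableT_comp; first exact: measurable_cosR.
    apply: measurable_funB => //; apply: measurable_funM => //.
    by apply: measurable_funB => //; exact: measurable_rV_coord.
  apply: (@measurableT_comp _ _ _ _ _ _ (fun b : bool => b%:R : R)) => //.
  exact: measurable_fun_ltr.
have p1 k x : `|p k x| <= 1.
  rewrite normr_prod; apply: prodr_ile1 => i _.
  by rewrite ger0_norm ?ler0n//= lern1 leq_b1.
have mg : measurable_fun setT (\1_(orthant c) : _ -> R).
  by apply: measurable_indic; exact: measurable_orthant.
have c1 := Rintegral_bounded_cvg (m := m1) mp mg p1 pg.
have c2 := Rintegral_bounded_cvg (m := m2) mp mg p1 pg.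
have eqp : (fun k => \int[m1]_x p k x) = (fun k => \int[m2]_x p k x).
  by apply/funext => k; exact: sin_indicE.
rewrite eqp in c1; have := cvg_unique _ c1 c2.
rewrite /Rintegral !integral_indic ?setIT//; [|exact: measurable_orthant..].
move=> H; rewrite -[LHS]fineK ?H ?fineK// fin_num_measure//; exact: measurable_orthant.
Unshelve. all: by end_near. Qed.

(** An open half-space bounded in the coordinate [i] is the increasing union of
    the orthants whose other coordinates tend to minus infinity. *)
Lemma measurable_rVE :
  @measurable _ 'rV[R]_n = <<s [set A | exists c, A = orthant c] >>.
Proof.
apply/seteqP; split; last first.
  apply: smallest_sub; first exact: sigma_algebra_measurable.
  by move=> _ [c ->]; exact: measurable_orthant.
move=> A mA.
pose G := [set A | exists c, A = orthant c].
have mid : measurable_fun setT (id : g_sigma_algebraType G -> 'rV[R]_n).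
  apply: measurable_fun_rVP => i.
  apply: (measurability _ (RGenOInfty.measurableE R)) => _ [_ [x ->] <-].
  rewrite setTI (_ : _ @^-1` _ = \bigcup_k
      orthant (\row_j if j == i then x else - k%:R)).
    apply: bigcup_measurable => k _; apply: sub_sigma_algebra.
    by exists (\row_j if j == i then x else - k%:R).
  apply/seteqP; split => [y|y [k _]] /=; rewrite in_itv/= andbT; last first.
    by move=> /(_ i); rewrite mxE eqxx.
  move=> xy; exists (Num.truncn (\sum_j `|y ord0 j|)).+1 => // j; rewrite mxE.
  case: eqP => [->//|_]; rewrite ltrNl.
  apply: (@le_lt_trans _ _ (\sum_j `|y ord0 j|)); last exact: truncnS_gt.
  rewrite (bigD1 j)//= -[leLHS]addr0 lerD ?sumr_ge0//.
  by rewrite -normrN ler_norm.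
by have := mid measurableT A mA; rewrite setTI preimage_id.
Qed.

(** The two laws agree on open orthants, which are stable under intersection and
    generate the Borel sets. *)
Theorem cramer_wold A : measurable A -> m1 A = m2 A.
Proof.
apply: (@measure_unique _ _ _ [set A | exists c, A = orthant c]
  (fun k => orthant (\row_j - k%:R))).
- exact: measurable_rVE.
- move=> _ _ [a ->] [b ->]; exists (\row_j Num.max (a ord0 j) (b ord0 j)).
  apply/seteqP; split => x /=.
    by move=> [xa xb] j; rewrite mxE gt_max xa xb.
  by move=> H; split => j; have := H j; rewrite mxE gt_max => /andP[].
- by move=> k; exists (\row_j - k%:R).
- apply/seteqP; split => // x _; exists (Num.truncn (\sum_j `|x ord0 j|)).+1 => // j.
  rewrite mxE ltrNl; apply: (@le_lt_trans _ _ (\sum_j `|x ord0 j|)); last exact: truncnS_gt.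
  rewrite (bigD1 j)//= -[leLHS]addr0 lerD ?sumr_ge0//.
  by rewrite -normrN ler_norm.
- by move=> _ [c ->]; exact: orthantE.
- by move=> k; rewrite (le_lt_trans (probability_le1 _ _)) ?ltry//; exact: measurable_orthant.
Qed.

End cramer_wold.

(** * Integrals against a density *)

Section density.
Context {d : measure_display} {T : measurableType d} {R : realType}.
Variables (m : {measure set T -> \bar R}) (nu : {measure set T -> \bar R}).
Variable p : T -> R.
Hypothesis p0 : forall x, 0 <= p x.
Hypothesis mp : measurable_fun setT p.
Hypothesis nuE : forall A, measurable A -> nu A = (\int[m]_(x in A) (p x)%:E)%E.

Import HBNNSimple.

Let nnsfun_density (g : {nnsfun T >-> R}) :
  (\int[nu]_x (g x)%:E = \int[m]_x ((g x)%:E * (p x)%:E))%E.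
Proof.
under eq_integral do rewrite fimfunE -fsumEFin//.
rewrite ge0_integral_fsum//; last 2 first.
- by move=> y; exact/measurable_EFinP/measurable_funM.
- by move=> y x _; rewrite nnfun_muleindic_ge0.
transitivity (\int[m]_x (\sum_(y \in range g)
    ((y * \1_(g @^-1` [set y]) x)%:E * (p x)%:E)))%E; last first.
  apply: eq_integral => x _; rewrite -ge0_mule_fsuml; last first.
    by move=> y; rewrite nnfun_muleindic_ge0.
  by rewrite fsumEFin// -fimfunE.
rewrite ge0_integral_fsum//; last 2 first.
- move=> y; apply: emeasurable_funM; last exact/measurable_EFinP.
  exact/measurable_EFinP/measurable_funM.
- by move=> y x _; rewrite mule_ge0 ?nnfun_muleindic_ge0// lee_fin.
apply: eq_fsbigr => y _; rewrite integralZl_indic_nnsfun// integral_indic//= setIT.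
rewrite nuE//; have [y0|y0] := leP 0 y; last first.
  rewrite preimage_nnfun0// integral_set0 mule0.
  by rewrite integral0_eq// => x _; rewrite indic0 mulr0 mul0e.
under [RHS]eq_integral do rewrite EFinM -muleA.
rewrite ge0_integralZl_EFin//.
- congr (_ * _)%E; rewrite [LHS]integral_mkcond; apply: eq_integral => x _.
  by rewrite patchE indicE; case: ifP => _; rewrite ?mul1e ?mul0e.
- by move=> x _; rewrite mule_ge0// lee_fin.
- apply: emeasurable_funM; last exact/measurable_EFinP.
  by apply/measurable_EFinP; exact: measurable_indic.
Qed.

(** True for simple functions by additivity; monotone convergence extends it. *)
Lemma ge0_integral_density (f : T -> \bar R) :
  measurable_fun setT f -> (forall x, 0 <= f x)%E ->
  (\int[nu]_x f x = \int[m]_x (f x * (p x)%:E))%E.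
Proof.
move=> mf f0; pose g := nnsfun_approx measurableT mf.
have gf x : (g n x)%:E @[n --> \oo] --> f x by apply: cvg_nnsfun_approx.
have nd x : {homo (fun n => (g n x)%:E) : a b / (a <= b)%N >-> (a <= b)%E}.
  by move=> a b ab; rewrite lee_fin; exact/lefP/nd_nnsfun_approx.
have h1 : ((\int[nu]_x (g n x)%:E)%E @[n --> \oo] --> \int[nu]_x f x)%E.
  rewrite (_ : (fun x => f x) = fun x => limn (fun n => (g n x)%:E)); last first.
    by apply/funext => x; apply/esym/cvg_lim => //; exact: gf.
  apply: cvg_monotone_convergence => //.
  - by move=> n; exact/measurable_EFinP.
  - by move=> n x _; rewrite lee_fin.
have h2 : ((\int[m]_x ((g n x)%:E * (p x)%:E))%E @[n --> \oo] --> \int[m]_x (f x * (p x)%:E))%E.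
  rewrite (_ : (fun x => f x * _)%E = fun x => limn (fun n => (g n x)%:E * (p x)%:E)%E); last first.
    by apply/funext => x; apply/esym/cvg_lim => //; apply: cvgeZr => //; exact: gf.
  apply: cvg_monotone_convergence => //.
  - by move=> n; apply: emeasurable_funM; exact/measurable_EFinP.
  - by move=> n x _; rewrite mule_ge0// lee_fin.
  - by move=> x _ a b ab; apply: lee_wpmul2r; [rewrite lee_fin|exact: nd].
have E : (fun n => \int[nu]_x (g n x)%:E)%E = (fun n => \int[m]_x ((g n x)%:E * (p x)%:E))%E.
  by apply/funext => n; exact: nnsfun_density.
by rewrite E in h1; exact: (cvg_unique _ h1 h2).
Qed.

Lemma integrable_density (f : T -> R) : measurable_fun setT f ->
  m.-integrable setT (fun x => (f x * p x)%:E) -> nu.-integrable setT (EFin \o f).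
Proof.
move=> mf /integrableP[_ fi]; apply/integrableP; split; first exact/measurable_EFinP.
rewrite ge0_integral_density//; last first.
  by apply: measurableT_comp => //; exact/measurable_EFinP.
apply: le_lt_trans fi; rewrite le_eqVlt; apply/orP; left; apply/eqP.
by apply: eq_integral => x _; rewrite /= normrM (ger0_norm (p0 x)).
Qed.

Lemma Rintegral_density (f : T -> R) : measurable_fun setT f ->
  m.-integrable setT (fun x => (f x * p x)%:E) ->
  \int[nu]_x f x = \int[m]_x (f x * p x).
Proof.
move=> mf fi; rewrite /Rintegral; congr fine.
have mF : measurable_fun setT (EFin \o f) by exact/measurable_EFinP.
rewrite integralE [RHS]integralE !ge0_integral_density//; [|exact: measurable_funeneg|exact: measurable_funepos].
congr (_ - _)%E; apply: eq_integral => x _.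
- by rewrite !funeposE -EFin_max -EFinM maxr_pMl// mul0r EFin_max.
- rewrite !funenegE -!EFinN -!EFin_max -EFinM maxr_pMl// mul0r.
  by rewrite mulNr EFin_max.
Qed.

End density.

(** * Affine images of the standard Gaussian law *)

Section affine_map.
Context {R : realType}.

(** Named so that it can carry the measurability instance used in pushforwards. *)
Definition affine_map (m a : R) (z : measurableTypeR R) : measurableTypeR R :=
  m + a * z.

Lemma measurable_affine_map m a : measurable_fun setT (affine_map m a).
Proof. by apply: measurable_funD => //; apply: measurable_funM. Qed.

HB.instance Definition _ m a :=
  isMeasurableFun.Build _ _ _ _ (affine_map m a) (measurable_affine_map m a).

Lemma measurable_affine_preimage m a (A : set (measurableTypeR R)) :
  measurable A -> measurable (affine_map m a @^-1` A).
Proof. by move=> mA; rewrite -[X in measurable X]setTI; exact: measurable_affine_map. Qed.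

(** Both sides are measures that agree on intervals. *)
Lemma lebesgue_measure_affine m a (A : set (measurableTypeR R)) :
  a != 0 -> measurable A ->
  lebesgue_measure A = (`|a|%:E * lebesgue_measure (affine_map m a @^-1` A))%E.
Proof.
move=> a0 mA.
pose m1 : {measure set (measurableTypeR R) -> \bar R} := mscale (NngNum (normr_ge0 a))
  (pushforward (@lebesgue_measure R) (affine_map m a)).
rewrite -[RHS]/(m1 (measurable_affine_map m a) A); apply: lebesgue_measure_unique => //= _ [[x y]] _ <-.
rewrite /m1 /mscale/= lebesgue_measure_itv/= lte_fin /pushforward.
have [an|ap] := ltrP a 0.
  rewrite (_ : _ @^-1` _ = `[(y - m) / a, (x - m) / a[%classic).
    rewrite lebesgue_measure_itv/= lte_fin ltr_nM2r ?invr_lt0// ltrD2r.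
    case: ifP => xy; last by rewrite mule0.
    rewrite ltr0_norm// -!EFinD -EFinM; congr EFin.
    by field; rewrite lt_eqF.
  apply/seteqP; split => z; rewrite /= !in_itv/= /affine_map ler_ndivrMr// ltr_ndivlMr//;
    by rewrite [z * a]mulrC lerBrDl ltrBlDl andbC.
have {a0}ap : 0 < a by rewrite lt_neqAle eq_sym a0.
rewrite (_ : _ @^-1` _ = `](x - m) / a, (y - m) / a]%classic).
  rewrite lebesgue_measure_itv/= lte_fin ltr_pM2r ?invr_gt0// ltrD2r.
  case: ifP => xy; last by rewrite mule0.
  rewrite gtr0_norm// -!EFinD -EFinM; congr EFin.
  by field; rewrite gt_eqF.
apply/seteqP; split => z; rewrite /= !in_itv/= /affine_map ler_pdivlMr// ltr_pdivrMr//;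
  by rewrite [z * a]mulrC lerBrDl ltrBlDl.
Qed.

Lemma ge0_integral_affine m a (g : R -> \bar R) : a != 0 ->
  measurable_fun setT g -> (forall x, 0 <= g x)%E ->
  (\int[lebesgue_measure]_x g x =
   `|a|%:E * \int[lebesgue_measure]_x g (m + a * x)%R)%E.
Proof.
move=> a0 mg g0.
pose m1 : {measure set (measurableTypeR R) -> \bar R} := mscale (NngNum (normr_ge0 a))
  (pushforward (@lebesgue_measure R) (affine_map m a)).
transitivity (\int[m1 (measurable_affine_map m a)]_x g x)%E.
  by apply: eq_measure_integral => A mA _; exact: lebesgue_measure_affine.
by rewrite ge0_integral_mscale//= ge0_integral_pushforward.
Qed.

Local Notation gaussian := (@normal_prob R 0 1).

Lemma normal_pdf_affine (m s z : R) : s != 0 ->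
  `|s| * normal_pdf m s (m + s * z) = normal_pdf 0 1 z.
Proof.
move=> s0; rewrite !normal_pdfE ?oner_neq0// /normal_peak /normal_fun.
rewrite mulrA; congr (_ * expR _).
  rewrite -mulrnAr sqrtrM ?sqr_ge0// sqrtr_sqr invfM mulrA divff ?normr_eq0// mul1r.
  by rewrite expr1n mul1r.
by field.
Qed.

(** Reduces every nondegenerate Gaussian law to the standard one. *)
Lemma normal_prob_affine (m s : R) (A : set (measurableTypeR R)) :
  s != 0 -> measurable A ->
  normal_prob m s A = gaussian (affine_map m s @^-1` A).
Proof.
move=> s0 mA; have mA' := measurable_affine_preimage m s mA.
have mp m' s' : measurable_fun setT (fun x : measurableTypeR R => (normal_pdf m' s' x)%:E).
  by apply/measurable_EFinP; exact: measurable_normal_pdf.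
rewrite /normal_prob integral_mkcond [RHS]integral_mkcond.
rewrite (ge0_integral_affine m s0); first last.
- by apply: erestrict_ge0 => x _; rewrite lee_fin normal_pdf_ge0.
- by apply/(measurable_restrict _ mA) => //; exact: measurable_funTS.
rewrite -ge0_integralZl_EFin//.
- apply: eq_integral => z _; rewrite !patchE.
  rewrite (_ : (_ \in _) = (z \in affine_map m s @^-1` A)); last first.
    by apply/idP/idP; rewrite !inE.
  by case: ifP => _; rewrite ?mule0// -EFinM normal_pdf_affine.
- by move=> z _; apply: erestrict_ge0 => x _; rewrite lee_fin normal_pdf_ge0.
- rewrite (_ : (fun x => _) = (fun x => (normal_pdf m s x)%:E) \_ A \o affine_map m s)//.
  apply: measurableT_comp; last exact: measurable_affine_map.
  by apply/(measurable_restrict _ mA) => //; exact: measurable_funTS.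
Qed.

End affine_map.

(** * Integration by parts against the standard Gaussian law *)

Section gaussian_integrals.
Context {R : realType}.
Local Notation gaussian := (@normal_prob R 0 1).
Local Notation mu := (@lebesgue_measure R).
Local Notation pdf := (@normal_pdf R 0 1).

Lemma normal_pdf01E (x : R) : pdf x = normal_peak 1 * expR (- (x ^+ 2 / 2)).
Proof.
by rewrite normal_pdfE ?oner_neq0// /normal_fun subr0 expr1n mulNr.
Qed.

Lemma is_derive_normal_pdf01 (x : R) : is_derive x 1 pdf (- x * pdf x).
Proof.
rewrite (_ : pdf = fun x => normal_peak 1 * expR (- (x ^+ 2 / 2))); last first.
  by apply/funext => y; exact: normal_pdf01E.
by apply: is_derive_eq; rewrite /GRing.scale/=; field.
Qed.

(** A multiple of the density of variance [2]. It dominates [(1 + x^2) pdf x]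
    because [1 + 4 u <= 4 exp u] for [u = x^2 / 4]. *)
Definition gaussian_dominator (x : R) := normal_peak 1 * (4 * expR (- (x ^+ 2 / 4))).

Lemma integrable_gaussian_dominator :
  mu.-integrable setT (EFin \o gaussian_dominator).
Proof.
have s0 : Num.sqrt (2 : R) != 0 by rewrite gt_eqF// sqrtr_gt0.
rewrite (_ : gaussian_dominator = fun x =>
    (4 * normal_peak 1 / normal_peak (Num.sqrt 2)) * normal_pdf 0 (Num.sqrt 2) x).
  rewrite (_ : EFin \o _ = fun x => ((4 * normal_peak 1 / normal_peak (Num.sqrt 2))%:E
      * (normal_pdf 0 (Num.sqrt 2) x)%:E)%E); last by apply/funext => x /=; rewrite EFinM.
  by apply: integrableZl => //; exact: integrable_normal_pdf.
apply/funext => x; rewrite normal_pdfE// /normal_fun subr0 sqr_sqrtr// mulNr.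
rewrite (_ : 2 *+ 2 = 4 :> R); last by rewrite -mulr_natr -natrM.
rewrite /gaussian_dominator; field.
by rewrite gt_eqF// normal_peak_gt0.
Qed.

Lemma gaussian_dominatorP (x : R) : (1 + x ^+ 2) * pdf x <= gaussian_dominator x.
Proof.
rewrite normal_pdf01E mulrCA /gaussian_dominator ler_wpM2l ?normal_peak_ge0//.
rewrite (_ : x ^+ 2 / 2 = x ^+ 2 / 4 + x ^+ 2 / 4); last by field.
rewrite opprD expRD mulrA ler_wpM2r ?expR_ge0// expRN.
rewrite ler_pdivrMr ?expR_gt0//.
by have := expR_ge1Dx (x ^+ 2 / 4); have := sqr_ge0 x; lra.
Qed.

Lemma gaussian_dominator_small (n : nat) (x : R) : `|x| = n.+1%:R ->
  gaussian_dominator x <= normal_peak 1 * 16 / n.+1%:R.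
Proof.
move=> xn; rewrite -mulrA ler_wpM2l ?normal_peak_ge0//.
rewrite expRN ler_pdivlMr// mulrC mulrA ler_pdivrMr ?expR_gt0//.
rewrite -[x ^+ 2]real_normK ?num_real// xn.
have := expR_ge1Dx (n.+1%:R ^+ 2 / 4 : R).
have : 1 <= n.+1%:R :> R by rewrite ler1n.
by nra.
Qed.

(** A class of test functions that are integrable for Gaussian laws, large enough
    for the first two moments and for cosines. *)
Definition subquadratic (q : R -> R) :=
  continuous q /\ exists B, forall x, `|q x| <= B * (1 + x ^+ 2).

Lemma subquadratic_pdf q : subquadratic q -> exists B, 0 <= B /\
  forall x, `|q x * pdf x| <= B * gaussian_dominator x.
Proof.
move=> [_ [B qB]]; exists `|B|; split => // x.
rewrite normrM (ger0_norm (normal_pdf_ge0 _ _ _)).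
apply: (@le_trans _ _ (`|B| * (1 + x ^+ 2) * pdf x)).
  apply: ler_wpM2r; first exact: normal_pdf_ge0.
  apply: (le_trans (qB x)); apply: ler_wpM2r; last exact: ler_norm.
  by rewrite addr_ge0// sqr_ge0.
by rewrite -mulrA ler_wpM2l// gaussian_dominatorP.
Qed.

Lemma measurable_subquadratic q : subquadratic q -> measurable_fun setT q.
Proof. by move=> [cq _]; exact: continuous_measurable_fun. Qed.

Lemma integrable_subquadratic_pdf q : subquadratic q ->
  mu.-integrable setT (fun x => (q x * pdf x)%:E).
Proof.
move=> sq; have [B [B0 qB]] := subquadratic_pdf sq.
have := @le_integrable _ _ R mu setT measurableT (fun x => (q x * pdf x)%:E) (fun x => (B * gaussian_dominator x)%:E).
apply => //.
- apply/measurable_EFinP; apply: measurable_funM; first exact: measurable_subquadratic.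
  exact: measurable_normal_pdf.
- move=> x _; by rewrite /= lee_fin (le_trans (qB x))// ler_norm.
- rewrite (_ : (fun x => _) = fun x => (B%:E * (gaussian_dominator x)%:E)%E)//.
  by apply: integrableZl => //; exact: integrable_gaussian_dominator.
Qed.

Let gaussianE (A : set (measurableTypeR R)) : measurable A ->
  gaussian A = (\int[mu]_(x in A) (pdf x)%:E)%E.
Proof. by []. Qed.

Lemma integrable_gaussian q : subquadratic q -> gaussian.-integrable setT (EFin \o q).
Proof.
move=> sq; apply: (integrable_density _ _ gaussianE).
- by move=> x; exact: normal_pdf_ge0.
- exact: measurable_normal_pdf.
- exact: measurable_subquadratic.
- exact: integrable_subquadratic_pdf.
Qed.

Lemma Rintegral_gaussian q : subquadratic q ->
  \int[gaussian]_x q x = \int[mu]_x (q x * pdf x).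
Proof.
move=> sq; apply: (Rintegral_density _ _ gaussianE).
- by move=> x; exact: normal_pdf_ge0.
- exact: measurable_normal_pdf.
- exact: measurable_subquadratic.
- exact: integrable_subquadratic_pdf.
Qed.

(** The fundamental theorem of calculus on [[-n, n]], where the boundary terms
    vanish in the limit. *)
Lemma Rintegral_derive_eq0 (G g : R -> R) (K : R) :
  (forall x : R, is_derive x (1 : R) G (g x)) -> continuous g ->
  mu.-integrable setT (EFin \o g) ->
  (forall n x, `|x| = n.+1%:R -> `|G x| <= K / n.+1%:R) ->
  \int[mu]_x g x = 0.
Proof.
move=> dG cg ig GK; pose I (n : nat) := `[- n.+1%:R, n.+1%:R]%classic : set R.
have mI n : measurable (I n) by exact: measurable_itv.
have mg : measurable_fun setT g by exact: continuous_measurable_fun.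
have FTC n : (\int[mu]_(x in I n) (g x)%:E = (G n.+1%:R)%:E - (G (- n.+1%:R))%:E)%E.
  apply: continuous_FTC2.
  - by rewrite ltrNl (@lt_trans _ _ 0)// ltrNl oppr0.
  - by apply: continuous_subspaceT => x; exact: cg.
  - have cG x : {for x, continuous G}.
      by apply/differentiable_continuous/derivable1_diffP; case: (dG x).
    split.
    + by move=> x _; case: (dG x).
    + by apply: cvg_at_right_filter; exact: cG.
    + by apply: cvg_at_left_filter; exact: cG.
  - by move=> x _; rewrite derive1E; case: (dG x).
have c0 : (\int[mu]_(x in I n) (g x)%:E)%E @[n --> \oo] --> 0%E.
  have e0 : G n.+1%:R - G (- n.+1%:R) @[n --> \oo] --> (0 : R).
    apply/cvgr0Pnorm_le => e e0.
    have : (K + K) / n.+1%:R @[n --> \oo] --> (0 : R).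
      by rewrite -[X in _ --> X](mulr0 (K + K)); apply: cvgMr; exact: cvg_harmonic.
    move/cvgr0Pnorm_le => /(_ e e0); apply: filterS => n.
    apply: le_trans; apply: le_trans (ler_normB _ _) _.
    rewrite mulrDl; apply: le_trans (ler_norm _); apply: lerD.
      by apply: GK; rewrite ger0_norm.
    by apply: GK; rewrite normrN ger0_norm.
  under eq_cvg do rewrite FTC -EFinB.
  by apply/fine_cvgP; split; [exact: nearW|exact: e0].
have c1 : (\int[mu]_(x in I n) (g x)%:E)%E @[n --> \oo] --> (\int[mu]_x (g x)%:E)%E.
  under eq_cvg do rewrite integral_mkcond.
  have := @dominated_cvg _ _ R mu setT measurableT (fun n => (fun x => (g x)%:E) \_ (I n))
    (fun x => (g x)%:E) (fun x => `|(g x)%:E|%E).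
  apply => //.
  - move=> n; apply/(measurable_restrict _ (mI n)) => //; apply: measurable_funTS.
    exact/measurable_EFinP.
  - move=> x _; apply: cvg_near_cst; near=> n; rewrite patchE mem_set//.
    rewrite /I/= in_itv/= -ler_norml ltW// (@lt_trans _ _ n%:R)// ?ltr_nat//.
    by near: n; exact: nbhs_infty_gtr.
  - exact: integrable_abse.
  - by move=> n x _; rewrite patchE; case: ifP => //= _; rewrite normr0 lee_fin.
by rewrite /Rintegral (cvg_unique _ c1 c0).
Unshelve. all: by end_near. Qed.

(** [q' - x q] times the density is the derivative of [q] times the density. *)
Lemma gaussian_stein (q q' : R -> R) : (forall x : R, is_derive x (1 : R) q (q' x)) ->
  subquadratic q -> subquadratic q' -> subquadratic (fun x => x * q x) ->
  \int[gaussian]_x q' x = \int[gaussian]_x (x * q x).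
Proof.
move=> dq sq sq' sxq; apply/eqP; rewrite -subr_eq0; apply/eqP.
rewrite !Rintegral_gaussian// -RintegralB//; [|exact: integrable_subquadratic_pdf..].
have [B [B0 qB]] := subquadratic_pdf sq.
apply: (@Rintegral_derive_eq0 (fun x => q x * pdf x) _ (B * (normal_peak 1 * 16))).
- move=> x; have dp := is_derive_normal_pdf01 x; have dqx := dq x.
  by apply: is_derive_eq; rewrite /GRing.scale/=; ring.
- have cp : continuous pdf by apply: continuous_normal_pdf; exact: oner_neq0.
  move: sq' sxq => [cq' _] [cxq _] x.
  by apply: cvgB; apply: cvgM; [exact: cq'|exact: cp|exact: cxq|exact: cp].
- rewrite (_ : EFin \o _ = (fun x => (q' x * pdf x)%:E - (x * q x * pdf x)%:E)%E)//.
  by apply: integrableB => //; exact: integrable_subquadratic_pdf.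
- move=> n x xn; apply: (le_trans (qB x)); rewrite -mulrA ler_wpM2l//.
  exact: gaussian_dominator_small.
Qed.

End gaussian_integrals.

(** * Moments and characteristic function of the standard Gaussian law *)

Section gaussian_law.
Context {R : realType}.
Local Notation gaussian := (@normal_prob R 0 1).
Local Notation mu := (@lebesgue_measure R).
Local Notation pdf := (@normal_pdf R 0 1).

Let square_ge (x : R) : `|x| <= 1 + x ^+ 2.
Proof. by have := sqr_ge0 (`|x| - 1); rewrite sqrrB real_normK ?num_real//; nra. Qed.

Lemma subquadratic_bounded (q : R -> R) (M : R) : continuous q ->
  (forall x, `|q x| <= M) -> subquadratic q.
Proof.
move=> cq qM; split => //; exists M => x; apply: le_trans (qM x) _.
by rewrite ler_peMr ?lerDl ?sqr_ge0// (le_trans _ (qM x)).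
Qed.

Lemma subquadratic_id_mul (q : R -> R) (M : R) : continuous q ->
  (forall x, `|q x| <= M) -> subquadratic (fun x => x * q x).
Proof.
move=> cq qM; split.
  by move=> x; apply: cvgM; [exact: cvg_id|exact: cq].
exists M => x; rewrite normrM mulrC; apply: ler_pM => //; exact: square_ge.
Qed.

Lemma subquadratic_id : subquadratic (@idfun R).
Proof.
split; first by move=> x; exact: cvg_id.
by exists 1 => x; rewrite mul1r square_ge.
Qed.

Lemma subquadratic_sqr : subquadratic (fun x : R => x * x).
Proof.
split; first by move=> x; apply: cvgM; exact: cvg_id.
by exists 1 => x; rewrite mul1r -expr2 ger0_norm ?sqr_ge0// lerDr.
Qed.

Lemma subquadratic_cst (c : R) : subquadratic (fun=> c).
Proof. by apply: (@subquadratic_bounded _ `|c|) => // x; exact: cvg_cst. Qed.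

Lemma gaussian_mean : \int[gaussian]_x x = 0.
Proof.
have := @gaussian_stein R (fun=> 1) (fun=> 0) (fun x => is_derive_cst _ _ _)
  (subquadratic_cst 1) (subquadratic_cst 0).
under [X in subquadratic X]eq_fun do rewrite mulr1.
move=> /(_ subquadratic_id).
under [X in _ = X]eq_Rintegral do rewrite mulr1.
by rewrite Rintegral_cst// mul0r => <-.
Qed.

Lemma gaussian_second_moment : \int[gaussian]_x (x * x) = 1.
Proof.
have := @gaussian_stein R id (fun=> 1) (fun x => is_derive_id _ _)
  subquadratic_id (subquadratic_cst 1) subquadratic_sqr.
by rewrite Rintegral_cst//= mul1r probability_setT.
Qed.

Let cos_cont (t c : R) : continuous (fun x : R => cos (t * x + c)).
Proof.
move=> x; apply: (@continuous_comp _ _ _ (fun x : R => t * x + c) cos).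
  by apply: cvgD; [apply: cvgM; [exact: cvg_cst|exact: cvg_id]|exact: cvg_cst].
exact: continuous_cos.
Qed.

Let sin_cont (t c : R) : continuous (fun x : R => sin (t * x + c)).
Proof.
move=> x; apply: (@continuous_comp _ _ _ (fun x : R => t * x + c) sin).
  by apply: cvgD; [apply: cvgM; [exact: cvg_cst|exact: cvg_id]|exact: cvg_cst].
exact: continuous_sin.
Qed.

Let cos1 (y : R) : `|cos y| <= 1. Proof. by rewrite ler_norml cos_geN1 cos_le1. Qed.
Let sin1 (y : R) : `|sin y| <= 1. Proof. by rewrite ler_norml sin_geN1 sin_le1. Qed.

(** As a function of [t] the left-hand side [F] satisfies [F' t = - t F t]:
    differentiation under the integral gives the mean of [- x sin (t x + c)], which
    Stein's identity turns into [- t F t]. *)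
Lemma gaussian_characteristic (t c : R) :
  \int[gaussian]_x cos (t * x + c) = cos c * expR (- (t ^+ 2 / 2)).
Proof.
pose F (s : R) := \int[gaussian]_x cos (s * x + c).
have dF s : is_derive s (1 : R) F (- s * F s).
  pose f (u x : R) := cos (u * x + c).
  have d1 (u x : R) : is_derive u (1 : R) (f ^~ x) (- (x * sin (u * x + c))).
    by apply: is_derive_eq; rewrite /GRing.scale/=; ring.
  have su : s \in `]s - 1, s + 1[ by rewrite in_itv/=; apply/andP; split; lra.
  have ci := @derivable_under_integral R _ _ gaussian f setT measurableT s (s - 1) (s + 1) su.
  have ce := @differentiation_under_integral R _ _ gaussian f setT measurableT s (s - 1) (s + 1) su.
  have h1 u : `]s - 1, s + 1[%classic u -> gaussian.-integrable setT (EFin \o f u).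
    move=> _; apply: integrable_gaussian; apply: (@subquadratic_bounded _ 1).
      exact: cos_cont.
    by move=> x; exact: cos1.
  have h2 : forall u x : R, `]s - 1, s + 1[%classic u -> [set: R] x -> derivable (f ^~ x) u 1.
    by move=> u x _ _; case: (d1 u x).
  have h3 : forall x : R, 0 <= 1 + x ^+ 2 by move=> x; rewrite addr_ge0// sqr_ge0.
  have h4 : gaussian.-integrable setT (EFin \o (fun x : R => 1 + x ^+ 2)).
    apply: integrable_gaussian; split.
      move=> x; apply: cvgD; first exact: cvg_cst.
      exact: sqr_continuous.
    by exists 1 => x; rewrite mul1r ger0_norm.
  have h5 : forall u x : R, `]s - 1, s + 1[%classic u -> [set: R] x ->
      `|derive1 (f ^~ x) u| <= 1 + x ^+ 2.
    move=> u x _ _; rewrite derive1E; case: (d1 u x) => _ ->.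
    rewrite normrN normrM; apply: (@le_trans _ _ (`|x| * 1)).
      by rewrite ler_wpM2l.
    by rewrite mulr1 square_ge.
  split; first exact: (ci h1 h2 _ h3 h4 h5).
  rewrite -derive1E; have := ce h1 h2 _ h3 h4 h5.
  move=> ->; rewrite -[LHS]/(\int[gaussian]_y derive1 (f ^~ y) s).
  have E y : derive1 (f ^~ y) s = (-1) * (y * sin (s * y + c)).
    by rewrite derive1E; case: (d1 s y) => _ ->; rewrite mulN1r.
  under eq_Rintegral do rewrite E.
  rewrite RintegralZl//; last first.
    apply: integrable_gaussian; apply: (@subquadratic_id_mul (fun y => sin (s * y + c)) 1).
      exact: sin_cont.
    by move=> x; exact: sin1.
  rewrite mulN1r mulNr; congr (- _).
  have dS (x : R) : is_derive x (1 : R) (fun x => sin (s * x + c)) (s * cos (s * x + c)).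
    by apply: is_derive_eq; rewrite /GRing.scale/=; ring.
  have st := gaussian_stein dS; rewrite /= in st; rewrite -st.
  - rewrite RintegralZl//; apply: integrable_gaussian.
    apply: (@subquadratic_bounded (fun y => cos (s * y + c)) 1) => //; exact: cos_cont.
  - apply: (@subquadratic_bounded (fun y => sin (s * y + c)) 1) => //; exact: sin_cont.
  - apply: (@subquadratic_bounded _ `|s|).
      by move=> x; apply: cvgM; [exact: cvg_cst|exact: cos_cont].
    by move=> x; rewrite normrM ler_piMr.
  - by apply: (@subquadratic_id_mul (fun y => sin (s * y + c)) 1) => //; exact: sin_cont.
(* The equation makes this product constant. *)
pose H s := F s * expR (s ^+ 2 / 2).
have dH (s : R) : is_derive s (1 : R) H 0.
  by have dFs := dF s; apply: is_derive_eq; rewrite /GRing.scale/=; field.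
have := is_derive_0_is_cst t 0 dH; rewrite /H -/(F t).
rewrite expr0n/= mul0r expR0 mulr1 expRN => Ft.
have -> : cos c = F 0.
  rewrite /F; under eq_Rintegral do rewrite mul0r add0r.
  by rewrite Rintegral_cst//= probability_setT mulr1.
by rewrite -Ft mulfK// gt_eqF// expR_gt0.
Qed.

End gaussian_law.

(** * Shifts and tails of Gaussian laws *)

Section gaussian_tails.
Context {R : realType}.
Local Notation gaussian := (@normal_prob R 0 1).
Local Notation mu := (@lebesgue_measure R).
Local Notation pdf := (@normal_pdf R 0 1).

Lemma normal_pdf_shift (s x : R) :
  normal_pdf s 1 x = expR (s * x - s ^+ 2 / 2) * pdf x.
Proof.
rewrite normal_pdf01E normal_pdfE ?oner_neq0// mulrCA; congr (_ * _).
rewrite -expRD /normal_fun expr1n; congr expR.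
by field.
Qed.

Let mpdf (s : R) (A : set (measurableTypeR R)) : measurable_fun A (fun x => (normal_pdf s 1 x)%:E).
Proof.
by apply: measurable_funTS; apply/measurable_EFinP; exact: measurable_normal_pdf.
Qed.

Let pdf_le (s k : R) (A : set (measurableTypeR R)) : measurable A ->
  (forall x, A x -> normal_pdf s 1 x <= k * pdf x) ->
  (normal_prob s 1 A <= k%:E * gaussian A)%E.
Proof.
move=> mA le_k.
have [->|/set0P[y Ay]] := eqVneq A set0.
  by rewrite !measure0 mule0.
have k0 : 0 <= k.
  have p0 : 0 < pdf y by rewrite normal_pdf01E mulr_gt0 ?expR_gt0// normal_peak_gt0 ?oner_neq0.
  by have := le_trans (normal_pdf_ge0 s 1 y) (le_k _ Ay); rewrite pmulr_lge0.
rewrite /normal_prob -ge0_integralZl_EFin//.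
- apply: ge0_le_integral => //.
  + by move=> x _; rewrite lee_fin normal_pdf_ge0.
  + by apply: measurable_funeM; exact: mpdf.
- by move=> x _; rewrite lee_fin normal_pdf_ge0.
Qed.

(** Below [K] the density of the shifted law is at most [exp (s K)] times the
    standard one; the shifted mass above [K] is the standard mass above
    [K - s]. *)
Lemma gaussian_shift_le (s K : R) (B : set (measurableTypeR R)) :
  0 <= s -> measurable B ->
  (gaussian (affine_map s 1 @^-1` B) <=
   (expR (s * K))%:E * gaussian B + gaussian `](K - s)%R, +oo[)%E.
Proof.
move=> s0 mB; have N1 : 1 != 0 :> R by exact: oner_neq0.
rewrite -normal_prob_affine//.
have mK : measurable (`]-oo, K] : set (measurableTypeR R)) by exact: measurable_itv.
have mK' : measurable (`]K, +oo[ : set (measurableTypeR R)) by exact: measurable_itv.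
apply: (@le_trans _ _ (normal_prob s 1 (B `&` `]-oo, K]) + normal_prob s 1 `]K, +oo[)%E).
  apply: (@le_trans _ _ (normal_prob s 1 ((B `&` `]-oo, K]) `|` `]K, +oo[))).
    apply: le_measure; rewrite ?inE//; first by apply: measurableU => //; exact: measurableI.
    move=> x Bx; have [xK|xK] := leP x K; [left|right]; rewrite /= in_itv/= ?andbT//.
  by apply: measureU2 => //; exact: measurableI.
apply: leeD.
  apply: (@le_trans _ _ ((expR (s * K))%:E * gaussian (B `&` `]-oo, K]))%E).
    apply: pdf_le; first exact: measurableI.
    move=> x [_]; rewrite /= in_itv/= => xK.
    rewrite (normal_pdf_shift s) ler_wpM2r ?normal_pdf_ge0// ler_expR.
    have := sqr_ge0 s; have := ler_wpM2l s0 xK; lra.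
  rewrite lee_wpmul2l// ?lee_fin ?expR_ge0//.
  by apply: le_measure; rewrite ?inE//; exact: measurableI.
rewrite normal_prob_affine//; apply: le_measure; rewrite ?inE//; last first.
  by move=> x; rewrite /affine_map /= !in_itv/= !andbT mul1r; lra.
exact: measurable_affine_preimage.
Qed.

(** Above [x] the density is at most [exp (- x^2 / 2)] times that of mean [x]. *)
Lemma gaussian_tail_le (x : R) : 0 <= x ->
  (gaussian `]x, +oo[ <= (expR (- (x ^+ 2 / 2)))%:E)%E.
Proof.
move=> x0; have mx : measurable (`]x, +oo[ : set (measurableTypeR R)) by exact: measurable_itv.
have e0 : 0 < expR (x ^+ 2 / 2) by exact: expR_gt0.
apply: (@le_trans _ _ ((expR (- (x ^+ 2 / 2)))%:E * normal_prob x 1 `]x, +oo[)%E).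
  rewrite /normal_prob -ge0_integralZl_EFin ?expR_ge0//; last first.
    by move=> y _; rewrite lee_fin normal_pdf_ge0.
  apply: ge0_le_integral => //.
  - by move=> y _; rewrite lee_fin normal_pdf_ge0.
  - by apply: measurable_funeM; exact: mpdf.
  - move=> y /=; rewrite in_itv/= andbT => xy.
    rewrite -EFinM lee_fin (normal_pdf_shift x) mulrA -expRD ler_peMl ?normal_pdf_ge0//.
    rewrite -[leLHS]expR0 ler_expR; have := ler_wpM2l x0 (ltW xy); lra.
rewrite -[leRHS]mule1 lee_wpmul2l ?lee_fin ?expR_ge0//.
exact: probability_le1.
Qed.

(** Keep only the mass of [[x, x + 1]], where the density is at least its value
    at [x + 1]. *)
Lemma gaussian_tail_ge (x : R) : 0 <= x ->
  ((normal_peak 1 * expR (- ((x + 1) ^+ 2 / 2)))%:E <= gaussian `]x, +oo[)%E.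
Proof.
move=> x0.
have mx : measurable (`]x, x + 1] : set (measurableTypeR R)) by exact: measurable_itv.
apply: (@le_trans _ _ (gaussian `]x, x + 1])); last first.
  apply: le_measure; rewrite ?inE//.
  by move=> y /=; rewrite !in_itv/= andbT => /andP[].
have mu1 : mu `]x, x + 1] = 1%E.
  by rewrite lebesgue_measure_itv/= lte_fin ltrDl ltr01 -EFinB addrAC subrr add0r.
rewrite -[leLHS]mule1 -[X in (_ * X <= _)%E]mu1 -integral_cst//.
apply: ge0_le_integral => //.
- by move=> y _; rewrite lee_fin mulr_ge0 ?normal_peak_ge0 ?expR_ge0.
- move=> y /=; rewrite in_itv/= => /andP[xy yx]; rewrite lee_fin normal_pdf01E.
  rewrite ler_wpM2l ?normal_peak_ge0// ler_expR lerN2 ler_pM2r// lerXn2r ?nnegrE//; lra.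
Qed.

End gaussian_tails.

Section centered_gaussian.
Context {R : realType} {d : measure_display} {O : measurableType d}.
Variable P : probability O R.
Local Notation gaussian := (@normal_prob R 0 1).

(** The law of [sqrt v * z] for a standard Gaussian [z]; this form includes the
    point mass at [0], for [v = 0]. *)
Definition centered_gaussian (X : O -> R) (v : R) :=
  forall A : set (measurableTypeR R), measurable A ->
    P (X @^-1` A) = gaussian (affine_map 0 (Num.sqrt v) @^-1` A).

Let gaussian_rv_affine (X : O -> R) : gaussian_rv P X -> exists m s : R, 0 <= s /\
  forall A : set (measurableTypeR R), measurable A ->
    P (X @^-1` A) = gaussian (affine_map m s @^-1` A).
Proof.
move=> [m [s [s0 XE]]]; exists m, s; split => // A mA; rewrite XE//.
case: eqP => [->|/eqP s1]; last by rewrite normal_prob_affine.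
rewrite diracE; have [|] := boolP (m \in A).
  rewrite inE => mA'; rewrite (_ : _ @^-1` _ = setT) ?probability_setT//.
  by apply/seteqP; split => // x _; rewrite /= /affine_map mul0r addr0.
rewrite notin_setE => mA'; rewrite (_ : _ @^-1` _ = set0) ?measure0//.
by apply/seteqP; split => // x; rewrite /= /affine_map mul0r addr0.
Qed.

Let law_integral (X : O -> R) (m s : R) (q : R -> R) : measurable_fun setT X ->
  (forall A : set (measurableTypeR R), measurable A ->
    P (X @^-1` A) = gaussian (affine_map m s @^-1` A)) ->
  subquadratic q ->
  P.-integrable setT (EFin \o (q \o X)) /\
  \int[P]_w q (X w) = \int[gaussian]_z q (m + s * z).
Proof.
move=> mX XE [cq [B qB]].
have mq : measurable_fun setT q by exact: continuous_measurable_fun.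
have sq : subquadratic (q \o affine_map m s).
  split.
    move=> x; apply: (@continuous_comp _ _ _ (affine_map m s) q); last exact: cq.
    by apply: cvgD; [exact: cvg_cst|apply: cvgM; [exact: cvg_cst|exact: cvg_id]].
  have B0 : 0 <= B.
    by have := le_trans (normr_ge0 _) (qB 0); rewrite expr0n/= addr0 mulr1.
  exists (B * (1 + 2 * m ^+ 2 + 2 * s ^+ 2)) => x; apply: (le_trans (qB _)).
  rewrite -mulrA ler_wpM2l// /affine_map.
  have := sqr_ge0 (m - s * x); have := sqr_ge0 m; have := sqr_ge0 s.
  have := sqr_ge0 x; have := sqr_ge0 (m * x); nra.
have ig : gaussian.-integrable setT (EFin \o (q \o affine_map m s)).
  exact: integrable_gaussian.
have mq' : measurable_fun setT (EFin \o q) by exact/measurable_EFinP.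
have e1 (g : R -> \bar R) : measurable_fun setT g -> (forall x, 0 <= g x)%E ->
    (\int[P]_w g (X w) = \int[gaussian]_z g (affine_map m s z))%E.
  move=> mg g0; rewrite -[LHS](@ge0_integral_pushforward _ _ _ (measurableTypeR R) _ X mX P setT g)//.
  rewrite -[RHS](@ge0_integral_pushforward _ _ _ _ _ _ (measurable_affine_map m s) _ setT g)//.
  by apply: eq_measure_integral => A mA _; exact: XE.
have iX : P.-integrable setT (EFin \o (q \o X)).
  apply/integrableP; split; first by apply: measurableT_comp => //; exact: measurableT_comp.
  rewrite (_ : (fun x => _) = fun x => (`|(q (X x))%:E|)%E)//.
  rewrite (e1 (fun x => `|(q x)%:E|)%E)//; last by apply: measurableT_comp.
  by move/integrableP : ig => [].
split => //; rewrite /Rintegral; congr fine.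
rewrite -[LHS](@integral_pushforward _ _ _ (measurableTypeR R) _ X mX P setT (EFin \o q))//.
rewrite -[RHS](@integral_pushforward _ _ _ _ _ _ (measurable_affine_map m s) _ setT (EFin \o q))//.
by apply: eq_measure_integral => A mA _; exact: XE.
Qed.

(** The first two moments of [m + s z] are [m] and [m^2 + s^2], so they identify
    the parameters. *)
Lemma gaussian_rv_centered (X : O -> R) (v : R) : measurable_fun setT X ->
  gaussian_rv P X -> \int[P]_w X w = 0 -> \int[P]_w (X w * X w) = v ->
  centered_gaussian X v.
Proof.
move=> mX gX; have [m [s [s0 XE]]] := gaussian_rv_affine gX.
have [_ ->] := law_integral mX XE subquadratic_id.
have [_ ->] := law_integral mX XE subquadratic_sqr.
have i1 : gaussian.-integrable setT (EFin \o (@idfun R)).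
  exact/integrable_gaussian/subquadratic_id.
have i2 : gaussian.-integrable setT (EFin \o (fun x : R => x * x)).
  exact/integrable_gaussian/subquadratic_sqr.
have im : gaussian.-integrable setT (EFin \o (fun=> m)).
  exact/integrable_gaussian/subquadratic_cst.
rewrite RintegralD//; last exact: integrable_Rscale.
rewrite Rintegral_cst// RintegralZl// gaussian_mean mulr0 addr0.
rewrite [fine _](_ : _ = 1) ?mulr1; last by rewrite /= probability_setT.
move=> m0 vE.
suff -> : v = s ^+ 2 by move=> A mA; rewrite sqrtr_sqr ger0_norm// XE// m0.
rewrite -vE m0; under eq_Rintegral do rewrite add0r mulrACA.
by rewrite RintegralZl// gaussian_second_moment mulr1 expr2.
Qed.

Variables (X : O -> R) (v : R).
Hypothesis mX : measurable_fun setT X.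
Hypothesis v0 : 0 <= v.
Hypothesis gX : centered_gaussian X v.

Lemma centered_gaussian_cos (c : R) : \int[P]_w cos (X w + c) = cos c * expR (- (v / 2)).
Proof.
have cq : continuous (fun x : R => cos (x + c)).
  move=> x; apply: (@continuous_comp _ _ _ (fun x : R => x + c) cos).
    by apply: cvgD; [exact: cvg_id|exact: cvg_cst].
  exact: continuous_cos.
have [_ ->] := law_integral mX gX (@subquadratic_bounded _ _ 1 cq (fun x =>
  etrans (ler_norml _ _) (introT andP (conj (cos_geN1 _) (cos_le1 _))))).
under eq_Rintegral do rewrite add0r.
by rewrite gaussian_characteristic sqr_sqrtr.
Qed.

Lemma centered_gaussian_tail_le (V x : R) : v <= V -> 0 < V -> 0 <= x ->
  (P [set w | (x < X w)%R] <= (expR (- (x ^+ 2 / (2 * V))))%:E)%E.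
Proof.
move=> vV V0 x0.
have mx y : measurable (`]y, +oo[ : set (measurableTypeR R)) by exact: measurable_itv.
rewrite (_ : [set w | _] = X @^-1` `]x, +oo[); last first.
  by apply/seteqP; split => w /=; rewrite in_itv/= andbT.
rewrite gX//; have sV : 0 < Num.sqrt V by rewrite sqrtr_gt0.
apply: (@le_trans _ _ (gaussian `](x / Num.sqrt V)%R, +oo[)).
  apply: le_measure; rewrite ?inE//; first exact: measurable_affine_preimage.
  move=> z /=; rewrite !in_itv/= !andbT /affine_map add0r => xz.
  rewrite ltr_pdivrMr//; have [z0|z0] := leP 0 z.
    by apply: (lt_le_trans xz); rewrite mulrC ler_wpM2l// ler_wsqrtr.
  have := mulr_ge0_le0 (sqrtr_ge0 v) (ltW z0); lra.
apply: le_trans (gaussian_tail_le _) _; first by rewrite divr_ge0// ltW.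
rewrite lee_fin ler_expR lerN2 exprMn exprVn sqr_sqrtr; last exact: ltW.
rewrite le_eqVlt; apply/orP; left; apply/eqP; field.
by rewrite gt_eqF.
Qed.

Lemma centered_gaussian_tail_ge (x : R) : 0 < v -> 0 <= x ->
  ((normal_peak 1 * expR (- ((x / Num.sqrt v + 1) ^+ 2 / 2)))%:E <=
   P [set w | (x < X w)%R])%E.
Proof.
move=> vp x0.
have mx y : measurable (`]y, +oo[ : set (measurableTypeR R)) by exact: measurable_itv.
rewrite (_ : [set w | _] = X @^-1` `]x, +oo[); last first.
  by apply/seteqP; split => w /=; rewrite in_itv/= andbT.
have sv : 0 < Num.sqrt v by rewrite sqrtr_gt0.
rewrite gX//; apply: le_trans (gaussian_tail_ge _) _; first by rewrite divr_ge0// ltW.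
apply: le_measure; rewrite ?inE//; first exact: measurable_affine_preimage.
move=> z /=; rewrite !in_itv/= !andbT /affine_map add0r.
by rewrite ltr_pdivrMr// mulrC.
Qed.

End centered_gaussian.

(** * A Cameron-Martin inequality in finite dimension *)

Section cameron_martin.
Context {R : realType} {d : measure_display} {O : measurableType d} {n : nat}.
Variable P : probability O R.
Local Notation gaussian := (@normal_prob R 0 1).
Variables (X : O -> 'rV[R]_n) (Q : 'M[R]_n) (a0 : 'rV[R]_n).
Hypothesis mX : measurable_fun setT X.
Hypothesis Qsym : Q^T = Q.
Hypothesis Q0 : forall a, 0 <= quadform Q a.
Hypothesis XG : forall a, centered_gaussian P (fun w => dotv a (X w)) (quadform Q a).
Hypothesis Qa0 : quadform Q a0 = 1.
Let h := a0 *m Q.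
Local Notation PxG := (P \x gaussian)%E.

(** With [Z = a0 . X], [X - Z h] is independent of [Z]. Replacing [Z] by an
    independent standard Gaussian coordinate [z] leaves the law of [X]
    unchanged, and turns the shift of [X] along [h] into a shift of [z]. *)
Let decompose (wz : O * measurableTypeR R) : 'rV[R]_n :=
  X wz.1 + (wz.2 - dotv a0 (X wz.1)) *: h.

Let measurable_dotX a : measurable_fun setT (fun w => dotv a (X w)).
Proof. by apply: measurableT_comp => //; exact: measurable_dotv. Qed.

Let measurable_decompose : measurable_fun setT decompose.
Proof.
apply: measurable_fun_rVP => i; under eq_fun do rewrite !mxE.
apply: measurable_funD.
  exact: (measurableT_comp (measurableT_comp (measurable_rV_coord i) mX) measurable_fst).
apply: measurable_funM => //; apply: measurable_funB; first exact: measurable_snd.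
exact: (measurableT_comp (measurable_dotX a0) measurable_fst).
Qed.

Let dotvZr (a b : 'rV[R]_n) (k : R) : dotv a (k *: b) = k * dotv a b.
Proof. by rewrite dotvC dotvZl dotvC. Qed.

Let dotvDr (a b c : 'rV[R]_n) : dotv a (b + c) = dotv a b + dotv a c.
Proof. by rewrite dotvC dotvDl !(dotvC a). Qed.

Let dotv_h (a : 'rV[R]_n) : dotv a h = (a *m Q *m a0^T) ord0 ord0.
Proof. by rewrite /dotv /h trmx_mul Qsym mulmxA. Qed.

(** The variance of [a . (X - Z h)], where [a . h] is the covariance of [a . X]
    with [Z]. *)
Let quadform_residual (a : 'rV[R]_n) :
  quadform Q (a - dotv a h *: a0) = quadform Q a - dotv a h ^+ 2.
Proof.
set k := dotv a h.
have kE : k = (a *m Q *m a0^T) ord0 ord0 := dotv_h a.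
have kE' : (a0 *m Q *m a^T) ord0 ord0 = k.
  by rewrite kE -[a0 *m Q *m _]trmxK mxE !trmx_mul trmxK Qsym mulmxA.
rewrite /quadform [(_ - _)^T]linearB/= [(_ *: _)^T]linearZ/= mulmxBl !mulmxBr !mulmxBl.
rewrite -!scalemxAr -!scalemxAl !mxE.
have := Qa0; rewrite /quadform mxE => ->.
move: kE'; rewrite mxE => ->; move: kE; rewrite mxE => <-.
ring.
Qed.

Let cosX a c : \int[P]_w cos (dotv a (X w) + c) = cos c * expR (- (quadform Q a / 2)).
Proof. by apply: centered_gaussian_cos => //; exact: measurable_dotX. Qed.

Let bounded_cosX a c : bounded_measurable (fun x : 'rV[R]_n => cos (dotv a x + c)).
Proof. exact/trig_bounded/trig_cos. Qed.

Let cos_decompose a c :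
  \int[PxG]_w cos (dotv a (decompose w) + c) =
  cos c * expR (- (quadform Q a / 2)).
Proof.
set k := dotv a h; set b := a - k *: a0.
have dE w z : dotv a (decompose (w, z)) = k * z + dotv b (X w).
  by rewrite /decompose/= dotvDr dotvZr -/k /b dotvDl dotvNl dotvZl; ring.
have ic : PxG.-integrable setT (fun w => (cos (dotv a (decompose w) + c))%:E).
  apply: (@bounded_measurable_integrable _ _ _ PxG).
  have [mc [M cM]] := bounded_cosX a c; split; last by exists M.
  exact: (measurableT_comp mc measurable_decompose).
transitivity (\int[P]_w \int[gaussian]_z cos (dotv a (decompose (w, z)) + c)).
  rewrite /Rintegral -(integral12_prod_meas1 ic); congr fine; apply: eq_integral => w _.
  rewrite /fubini_F /= fineK//.
  apply: integrable_fin_num => //.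
  apply: bounded_measurable_integrable; split; last first.
    by exists 1 => z; rewrite ler_norml cos_geN1 cos_le1.
  have [mc _] := bounded_cosX a c.
  apply: (measurableT_comp mc); apply: (measurableT_comp measurable_decompose).
  exact: measurable_pair1.
under eq_Rintegral.
  move=> w _; under eq_Rintegral do rewrite dE -addrA.
  rewrite gaussian_characteristic; over.
rewrite -[LHS]/(\int[P]_w (cos (dotv b (X w) + c) * expR (- (k ^+ 2 / 2)))).
rewrite RintegralZr//; last first.
  apply: bounded_measurable_integrable.
  have [mc [M cM]] := bounded_cosX b c; split; last by exists M.
  exact: (measurableT_comp mc mX).
by rewrite cosX /b quadform_residual -/k -mulrA -expRD; congr (_ * expR _); field.
Qed.

(** Both laws have the same characteristic function: the variance of
    [a . (X - Z h)] and that of [(a . h) z] add up to that of [a . X]. *)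
Lemma gaussian_vector_decompose (A : set 'rV[R]_n) : measurable A ->
  P (X @^-1` A) = PxG (decompose @^-1` A).
Proof.
move=> mA.
pose X' : {mfun O >-> 'rV[R]_n} := HB.pack X (isMeasurableFun.Build _ _ _ _ _ mX).
pose Y' : {mfun (O * measurableTypeR R)%type >-> 'rV[R]_n} :=
  HB.pack decompose (isMeasurableFun.Build _ _ _ _ _ measurable_decompose).
apply: (@cramer_wold _ _ (distribution P X') (distribution PxG Y')) => // a c.
transitivity (\int[P]_w cos (dotv a (X w) + c)).
  rewrite /Rintegral; congr fine.
  rewrite -[LHS]/(\int[distribution P X']_x (EFin \o (fun x => cos (dotv a x + c))) x)%E.
  rewrite integral_distribution//.
    apply/measurable_EFinP; by have [] := bounded_cosX a c.
  apply: bounded_measurable_integrable.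
  have [mc [M cM]] := bounded_cosX a c; split; last by exists M.
  exact: (measurableT_comp mc mX).
rewrite cosX -cos_decompose /Rintegral; congr fine; apply/esym.
rewrite -[LHS]/(\int[distribution PxG Y']_x (EFin \o (fun x => cos (dotv a x + c))) x)%E.
rewrite integral_distribution//.
  apply/measurable_EFinP; by have [] := bounded_cosX a c.
apply: (@bounded_measurable_integrable _ _ _ PxG).
have [mc [M cM]] := bounded_cosX a c; split; last by exists M.
exact: (measurableT_comp mc measurable_decompose).
Qed.

(** For each value of the independent part, the shift acts on the coordinate [z]
    alone, where [gaussian_shift_le] applies; integrate over that part. *)
Theorem cameron_martin_le (s K : R) (A : set 'rV[R]_n) : 0 <= s -> measurable A ->
  (P [set w | A (X w + s *: h)%R] <=
   (expR (s * K))%:E * P (X @^-1` A) + gaussian `](K - s)%R, +oo[)%E.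
Proof.
move=> s0 mA.
have mAs : measurable [set x | A (x + s *: h)].
  rewrite -[X in measurable X]setTI.
  have : measurable_fun setT (fun x : 'rV[R]_n => x + s *: h); last exact.
  apply: measurable_fun_rVP => i; under eq_fun do rewrite !mxE.
  by apply: measurable_funD => //; exact: measurable_rV_coord.
have mD (B : set 'rV[R]_n) : measurable B -> measurable (decompose @^-1` B).
  by move=> mB; rewrite -[X in measurable X]setTI; exact: measurable_decompose.
have mxs w (B : set 'rV[R]_n) : measurable B ->
    measurable (xsection (decompose @^-1` B) w).
  by move=> mB; apply: measurable_xsection; exact: mD.
rewrite -[leLHS]/(P (X @^-1` [set x | A (x + s *: h)])).
rewrite !gaussian_vector_decompose// /product_measure1/=.
have eK : 0 <= expR (s * K) by exact: expR_ge0.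
have mPhi (B : set 'rV[R]_n) : measurable B ->
    measurable_fun setT (fun w => gaussian (xsection (decompose @^-1` B) w)).
  by move=> mB; apply: measurable_fun_xsection; exact: mD.
rewrite -ge0_integralZl_EFin//; last exact: mPhi.
rewrite -[X in (_ + X)%E]mule1 -(probability_setT P) -integral_cst//.
rewrite -ge0_integralD//; last by apply: measurable_funeM; exact: mPhi.
apply: ge0_le_integral => //=.
- exact: mPhi.
- by apply: emeasurable_funD => //; apply: measurable_funeM; exact: mPhi.
  move=> w _; apply: le_trans (gaussian_shift_le _ s0 (mxs w _ mA)).
  rewrite le_eqVlt; apply/orP; left; apply/eqP; congr (gaussian _).
  have E (z : R) : decompose (w, z) + s *: h = decompose (w, s + 1 * z).
    by rewrite /decompose/= mul1r -addrA -scalerDl addrAC [s + z]addrC.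
  by apply/seteqP; split => z; rewrite /xsection /= !inE /= E.
by move=> w _; rewrite mule_ge0// lee_fin.
Qed.

End cameron_martin.

(** * Values of the field at finitely many points *)

Section field_vectors.
Context {R : realType} {dO : measure_display} {O : measurableType dO}.
Variable P : probability O R.
Context {d : nat}.
Variables (U : set 'rV[R]_d) (f : 'rV[R]_d -> {RV P >-> R}) (C : 'rV[R]_d -> R).
Hypothesis gf : gaussian_field U f.
Hypothesis covf : covariance_function U f C.
Hypothesis mean0 : forall t, U t -> ('E_P[f t] = 0)%E.
Hypothesis var1 : forall t, U t -> ('E_P[(f t : O -> R) ^+ 2] = 1)%E.

Let integrable_f2 t : U t -> P.-integrable setT (EFin \o (fun w => f t w ^+ 2)).
Proof.
move=> Ut; apply/integrableP; split.
  by apply/measurable_EFinP; apply: measurable_funX; exact: measurable_funP.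
have := var1 Ut; rewrite unlock => v1.
rewrite (_ : (\int[P]_x _ = \int[P]_x (((f t : O -> R) ^+ 2) x)%:E)%E).
  by rewrite v1 ltry.
by apply: eq_integral => w _; rewrite /= ger0_norm// sqr_ge0.
Qed.

Lemma integrable_field_mul s t : U s -> U t ->
  P.-integrable setT (EFin \o (fun w => f s w * f t w)).
Proof.
move=> Us Ut.
apply: (@le_integrable _ _ _ P setT measurableT _
    ((EFin \o (fun w => (f s w ^+ 2)%R)) \+ (EFin \o (fun w => (f t w ^+ 2)%R)))%E).
- apply/measurable_EFinP; apply: measurable_funM; exact: measurable_funP.
- move=> w _; rewrite /= lee_fin [leRHS]ger0_norm ?addr_ge0 ?sqr_ge0// normrM.
  rewrite -[X in _ <= X + _]real_normK ?num_real// -[X in _ <= _ + X]real_normK ?num_real//.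
  have := sqr_ge0 (`|f s w| - `|f t w|); have := normr_ge0 (f s w).
  by have := normr_ge0 (f t w); nra.
- by apply: integrableD => //; exact: integrable_f2.
Qed.

Lemma Rintegral_field_mul s t : U s -> U t ->
  \int[P]_w (f s w * f t w) = C (s - t).
Proof.
move=> Us Ut; have := covf Ut Us; rewrite unlock !mean0//= unlock /Rintegral.
rewrite (_ : (fun x => _) = (fun w => (f s w * f t w)%:E)); first by move=> ->.
apply/funext => w.
by rewrite -[LHS]/(((f s w - 0) * (f t w - 0))%:E) !subr0.
Qed.

Lemma integrable_field t : U t -> P.-integrable setT (EFin \o f t).
Proof.
move=> Ut.
apply: (@le_integrable _ _ _ P setT measurableT _
    ((EFin \o (fun w => 1%R)) \+ (EFin \o (fun w => (f t w ^+ 2)%R)))%E).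
- exact/measurable_EFinP.
- move=> w _; rewrite /= lee_fin [leRHS]ger0_norm ?addr_ge0 ?sqr_ge0//.
  rewrite -[X in _ <= _ + X]real_normK ?num_real//.
  by have := sqr_ge0 (`|f t w| - 1); have := normr_ge0 (f t w); nra.
- apply: integrableD => //; last exact: integrable_f2.
  by apply: bounded_measurable_integrable; split => //; exists 1 => x; rewrite normr1.
Qed.

Lemma Rintegral_field t : U t -> \int[P]_w f t w = 0.
Proof. by move=> Ut; have := mean0 Ut; rewrite unlock /Rintegral => ->. Qed.

Section vector.
Variables (n : nat) (t : 'I_n -> 'rV[R]_d).
Hypothesis Ut : forall i, U (t i).

Definition field_vector (w : O) : 'rV[R]_n := \row_i f (t i) w.

Definition covariance_matrix : 'M[R]_n := \matrix_(i, j) C (t i - t j).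

Lemma measurable_field_vector : measurable_fun setT field_vector.
Proof.
apply: measurable_fun_rVP => i; under eq_fun do rewrite mxE.
exact: (measurable_funP (f (t i))).
Qed.

Lemma covariance_matrix_sym : covariance_matrix^T = covariance_matrix.
Proof.
apply/matrixP => i j; rewrite !mxE -!Rintegral_field_mul//.
by apply: eq_Rintegral => w _; rewrite mulrC.
Qed.

Lemma quadform_covarianceE a :
  quadform covariance_matrix a = \sum_i \sum_j a ord0 i * a ord0 j * C (t i - t j).
Proof.
rewrite /quadform -mulmxA mxE; apply: eq_bigr => i _.
rewrite mxE mulr_sumr; apply: eq_bigr => j _; rewrite !mxE; ring.
Qed.

Let dotv_sqr a : \int[P]_w (dotv a (field_vector w) * dotv a (field_vector w)) =
  quadform covariance_matrix a.
Proof.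
rewrite quadform_covarianceE.
under eq_Rintegral.
  move=> w _; rewrite dotvE mulr_suml.
  under eq_bigr do rewrite mulr_sumr.
  over.
rewrite Rintegral_sum; last first.
  move=> i; apply: integrable_Rsum => j.
  rewrite (_ : EFin \o _ = EFin \o (fun w => (a ord0 i * a ord0 j) * (f (t i) w * f (t j) w))).
    by apply: integrable_Rscale; exact: integrable_field_mul.
  by apply/funext => w /=; rewrite !mxE mulrACA.
apply: eq_bigr => i _; rewrite Rintegral_sum; last first.
  move=> j.
  rewrite (_ : EFin \o _ = EFin \o (fun w => (a ord0 i * a ord0 j) * (f (t i) w * f (t j) w))).
    by apply: integrable_Rscale; exact: integrable_field_mul.
  by apply/funext => w /=; rewrite !mxE mulrACA.
apply: eq_bigr => j _.
under eq_Rintegral do rewrite !mxE mulrACA.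
by rewrite RintegralZl//; [rewrite Rintegral_field_mul|exact: integrable_field_mul].
Qed.

Lemma covariance_matrix_ge0 a : 0 <= quadform covariance_matrix a.
Proof. by rewrite -dotv_sqr; apply: Rintegral_ge0 => w _; rewrite -expr2 sqr_ge0. Qed.

(** A combination of values of the field is Gaussian by definition, with mean [0]
    and second moment given by the covariance matrix. *)
Lemma field_vector_gaussian a :
  centered_gaussian P (fun w => dotv a (field_vector w)) (quadform covariance_matrix a).
Proof.
apply: gaussian_rv_centered.
- apply: measurableT_comp; first exact: measurable_dotv.
  exact: measurable_field_vector.
- rewrite (_ : (fun w => _) = fun w => \sum_i a ord0 i * f (t i) w).
    exact: gf.
  by apply/funext => w; rewrite dotvE; apply: eq_bigr => i _; rewrite mxE.
- under eq_Rintegral do rewrite dotvE.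
  rewrite Rintegral_sum; last first.
    move=> i; apply: (@integrable_Rscale _ _ _ P (a ord0 i) (fun w => field_vector w ord0 i)).
    rewrite (_ : (fun w => _) = f (t i)); first exact: integrable_field.
    by apply/funext => w; rewrite mxE.
  rewrite big1// => i _; under eq_Rintegral do rewrite mxE.
  by rewrite RintegralZl//; [rewrite Rintegral_field// mulr0|exact: integrable_field].
- exact: dotv_sqr.
Qed.

End vector.
End field_vectors.

(** * The covariance near the origin *)

Section sup_norm.
Context {R : realType} {d : nat}.
Implicit Types x y : 'rV[R]_d.

Lemma normr_coord x i : `|x ord0 i| <= `|x|.
Proof.
rewrite [leRHS]/Num.Def.normr /= mx_normrE.
exact: (@le_bigmax _ _ _ _ (fun ij : 'I_1 * 'I_d => `|x ij.1 ij.2|) (ord0, i)).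
Qed.

Lemma normr_rV_le x (c : R) : 0 <= c -> (forall i, `|x ord0 i| <= c) -> `|x| <= c.
Proof.
move=> c0 xc; rewrite [leLHS]/Num.Def.normr /= mx_normrE.
by apply/bigmax_leP; split => // -[i j] _ /=; rewrite (ord1 i).
Qed.

Lemma normr_rV_lt x (c : R) : 0 < c -> (forall i, `|x ord0 i| < c) -> `|x| < c.
Proof.
move=> c0 xc; rewrite [ltLHS]/Num.Def.normr /= mx_normrE.
by apply/bigmax_ltP; split => // -[i j] _ /=; rewrite (ord1 i).
Qed.

Lemma dotv_norm_le x : dotv x x <= d%:R * `|x| ^+ 2.
Proof.
rewrite dotvE -[d in d%:R]card_ord -sum1_card natr_sum mulr_suml; apply: ler_sum => i _.
rewrite mul1r -expr2 -[leLHS]real_normK ?num_real// lerXn2r ?nnegrE//.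
exact: normr_coord.
Qed.

End sup_norm.

Section covariance_near_zero.
Context {R : realType} {d : nat}.
Variables (C : 'rV[R]_d -> R) (delta0 : R).
Hypothesis delta0_gt0 : 0 < delta0.
Hypothesis expC : covariance_expansion delta0 C.

Let fourth_bound : R := \sum_i \sum_j \sum_k \sum_l
  `|partial i (partial j (partial k (partial l C))) 0|.

Let fourth_bound_ge0 : 0 <= fourth_bound.
Proof. by do 4 (apply: sumr_ge0 => ? _). Qed.

Let fourth_le t : `|fourth_order_form C t| <= fourth_bound * `|t| ^+ 4.
Proof.
rewrite /fourth_order_form normrM ger0_norm ?invr_ge0//.
apply: (@le_trans _ _ (1 * (fourth_bound * `|t| ^+ 4))); last by rewrite mul1r.
apply: ler_pM => //; first by rewrite invf_le1 ?ler1n.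
rewrite /fourth_bound mulr_suml; apply: le_trans (ler_norm_sum _ _ _) _.
apply: ler_sum => i _; rewrite mulr_suml; apply: le_trans (ler_norm_sum _ _ _) _.
apply: ler_sum => j _; rewrite mulr_suml; apply: le_trans (ler_norm_sum _ _ _) _.
apply: ler_sum => k _; rewrite mulr_suml; apply: le_trans (ler_norm_sum _ _ _) _.
apply: ler_sum => l _; rewrite !normrM -!mulrA ler_wpM2l//.
rewrite !exprS expr0 mulr1.
by do 3 (apply: ler_pM; rewrite ?mulr_ge0 ?normr_coord//); exact: normr_coord.
Qed.

(** The form of degree four and the remainder are both of order [|t|^4], the
    radius being at most [1]. *)
Lemma covariance_near_zero : exists K r : R, [/\ 0 < K, 0 < r, r <= 1 &
  forall t, `|t| <= r -> {for t, continuous C} /\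
    `|C t - 1 + 2^-1 * dotv t t| <= K * `|t| ^+ 4].
Proof.
have [dC _ rem] := expC.
have /eqO_exP[k k0 remk] := rem.
have {}dC : \forall t \near (0 : 'rV[R]_d), differentiable C t by case: dC.
have : \forall t \near (0 : 'rV[R]_d), differentiable C t /\
   `|C t - (1 - 2^-1 * dotv t t + fourth_order_form C t)| <= k * `| `|t| `^ (4 + delta0)|.
  by near=> t; split; near: t.
move=> /nbhs_ballP[e /= e0 He].
exists (k + fourth_bound), (Num.min (e / 2) 1); split.
- by rewrite ltr_wpDr.
- by rewrite lt_min ltr01 divr_gt0.
- by rewrite ge_min lexx orbT.
move=> t; rewrite le_min => /andP[te t1].
have [dt Ht] : differentiable C t /\
   `|C t - (1 - 2^-1 * dotv t t + fourth_order_form C t)| <= k * `| `|t| `^ (4 + delta0)|.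
  apply: He; rewrite -ball_normE /= sub0r normrN (le_lt_trans te)//.
  by rewrite ltr_pdivrMr// ltr_pMr// ltr1n.
split; first exact: differentiable_continuous.
rewrite (_ : C t - 1 + _ = (C t - (1 - 2^-1 * dotv t t + fourth_order_form C t)) +
  fourth_order_form C t); last by ring.
rewrite mulrDl; apply: le_trans (ler_normD _ _) _; apply: lerD; last exact: fourth_le.
apply: le_trans Ht _; rewrite ler_wpM2l ?(ltW k0)// ger0_norm ?powR_ge0//.
have [->|t0] := eqVneq `|t| 0.
  by rewrite powR0 ?expr0n// gt_eqF// addr_gt0.
rewrite -powR_mulrn// powRD; last by rewrite t0 implybT.
rewrite ler_piMr ?powR_ge0//.
have -> : 1 = 1 `^ delta0 :> R by rewrite powR1.
by apply: ge0_ler_powR; rewrite ?nnegrE// ltW.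
Unshelve. all: by end_near. Qed.

End covariance_near_zero.

Section covariance_near_zero_consequences.
Context {R : realType} {d : nat}.
Variables (C : 'rV[R]_d -> R) (delta0 : R).
Hypothesis delta0_gt0 : 0 < delta0.
Hypothesis expC : covariance_expansion delta0 C.

(** [2 (1 - C t)] is the variance of an increment of the field along [t]. *)
Lemma covariance_quadratic : exists A r : R, [/\ 0 < A, 0 < r &
  forall t, `|t| <= r -> 2 * (1 - C t) <= A * `|t| ^+ 2].
Proof.
have [K [r [K0 r0 r1 H]]] := covariance_near_zero delta0_gt0 expC.
exists (d%:R + 2 * K), r; split => //; first by rewrite ltr_wpDl// mulr_gt0.
move=> t tr; have [_] := H t tr; rewrite ler_norml => /andP[H1 _].
have := dotv_norm_le t.
have t4 : `|t| ^+ 4 <= `|t| ^+ 2.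
  by rewrite (_ : 4%N = (2 + 2)%N)// exprD ler_piMr ?sqr_ge0// exprn_ile1// (le_trans tr).
have := ler_wpM2l (ltW K0) t4; lra.
Qed.

(** To second order [C t] is [1 - |t|^2 / 2], which drops strictly from [x e] to
    [lam x e] for a small [x] and a unit vector [e]; continuity extends the drop to
    a ball. *)
Lemma covariance_strict_decrease (lam rho : R) : (0 < d)%N -> 1 < lam -> 0 < rho ->
  exists (v : 'rV[R]_d) (c r : R), [/\ `|v| <= rho, 0 < c, 0 < r &
    forall w, `|w - v| <= r -> c <= C w - C (lam *: w)].
Proof.
move=> d0 lam1 rho0.
have [K [r [K0 r0 r1 H]]] := covariance_near_zero delta0_gt0 expC.
have lam0 : 0 < lam by exact: lt_trans lam1.
pose e : 'rV[R]_d := delta_mx ord0 (Ordinal d0).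
have e1 : `|e| <= 1.
  by apply: normr_rV_le => // i; rewrite mxE normr_nat lern1 leq_b1.
have dote (x : R) : dotv (x *: e) (x *: e) = x ^+ 2.
  rewrite dotvE (bigD1 (Ordinal d0))//= big1 ?addr0.
    by rewrite !mxE !eqxx/= mulr1 expr2.
  by move=> i /negbTE ine; rewrite !mxE ine andbF mulr0 mul0r.
(* [M x^2 <= 1] makes the quartic error at most half of the quadratic
   drop. *)
pose M := 4 * K * (lam ^+ 4 + 1) / (lam ^+ 2 - 1).
have l21 : 0 < lam ^+ 2 - 1 by rewrite subr_gt0 exprn_egt1.
have M0 : 0 < M.
  by rewrite divr_gt0// !mulr_gt0// addr_gt0// exprn_gt0.
pose x := Num.min (Num.min rho (r / lam)) (Num.min r (1 / (M + 1))).
have x0 : 0 < x by rewrite !lt_min rho0 r0 !divr_gt0// addr_gt0.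
have xrho : x <= rho by rewrite !ge_min lexx.
have xrl : lam * x <= r by rewrite mulrC -ler_pdivlMr// !ge_min lexx !orbT.
have xr : x <= r by rewrite !ge_min lexx !orbT.
have xM : x * (M + 1) <= 1 by rewrite -ler_pdivlMr ?addr_gt0// !ge_min lexx !orbT.
have nxe y : 0 <= y -> `|y *: e| <= y.
  by move=> y0; rewrite normrZ ger0_norm// ler_piMr.
have vr : `|x *: e| <= r by rewrite (le_trans (nxe _ (ltW x0))).
have lvr : `|lam *: (x *: e)| <= r.
  by rewrite scalerA (le_trans (nxe _ _))// mulr_ge0 ?(ltW x0) ?(ltW lam0).
have [cv] := H _ vr; rewrite dote ler_norml => /andP[v1 _].
have [clv] := H _ lvr; rewrite scalerA dote -scalerA ler_norml => /andP[_ v2].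
pose g w := C w - C (lam *: w).
have gv : 0 < g (x *: e).
  have n1 : `|x *: e| ^+ 4 <= x ^+ 4 by rewrite lerXn2r ?nnegrE ?(ltW x0)// nxe// ltW.
  have n2 : `|lam *: (x *: e)| ^+ 4 <= lam ^+ 4 * x ^+ 4.
    rewrite -exprMn lerXn2r ?nnegrE ?mulr_ge0 ?(ltW x0) ?(ltW lam0)//.
    by rewrite scalerA nxe// mulr_ge0// ltW.
  have := ler_wpM2l (ltW K0) n1; have := ler_wpM2l (ltW K0) n2.
  have key : K * (lam ^+ 4 + 1) * x ^+ 4 * 4 <= (lam ^+ 2 - 1) * x ^+ 2.
    have -> : K * (lam ^+ 4 + 1) * x ^+ 4 * 4 = (lam ^+ 2 - 1) * x ^+ 2 * (M * x ^+ 2).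
      by rewrite /M; field; rewrite gt_eqF.
    have p2 : 0 <= (lam ^+ 2 - 1) * x ^+ 2 by apply: mulr_ge0; [exact: ltW|exact: sqr_ge0].
    rewrite ler_piMr//.
    have x1 : x <= 1 by rewrite (le_trans xr).
    have Mx : M * x <= 1 by have := ltW x0; nra.
    rewrite expr2 mulrA (le_trans _ x1)// ler_piMl//; exact: ltW.
  have pos : 0 < (lam ^+ 2 - 1) * x ^+ 2 by rewrite mulr_gt0// exprn_gt0.
  rewrite /g => n3 n4; move: v1 v2 key pos n3 n4; rewrite exprMn !mulrDr !mulrDl.
  move: (`|x *: e| ^+ 4) (`|lam *: (x *: e)| ^+ 4) (C (x *: e)) (C (lam *: (x *: e))) => *.
  lra.
have cg : g @ (x *: e) --> g (x *: e).
  have clv' : (fun w => C (lam *: w)) @ (x *: e) --> C (lam *: (x *: e)).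
    exact: (@cvg_comp _ _ _ ( *:%R lam) C _ _ _ (@scaler_continuous _ _ lam _) clv).
  exact: (@cvgB R R _ (nbhs (x *: e)) _ C (fun w => C (lam *: w)) _ _ cv clv').
have : \forall w \near (x *: e), g (x *: e) / 2 < g w.
  apply: (@cvgr_gt _ _ _ _ g (g (x *: e)) cg).
  by rewrite ltr_pdivrMr// ltr_pMr// ltr1n.
move=> /nbhs_ballP[s /= s0 Hs].
exists (x *: e), (g (x *: e) / 2), (s / 2); split.
- by rewrite (le_trans (nxe _ (ltW x0))).
- by rewrite divr_gt0.
- by rewrite divr_gt0.
move=> w ws; apply/ltW/Hs; rewrite -ball_normE /= distrC (le_lt_trans ws)//.
by rewrite ltr_pdivrMr// ltr_pMr// ltr1n.
Qed.

End covariance_near_zero_consequences.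

(** * A direction positively correlated with the whole field *)

Section cons_ord.
Context {X : Type} {n : nat}.

Definition cons_ord (p : X) (t : 'I_n -> X) (i : 'I_n.+1) : X :=
  if unlift ord0 i is Some j then t j else p.

Lemma cons_ord0 p t : cons_ord p t ord0 = p.
Proof. by rewrite /cons_ord unlift_none. Qed.

Lemma cons_ordS p t j : cons_ord p t (lift ord0 j) = t j.
Proof. by rewrite /cons_ord liftK. Qed.

Lemma cons_ord_all (P : X -> Prop) p t :
  P p -> (forall i, P (t i)) -> forall i, P (cons_ord p t i).
Proof. by move=> Pp Pt i; rewrite /cons_ord; case: unlift => [j|//]. Qed.

End cons_ord.

Section compact_sets.
Context {R : realType} {d : nat}.
Variables (T U : set 'rV[R]_d).
Hypothesis compactT : compact T.

Lemma compact_room : open U -> T `<=` U -> exists r : R, 0 < r /\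
  forall y x, T y -> `|x - y| <= r -> U x.
Proof.
move=> oU TU.
have nc := (compact_near_coveringP T).1 compactT.
have H : \forall r \near (0 : R)^'+, T `<=` (fun y => forall x, `|x - y| <= r -> U x).
  apply: (nc R (0^'+)%classic (fun r y => forall x, `|x - y| <= r -> U x)) => y Ty.
  have /nbhs_ballP[e /= e0 yU] : nbhs y U by apply: open_nbhs_nbhs; split => //; exact: TU.
  exists (ball y (e / 2), `]0, e / 2[%classic).
    split => /=; first by apply: nbhsx_ballx; rewrite divr_gt0.
    by near=> r; rewrite /= in_itv/=; apply/andP; split; near: r;
      [exact: nbhs_right_gt|apply: nbhs_right_lt; rewrite divr_gt0].
  move=> [y' r] [/=]; rewrite -ball_normE /= in_itv/= => yy' /andP[r0 re] x xy'.
  apply: yU; rewrite -ball_normE /= -(subrKA y') (le_lt_trans (ler_normD _ _))//.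
  rewrite [ltRHS](splitr e) ltrD// distrC (le_lt_trans xy')//.
have [r [r0 Hr]] : exists r : R, 0 < r /\ T `<=` (fun y => forall x, `|x - y| <= r -> U x).
  near (0 : R)^'+ => r; exists r; split; first by near: r; exact: nbhs_right_gt.
  by near: r.
by exists r; split => // y x Ty; exact: Hr.
Unshelve. all: by end_near. Qed.

Lemma compact_net (e : R) : 0 < e -> exists s : seq 'rV[R]_d,
  (forall y, y \in s -> T y) /\ forall x, T x -> exists2 y, y \in s & `|x - y| < e.
Proof.
move=> e0; move: compactT; rewrite compact_cover => /(_ _ T (fun y => ball y e)).
case.
- by move=> y _; exact: ball_open.
- by move=> x Tx; exists x => //; exact: ballxx.
move=> D DT cov; exists (finmap.enum_fset D); split => [y yD|x Tx].
  by have := DT _ yD; rewrite inE.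
have [y yD xy] := cov _ Tx; exists y => //.
by move: xy; rewrite -ball_normE /= distrC.
Qed.

End compact_sets.

Section positive_direction.
Context {R : realType} {d : nat}.
Variables (T U : set 'rV[R]_d) (C : 'rV[R]_d -> R) (delta0 : R).
Hypothesis d_gt0 : (0 < d)%N.
Hypothesis openU : open U.
Hypothesis TU : T `<=` U.
Hypothesis compactT : compact T.
Hypothesis T0 : T !=set0.
Hypothesis delta0_gt0 : 0 < delta0.
Hypothesis expC : covariance_expansion delta0 C.
Hypothesis radC : radially_nonincreasing C.

(** The variance of [\sum_i a_i f (t_i)]. *)
Definition cov_form n (t : 'I_n -> 'rV[R]_d) (a : 'I_n -> R) :=
  \sum_i \sum_j a i * a j * C (t i - t j).

Hypothesis psd : forall n (t : 'I_n -> 'rV[R]_d) a,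
  (forall i, U (t i)) -> 0 <= cov_form t a.
Hypothesis Csym : forall s t, U s -> U t -> C (s - t) = C (t - s).
Hypothesis C0 : C 0 = 1.

Lemma cov_form_cons n (t : 'I_n -> 'rV[R]_d) a p x :
  U p -> (forall i, U (t i)) ->
  cov_form (cons_ord p t) (cons_ord x a) =
  x ^+ 2 + 2 * x * (\sum_j a j * C (t j - p)) + cov_form t a.
Proof.
move=> Up Ut; rewrite /cov_form big_ord_recl big_ord_recl !cons_ord0 subrr C0.
under eq_bigr do rewrite !cons_ordS Csym// -mulrA.
rewrite -mulr_sumr.
under [X in _ + X]eq_bigr.
  move=> i _; rewrite big_ord_recl !cons_ordS !cons_ord0.
  under eq_bigr do rewrite !cons_ordS.
  rewrite [a i * x]mulrC -mulrA.
  over.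
by rewrite big_split/= -mulr_sumr; ring.
Qed.

Lemma cov_formZ n (t : 'I_n -> 'rV[R]_d) a k :
  cov_form t (fun i => k * a i) = k ^+ 2 * cov_form t a.
Proof.
rewrite /cov_form mulr_sumr; apply: eq_bigr => i _.
by rewrite mulr_sumr; apply: eq_bigr => j _; ring.
Qed.

(** The Cauchy-Schwarz inequality against [f p], whose variance is [1]. *)
Lemma cov_form_cauchy n (t : 'I_n -> 'rV[R]_d) a p eta : 0 < eta ->
  U p -> (forall i, U (t i)) -> cov_form t a <= eta ^+ 2 ->
  `|\sum_j a j * C (t j - p)| <= eta.
Proof.
move=> eta0 Up Ut qe.
have H x : 0 <= x ^+ 2 + 2 * x * (\sum_j a j * C (t j - p)) + cov_form t a.
  by rewrite -cov_form_cons//; apply: psd; exact: cons_ord_all.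
have := H eta; have := H (- eta); rewrite ler_norml.
move: (\sum_j _) => L H1 H2; apply/andP; split; nra.
Qed.

Definition thickening (r : R) : set 'rV[R]_d :=
  [set x | exists2 y, T y & `|x - y| <= r].

(** Suppose that a probability weight [a] gives a variance below [eta^2]. For [y]
    in [T], move the points to [y + m (t_j - y + v)] with [1 <= m <= lam]: they stay
    in [U], and their variance does not grow because their differences are
    dilated and [C] is nonincreasing along rays. So the covariance with [f y] is at
    most [eta] both for [m = 1] and for [m = lam]. Term by term the latter is not
    larger than the former, and it is smaller by [c1] when [t_j] is within [rho] of
    [y], by the choice of [v]. Hence [a] charges each such ball by at most
    [2 eta / c1]. Finitely many of these balls cover the support of [a], so that
    the total mass would be less than [1] for a small [eta]. *)
Lemma cov_form_lower_bound : exists r c : R, [/\ 0 < r, 0 < c,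
  forall y x, T y -> `|x - y| <= r -> U x &
  forall n (t : 'I_n -> 'rV[R]_d) a, (forall i, thickening r (t i)) ->
    (forall i, 0 <= a i) -> \sum_i a i = 1 -> c <= cov_form t a].
Proof.
have [r [r0 room]] := compact_room compactT openU TU.
have [B [B0 TB]] : exists B : R, 0 < B /\ forall y, T y -> `|y| <= B.
  have [M [_ HM]] := compact_bounded compactT.
  exists (Num.max 1 (M + 1)); split; first by rewrite lt_max ltr01.
  by move=> y Ty; apply: HM => //; rewrite lt_max ltrDl ltr01 orbT.
pose D := r + 2 * B.
have D0 : 0 < D by rewrite addr_gt0// mulr_gt0.
pose lam := 1 + r / (3 * D).
have lam1 : 1 < lam by rewrite ltrDl divr_gt0// mulr_gt0.
have lam0 : 0 < lam by exact: lt_trans lam1.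
have [v [c1 [rho [vr c10 rho0 dec]]]] := @covariance_strict_decrease _ _ _ _
  delta0_gt0 expC lam (r / (3 * lam)) d_gt0 lam1 (divr_gt0 r0 (mulr_gt0 (ltr0n R 3) lam0)).
pose r1 := Num.min (r / 3) (rho / 4).
have r10 : 0 < r1 by rewrite lt_min !divr_gt0.
have r1r : r1 <= r / 3 by rewrite ge_min lexx.
have r1rho : r1 <= rho / 4 by rewrite ge_min lexx orbT.
have [s [sT net]] := compact_net compactT (divr_gt0 rho0 (ltr0n R 4)).
pose eta := c1 / (2 * (size s)%:R + 2).
have sz0 : 0 <= (size s)%:R :> R by [].
have eta0 : 0 < eta by rewrite divr_gt0//; lra.
exists r1, (eta ^+ 2); split => //.
- by rewrite exprn_gt0.
- by move=> y x Ty xy; apply: (room y) => //; lra.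
move=> n t a tT a0 a1; rewrite leNgt; apply/negP => qlt.
pose L y mu := \sum_j a j * C (mu *: (t j - y + v)).
have dist j y : T y -> `|t j - y| <= D.
  move=> Ty; have [z Tz tz] := tT j.
  rewrite -(subrKA z) (le_trans (ler_normD _ _))//.
  have := ler_normB z y; have := TB _ Ty; have := TB _ Tz.
  rewrite /D; lra.
have Lle y mu : T y -> 1 <= mu -> mu <= lam -> `|L y mu| <= eta.
  move=> Ty mu1 mul.
  pose p j := y + mu *: (t j - y + v).
  have Up j : U (p j).
    have [z Tz tz] := tT j; apply: (room z) => //.
    have -> : p j - z = (t j - z) + ((mu - 1) *: (t j - y) + mu *: v).
      rewrite /p scalerDr scalerBl scale1r [in RHS]addrA.
      apply/matrixP => i k; rewrite !mxE; ring.
    have mu1D : `|(mu - 1) *: (t j - y)| <= r / 3.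
      rewrite normrZ ger0_norm ?subr_ge0//.
      apply: (@le_trans _ _ (r / (3 * D) * D)).
        by apply: ler_pM; rewrite ?subr_ge0 ?dist//; rewrite /lam in mul; lra.
      by rewrite le_eqVlt; apply/orP; left; apply/eqP; field; rewrite gt_eqF.
    have muv : `|mu *: v| <= r / 3.
      rewrite normrZ ger0_norm; last by lra.
      apply: (@le_trans _ _ (lam * (r / (3 * lam)))).
        by apply: ler_pM => //; lra.
      by rewrite le_eqVlt; apply/orP; left; apply/eqP; field; rewrite gt_eqF.
    rewrite (le_trans (ler_normD _ _))//; have := ler_normD ((mu - 1) *: (t j - y)) (mu *: v).
    by lra.
  have -> : L y mu = \sum_j a j * C (p j - y).
    by apply: eq_bigr => j _; congr (_ * C _); rewrite /p [RHS]addrC addKr.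
  apply: cov_form_cauchy => //; first exact: TU.
  apply: le_trans (ltW qlt); rewrite /cov_form.
  apply: ler_sum => i _; apply: ler_sum => j _.
  rewrite ler_wpM2l ?mulr_ge0//.
  have -> : p i - p j = mu *: (t i - t j).
    by rewrite /p; apply/matrixP => k l; rewrite !mxE; ring.
  by rewrite -[X in _ <= C X]scale1r; apply: radC.
have ball_mass y : y \in s ->
    c1 * \sum_j a j * (`|t j - y| <= rho)%R%:R <= 2 * eta.
  move=> ys; have Ty := sT _ ys.
  apply: (@le_trans _ _ (L y 1 - L y lam)); last first.
    have := Lle y 1 Ty (lexx _) (ltW lam1); have := Lle y lam Ty (ltW lam1) (lexx _).
    by rewrite !ler_norml => /andP[? ?] /andP[? ?]; lra.
  rewrite /L -sumrB mulr_sumr; apply: ler_sum => j _.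
  rewrite -mulrBr mulrCA ler_wpM2l// scale1r.
  have [tj|tj] := leP `|t j - y| rho; last first.
    by rewrite mulr0 subr_ge0 -[X in _ <= C X]scale1r radC// ltW.
  by rewrite mulr1; apply: dec; rewrite addrK.
have mass : 1 <= \sum_(y <- s) \sum_j a j * (`|t j - y| <= rho)%R%:R.
  rewrite exchange_big/= -[leLHS]a1; apply: ler_sum => j _.
  rewrite -mulr_sumr ler_peMr//.
  have [z Tz tz] := tT j; have [y ys zy] := net _ Tz.
  rewrite (big_rem y)//=.
  have -> : `|t j - y| <= rho by rewrite -(subrKA z) (le_trans (ler_normD _ _))//; lra.
  by rewrite -[leLHS]addr0 lerD// sumr_ge0.
have : c1 * 1 <= (size s)%:R * (2 * eta).
  apply: le_trans (ler_wpM2l (ltW c10) mass) _.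
  rewrite mulr_sumr -[X in _ <= X%:R * _]sum1_size natr_sum mulr_suml.
  rewrite big_seq [leRHS]big_seq; apply: ler_sum => y ys.
  by rewrite mul1r ball_mass.
rewrite mulr1 /eta leNgt => /negP; apply.
rewrite mulrCA mulrA mulrA ltr_pdivrMr; last by lra.
by have : 0 < c1 by []; nra.
Qed.

(** Let [q] be the infimum of the variances of probability weights near [T], and
    let [a] be nearly optimal. Moving a small mass [th] from [a] to any point [p]
    near [T] cannot bring the variance below [q]; expanding to first order in
    [th], the covariance of [f p] with the combination [a] is at least about [q],
    here at least [q / 2]. Dividing by the standard deviation normalizes the
    variance. *)
Theorem positive_direction : exists r c : R, [/\ 0 < r, 0 < c,
  forall y x, T y -> `|x - y| <= r -> U x &
  exists n (t : 'I_n -> 'rV[R]_d) a, [/\ forall i, U (t i), cov_form t a = 1 &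
    forall p, thickening r p -> c <= \sum_j a j * C (t j - p)]].
Proof.
have [r [c0 [r0 c00 room lb]]] := cov_form_lower_bound.
have thU p : thickening r p -> U p by move=> [y Ty py]; exact: (room y).
pose E := [set x : R | exists n (t : 'I_n -> 'rV[R]_d) a,
  [/\ forall i, thickening r (t i), forall i, 0 <= a i, \sum_i a i = 1 & x = cov_form t a]].
have [y0 Ty0] := T0.
have E1 : E 1.
  exists 1%N, (fun=> y0), (fun=> 1); split.
  - by move=> _; exists y0 => //; rewrite subrr normr0 ltW.
  - by [].
  - by rewrite big_ord1.
  - by rewrite /cov_form !big_ord1 subrr C0 !mulr1.
have lbE : lbound E c0 by move=> _ [n [t [a [ta a0 a1 ->]]]]; exact: lb.
have hiE : has_inf E by split; [exists 1|exists c0].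
pose q := inf E.
have q0 : 0 < q.
  by apply: (lt_le_trans c00); apply: lb_le_inf => //; exists 1.
have q1 : q <= 1 by apply: ge_inf => //; exists c0.
pose th := q / 4.
have th0 : 0 < th by rewrite divr_gt0.
have [x [n [t [a [ta a0 a1 xE]]]] xq] := inf_adherent (exprn_gt0 2 th0) hiE.
have qx : q <= x by apply: ge_inf; [exists c0|exists n, t, a].
have x0 : 0 < x by exact: lt_le_trans qx.
have sx0 : 0 < Num.sqrt x by rewrite sqrtr_gt0.
exists r, (q / 2 / Num.sqrt x); split => //; first by rewrite !divr_gt0.
exists n, t, (fun i => (Num.sqrt x)^-1 * a i); split.
- by move=> i; exact: thU.
- by rewrite cov_formZ -xE exprVn sqr_sqrtr ?mulVf ?gt_eqF// ltW.
move=> p Sp; under eq_bigr do rewrite -mulrA.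
rewrite -mulr_sumr mulrC ler_pM2l ?invr_gt0//.
have : q <= cov_form (cons_ord p t) (cons_ord th (fun i => (1 - th) * a i)).
  apply: ge_inf; first by exists c0.
  exists n.+1, (cons_ord p t), (cons_ord th (fun i => (1 - th) * a i)); split => //.
  - exact: cons_ord_all.
  - apply: (cons_ord_all (P := fun z => 0 <= z)); first exact: ltW.
    by move=> i; rewrite mulr_ge0// subr_ge0 /th; lra.
  - rewrite big_ord_recl cons_ord0; under eq_bigr do rewrite cons_ordS.
    by rewrite -mulr_sumr a1; ring.
rewrite cov_form_cons//; [|exact: thU|by move=> i; exact: thU].
rewrite cov_formZ -xE.
under eq_bigr do rewrite -mulrA.
rewrite -mulr_sumr; move: (\sum_j _) => L Lq.
have th4 : q = 4 * th by rewrite /th; field.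
have h1 : (1 - th) ^+ 2 * x <= (1 - th) ^+ 2 * (q + th ^+ 2).
  by rewrite ler_wpM2l ?sqr_ge0// ltW.
have h2 : (1 - th) ^+ 2 * th ^+ 2 <= th ^+ 2.
  rewrite ler_piMl ?sqr_ge0// expr_le1//; rewrite ?subr_ge0; rewrite /th; lra.
have th1 : th <= 1 / 4 by rewrite /th; lra.
have h3 : th * (2 * q - 3 * th) <= th * (2 * ((1 - th) * L)).
  move: Lq h1 h2; rewrite th4; nra.
rewrite ler_pM2l// in h3.
have L0 : 0 <= L.
  rewrite leNgt; apply/negP => Ln; have : (1 - th) * L <= 0 by nra.
  by rewrite th4 in h3; lra.
have : th * L >= 0 by rewrite mulr_ge0// ltW.
rewrite th4 in h3 *; lra.
Qed.

End positive_direction.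

(** * Union bound and increments of the field *)

Section union_bounds.
Context {R : realType} {d : measure_display} {O : measurableType d}.
Variable P : probability O R.

Lemma measurable_bigsetU_seq (I : Type) (s : seq I) (F : I -> set O) :
  (forall i, measurable (F i)) -> measurable (\big[setU/set0]_(i <- s) F i).
Proof.
move=> mF; elim: s => [|i s IH]; first by rewrite big_nil.
by rewrite big_cons; exact: measurableU.
Qed.

Lemma union_bound_seq (I : Type) (s : seq I) (F : I -> set O) (e : R) :
  (forall i, measurable (F i)) -> (forall i, P (F i) <= e%:E)%E ->
  (P (\big[setU/set0]_(i <- s) F i) <= ((size s)%:R * e)%:E)%E.
Proof.
move=> mF Fe; elim: s => [|i s IH]; first by rewrite big_nil measure0 mul0r.
rewrite big_cons; apply: le_trans (measureU2 _ _ _) _ => //.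
  exact: measurable_bigsetU_seq.
by rewrite /= -natr1 mulrDl mul1r EFinD addeC; apply: leeD.
Qed.

End union_bounds.

Section increments.
Context {R : realType} {dO : measure_display} {O : measurableType dO}.
Variable P : probability O R.
Context {d : nat}.
Variables (U : set 'rV[R]_d) (f : 'rV[R]_d -> {RV P >-> R}) (C : 'rV[R]_d -> R).
Hypothesis gf : gaussian_field U f.
Hypothesis covf : covariance_function U f C.
Hypothesis mean0 : forall t, U t -> ('E_P[f t] = 0)%E.
Hypothesis var1 : forall t, U t -> ('E_P[(f t : O -> R) ^+ 2] = 1)%E.

Lemma covariance0 t : U t -> C 0 = 1.
Proof.
move=> Ut; have := covf Ut Ut; rewrite subrr => E.
have := var1 Ut; have := mean0 Ut.
move: E; rewrite unlock => + m0 v1; rewrite m0 /= => E.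
apply: EFin_inj; rewrite -E -v1; congr expectation.
apply/funext => w.
by rewrite -[RHS]/(f t w ^+ 2) -[LHS]/((f t w - 0) * (f t w - 0)) subr0 expr2.
Qed.

Lemma covarianceN s t : U s -> U t -> C (s - t) = C (t - s).
Proof.
by move=> Us Ut; apply: EFin_inj; rewrite -(covf Ut Us) -(covf Us Ut) covarianceC.
Qed.

Let increment_tail1 (s t : 'rV[R]_d) (V x : R) : U s -> U t ->
  2 * (1 - C (s - t)) <= V -> 0 < V -> 0 <= x ->
  (P [set w | (x < f s w - f t w)%R] <= (expR (- (x ^+ 2 / (2 * V))))%:E)%E.
Proof.
move=> Us Ut CV V0 x0.
pose pts (i : 'I_2) := if i == ord0 then s else t.
pose a : 'rV[R]_2 := \row_i (if i == ord0 then 1 else -1).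
have Upts i : U (pts i) by rewrite /pts; case: ifP.
have sumE (F : 'I_2 -> R) : \sum_i F i = F ord0 + F ord_max.
  by rewrite big_ord_recl big_ord1; congr (_ + F _); exact/val_inj.
have aX w : dotv a (field_vector f pts w) = f s w - f t w.
  by rewrite dotvE sumE !mxE /pts /= mul1r mulN1r.
have qa : quadform (covariance_matrix C pts) a = 2 * (1 - C (s - t)).
  rewrite quadform_covarianceE !sumE !mxE /pts /= !subrr (covariance0 Us).
  by rewrite (covarianceN Ut Us); ring.
have G := field_vector_gaussian gf covf mean0 var1 Upts a.
have mX : measurable_fun setT (fun w => dotv a (field_vector f pts w)).
  by apply: measurableT_comp; [exact: measurable_dotv|exact: measurable_field_vector].
rewrite qa in G.
have := centered_gaussian_tail_le G CV V0 x0.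
by under [X in (P X <= _)%E -> _]eq_set do rewrite aX.
Qed.

Lemma measurable_increment_gt (s t : 'rV[R]_d) (x : R) :
  measurable [set w | (x < `|f s w - f t w|)%R].
Proof.
rewrite (_ : [set w | _] = (fun w => `|f s w - f t w|) @^-1` `]x, +oo[); last first.
  by apply/seteqP; split => w /=; rewrite in_itv/= andbT.
rewrite -[X in measurable X]setTI.
have : measurable_fun setT (fun w => `|f s w - f t w|).
  apply: measurableT_comp => //.
  by apply: measurable_funB; exact: measurable_funP.
by apply => //; exact: measurable_itv.
Qed.

Lemma increment_tail (s t : 'rV[R]_d) (V x : R) : U s -> U t ->
  2 * (1 - C (s - t)) <= V -> 0 < V -> 0 <= x ->
  (P [set w | (x < `|f s w - f t w|)%R] <= (2 * expR (- (x ^+ 2 / (2 * V))))%:E)%E.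
Proof.
move=> Us Ut CV V0 x0.
have m1 u v : measurable [set w | (x < f u w - f v w)%R].
  rewrite (_ : [set w | _] = (fun w => f u w - f v w) @^-1` `]x, +oo[); last first.
    by apply/seteqP; split => w /=; rewrite in_itv/= andbT.
  rewrite -[X in measurable X]setTI.
  have : measurable_fun setT (fun w => f u w - f v w).
    by apply: measurable_funB; exact: measurable_funP.
  by apply => //; exact: measurable_itv.
apply: (@le_trans _ _ (P ([set w | (x < f s w - f t w)%R] `|` [set w | (x < f t w - f s w)%R]))).
  apply: le_measure; rewrite ?inE//; [exact: measurable_increment_gt|exact: measurableU|].
  by move=> w /=; rewrite ltr_normr opprB => /orP[]; [left|right].
apply: le_trans (measureU2 _ _ _) _ => //.
rewrite mulrDl mul1r EFinD; apply: leeD; apply: increment_tail1 => //.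
by rewrite covarianceN.
Qed.

End increments.

(** * Lattice corners *)

Section corners.
Context {R : realType} {d : nat}.
Implicit Types x : 'rV[R]_d.

(** The largest point of the half-open lattice cell containing [x]. *)
Definition corner (N : nat) x : 'rV[R]_d :=
  \row_j ((Num.ceil (N%:R * x ord0 j))%:~R / N%:R).

Lemma corner_itv N x j : (0 < N)%N ->
  x ord0 j <= corner N x ord0 j < x ord0 j + N%:R^-1.
Proof.
move=> N0; have NR : 0 < N%:R :> R by rewrite ltr0n.
have := ceil_itv (N%:R * x ord0 j); rewrite mxE.
move: (Num.ceil _) => z; rewrite intrB mulrC => /andP[h1 h2].
by rewrite ler_pdivlMr// h2/= ltr_pdivrMr// mulrDl mulVf ?gt_eqF//; lra.
Qed.

Lemma corner_dist N x : (0 < N)%N -> `|corner N x - x| <= N%:R^-1.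
Proof.
move=> N0; apply: normr_rV_le => [|j]; first by rewrite invr_ge0.
have := corner_itv x j N0; rewrite !mxE => /andP[h1 h2].
rewrite ler_norml; apply/andP; split; last by lra.
have : 0 <= N%:R^-1 :> R by rewrite invr_ge0.
by lra.
Qed.

Lemma corner_corner_dist M M' x : (0 < M)%N -> (M <= M')%N ->
  `|corner M' x - corner M x| <= M%:R^-1.
Proof.
move=> M0 MM'; have M'0 := leq_trans M0 MM'.
have le_inv : M'%:R^-1 <= M%:R^-1 :> R.
  by rewrite lef_pV2 ?posrE ?ltr0n// ler_nat.
apply: normr_rV_le => [|j]; first by rewrite invr_ge0.
have := corner_itv x j M0; have := corner_itv x j M'0.
rewrite !mxE => /andP[h1 h2] /andP[h3 h4].
by rewrite ler_norml; apply/andP; split; lra.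
Qed.

Lemma cell_corner (T : set 'rV[R]_d) N t s : (0 < N)%N ->
  lattice N t -> cell T N t s -> t = corner N s.
Proof.
move=> N0 lt [_ ts]; have NR : 0 < N%:R :> R by rewrite ltr0n.
apply/rowP => j; rewrite mxE.
have [i ti] := lt j; have := ts j; rewrite ti => /andP[h1 h2].
congr (_%:~R / _); apply/esym/ceil_def; rewrite intrB.
rewrite mulrC -ler_pdivlMr// h2 andbT.
by move: h1; rewrite -[X in _ - X]mul1r -mulrBl ltr_pdivrMr.
Qed.

(** The points of the lattice of mesh [1 / M] in the cube of radius [B], indexed
    by a finite type for use in union bounds. *)
Definition grid_point (B M : nat) (a : {ffun 'I_d -> 'I_(2 * B * M).+1}) : 'rV[R]_d :=
  \row_j (((a j)%:R - (B * M)%:R) / M%:R).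

Lemma grid_pointP (B M : nat) (p : 'rV[R]_d) (z : 'I_d -> int) : (0 < M)%N ->
  (forall j, p ord0 j = (z j)%:~R / M%:R) -> `|p| <= B%:R ->
  exists a, p = @grid_point B M a.
Proof.
move=> M0 pz pB; have MR : 0 < M%:R :> R by rewrite ltr0n.
have zB j : (- (B * M)%:Z <= z j <= (B * M)%:Z)%R.
  have := le_trans (normr_coord p j) pB.
  rewrite pz normrM normfV (ger0_norm (ltW MR)) ler_pdivrMr// -natrM.
  by rewrite -intr_norm -[X in _ <= X]/(((B * M)%:Z)%:~R) ler_int ler_norml.
exists [ffun j => inord (absz (z j + (B * M)%:Z))].
apply/rowP => j; rewrite pz !mxE ffunE; congr (_ / _).
have /andP[h1 h2] := zB j.
have e0 : 0 <= z j + (B * M)%:Z by rewrite -lerBlDr sub0r.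
rewrite inordK; last first.
  rewrite ltnS -lez_nat gez0_abs// -mulnA mul2n -addnn PoszD lerD2r//.
by rewrite -[X in _ = X - _]/((Posz (absz (z j + (B * M)%:Z)))%:~R) gez0_abs// intrD addrK.
Qed.

End corners.

(** * Chaining *)

Section exponential_series.
Context {R : realType}.

(** Half of the exponent absorbs the power of [x] and leaves the factor [1 / x],
    which makes the bound summable along a geometric sequence. *)
Lemma power_exp_le (m : nat) (kappa x : R) : 1 <= kappa -> 1 <= x ->
  x ^+ m * expR (- (kappa * x)) <=
  (m.+1)`!%:R * 2 ^+ m.+1 * expR (- (kappa / 2)) / x.
Proof.
move=> k1 x1; have x0 : 0 < x by lra.
have F0 : 0 < (m.+1)`!%:R :> R by rewrite ltr0n fact_gt0.
have e1 : expR (- (x / 2)) <= (m.+1)`!%:R * 2 ^+ m.+1 / x ^+ m.+1.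
  have x20 : 0 <= x / 2 by lra.
  rewrite expRN -[leRHS]invrK lef_pV2 ?posrE ?expR_gt0 ?invr_gt0//; last first.
    by rewrite !divr_gt0 ?mulr_gt0 ?exprn_gt0.
  rewrite invf_div; apply: le_trans (expR_ge1Dxn m x20).
  rewrite expr_div_n -mulrA -invfM [2 ^+ _ * _]mulrC.
  by rewrite lerDr.
have e2 : expR (- (kappa * x)) <= expR (- (kappa / 2)) * expR (- (x / 2)).
  by rewrite -expRD ler_expR; nra.
apply: (@le_trans _ _ (x ^+ m * (expR (- (kappa / 2)) * ((m.+1)`!%:R * 2 ^+ m.+1 / x ^+ m.+1)))).
  rewrite ler_wpM2l ?exprn_ge0 ?(ltW x0)// (le_trans e2)//.
  by rewrite ler_wpM2l ?expR_ge0.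
rewrite le_eqVlt; apply/orP; left; apply/eqP; rewrite [x ^+ m.+1]exprS.
have xm : x ^+ m != 0 by rewrite expf_neq0// gt_eqF.
by move: (expR _) (2 ^+ m.+1) => e p2; field; rewrite xm gt_eqF.
Qed.

End exponential_series.

Section chaining.
Context {R : realType} {dO : measure_display} {O : measurableType dO}.
Variable P : probability O R.
Context {d : nat}.
Variables (T U : set 'rV[R]_d) (f : 'rV[R]_d -> {RV P >-> R}) (C : 'rV[R]_d -> R).
Hypothesis gf : gaussian_field U f.
Hypothesis covf : covariance_function U f C.
Hypothesis mean0 : forall t, U t -> ('E_P[f t] = 0)%E.
Hypothesis var1 : forall t, U t -> ('E_P[(f t : O -> R) ^+ 2] = 1)%E.
Variables (r A : R) (B : nat).
Hypothesis A0 : 0 < A.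
Hypothesis room : forall y x, T y -> `|x - y| <= r -> U x.
Hypothesis quadC : forall t, `|t| <= r -> 2 * (1 - C t) <= A * `|t| ^+ 2.
Hypothesis TB : forall y, T y -> `|y| + 1 <= B%:R.

(** The number of pairs of grid points at level [k] is at most
    [(9 B N 4^k)^(2 d)]; the other factors come from [power_exp_le]. *)
Definition chaining_constant : R :=
  4 * (9 * B%:R) ^+ (2 * d) * ((2 * d).+1)`!%:R * 2 ^+ (2 * d).+1.

Section level.
Variables (N k : nat) (K : R).
Hypothesis N0 : (0 < N)%N.
Hypothesis Nr : N%:R^-1 <= r.
Hypothesis K0 : 0 <= K.
Hypothesis KA : 2 * A <= K ^+ 2.

Let M := (N * 4 ^ k)%N.
Let M' := (N * 4 ^ k.+1)%N.
Let index := ({ffun 'I_d -> 'I_(2 * B * M').+1} * {ffun 'I_d -> 'I_(2 * B * M').+1})%type.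
Let close (a : index) := [/\ U (grid_point a.1), U (grid_point a.2) &
  `|grid_point a.1 - grid_point a.2 : 'rV[R]_d| <= M%:R^-1].

Let pair_event (a : index) : set O := [set w | close a /\
  (K / (N * 2 ^ k)%:R < `|f (grid_point a.1) w - f (grid_point a.2) w|)%R].

(** Two grid points within [1 / (N 4^k)] have values more than [K / (N 2^k)]
    apart. Running over all pairs, rather than over neighbours, only changes the
    power of [N]. *)
Definition level_event : set O :=
  \big[setU/set0]_(a <- enum {: index}) pair_event a.

Let measurable_pair_event a : measurable (pair_event a).
Proof.
have [ca|nca] := pselect (close a); last first.
  rewrite (_ : pair_event a = set0); first exact: measurable0.
  by apply/seteqP; split => // w [].
rewrite (_ : pair_event a = [set w | (K / (N * 2 ^ k)%:R <
    `|f (grid_point a.1) w - f (grid_point a.2) w|)%R]).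
  exact: measurable_increment_gt.
by apply/seteqP; split => w // [].
Qed.

Lemma measurable_level_event : measurable level_event.
Proof. exact: measurable_bigsetU_seq. Qed.

Let NR : 0 < N%:R :> R. Proof. by rewrite ltr0n. Qed.
Let M0 : (0 < M)%N. Proof. by rewrite muln_gt0 N0 expn_gt0. Qed.
Let MR : 0 < M%:R :> R. Proof. by rewrite ltr0n. Qed.
Let M'0 : (0 < M')%N. Proof. by rewrite muln_gt0 N0 expn_gt0. Qed.

(** The variance is at most [A / (N 4^k)^2], so that the squared threshold exceeds
    it by a factor [K^2 4^k / A]. *)
Let pair_event_le a :
  (P (pair_event a) <= (2 * expR (- (K ^+ 2 / (2 * A) * 4 ^+ k)))%:E)%E.
Proof.
have [ca|nca] := pselect (close a); last first.
  rewrite (_ : pair_event a = set0) ?measure0 ?lee_fin ?mulr_ge0 ?expR_ge0//.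
  by apply/seteqP; split => // w [].
rewrite (_ : pair_event a = [set w | (K / (N * 2 ^ k)%:R <
    `|f (grid_point a.1) w - f (grid_point a.2) w|)%R]); last first.
  by apply/seteqP; split => w // [].
have [U1 U2 dist] := ca.
have Mr : M%:R^-1 <= r.
  apply: le_trans Nr; rewrite lef_pV2 ?posrE ?ltr0n// ler_nat /M.
  by rewrite leq_pmulr// expn_gt0.
have V0 : 0 < A / M%:R ^+ 2 by rewrite divr_gt0// exprn_gt0.
have CV : 2 * (1 - C (grid_point a.1 - grid_point a.2)) <= A / M%:R ^+ 2.
  apply: le_trans (quadC _) _; first exact: le_trans dist Mr.
  rewrite ler_wpM2l ?(ltW A0)// -exprVn lerXn2r ?nnegrE ?invr_ge0//.
have th0 : 0 <= K / (N * 2 ^ k)%:R by rewrite divr_ge0.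
have := increment_tail gf covf mean0 var1 U1 U2 CV V0 th0.
move/le_trans; apply; rewrite lee_fin ler_wpM2l// ler_expR lerN2.
rewrite le_eqVlt; apply/orP; left; apply/eqP.
rewrite /M !natrM !natrX (_ : 4 = 2 ^+ 2 :> R); last by rewrite -natrX.
rewrite -exprM mulnC exprM.
have p2 : 2 ^+ k != 0 :> R by rewrite expf_neq0.
have nN : N%:R != 0 :> R by rewrite gt_eqF.
by move: p2; move: (2 ^+ k) => p p2; field; rewrite nN p2 gt_eqF.
Qed.

Lemma level_event_le : (B > 0)%N ->
  (P level_event <=
   (chaining_constant * N%:R ^+ (2 * d) * expR (- (K ^+ 2 / (4 * A)))
     / (2 ^ k.+1)%:R)%:E)%E.
Proof.
move=> B0; apply: le_trans (union_bound_seq _ measurable_pair_event pair_event_le) _.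
rewrite lee_fin -cardT card_prod !card_ffun !card_ord -expnD addnn -mul2n.
have n_le : ((2 * B * M').+1%:R : R) <= 9 * B%:R * N%:R * 4 ^+ k.
  rewrite /M' expnS -addn1 natrD !natrM !natrX.
  have BN : 1 <= B%:R * N%:R * 4 ^+ k :> R.
    by rewrite -natrX -!natrM ler1n !muln_gt0 B0 N0 expn_gt0.
  by lra.
have n_le2 : (((2 * B * M').+1 ^ (2 * d))%:R : R) <=
   (9 * B%:R) ^+ (2 * d) * N%:R ^+ (2 * d) * (4 ^+ k) ^+ (2 * d).
  by rewrite natrX -!exprMn lerXn2r ?nnegrE ?mulr_ge0 ?exprn_ge0.
have k1 : 1 <= K ^+ 2 / (2 * A) by rewrite ler_pdivlMr ?mulr_gt0// mul1r.
have x1 : 1 <= 4 ^+ k :> R by rewrite exprn_ege1// ler1n.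
have pe := power_exp_le (2 * d) k1 x1.
have e0 : 0 <= 2 * expR (- (K ^+ 2 / (2 * A) * 4 ^+ k)) by rewrite mulr_ge0 ?expR_ge0.
apply: le_trans (ler_wpM2r e0 n_le2) _.
have -> : (9 * B%:R) ^+ (2 * d) * N%:R ^+ (2 * d) * (4 ^+ k) ^+ (2 * d) *
   (2 * expR (- (K ^+ 2 / (2 * A) * 4 ^+ k))) =
   2 * (9 * B%:R) ^+ (2 * d) * N%:R ^+ (2 * d) *
   ((4 ^+ k) ^+ (2 * d) * expR (- (K ^+ 2 / (2 * A) * 4 ^+ k))) by ring.
have c0 : 0 <= 2 * (9 * B%:R) ^+ (2 * d) * N%:R ^+ (2 * d) :> R.
  by rewrite !mulr_ge0 ?exprn_ge0 ?mulr_ge0.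
apply: le_trans (ler_wpM2l c0 pe) _.
rewrite /chaining_constant.
have -> : K ^+ 2 / (2 * A) / 2 = K ^+ 2 / (4 * A) by field; rewrite gt_eqF.
set E := expR _; set a1 := _ ^+ (2 * d); set a2 := _ ^+ (2 * d); set a3 := 2 ^+ _.
set F := _`!%:R.
have -> : 2 * a1 * a2 * (F * a3 * E / 4 ^+ k) = 2 * a1 * a2 * F * a3 * E * (4 ^+ k)^-1.
  by ring.
have -> : 4 * a1 * F * a3 * a2 * E / (2 ^ k.+1)%:R =
  2 * a1 * a2 * F * a3 * E * (2 / (2 ^ k.+1)%:R) by field; rewrite pnatr_eq0 expn_eq0.
apply: ler_wpM2l.
  by rewrite !mulr_ge0 ?exprn_ge0 ?mulr_ge0 ?expR_ge0.
rewrite expnS natrM invfM mulrA divff// mul1r natrX.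
by rewrite lef_pV2 ?posrE ?exprn_gt0// lerXn2r ?nnegrE// ler_nat.
Qed.

End level.

(** By continuity [f x - f (corner N x)] is the sum of the increments between
    successive corners of [x] of meshes [1 / (N 4^k)]; off the level events the
    [k]-th one is at most [K / (N 2^k)]. *)
Lemma chaining (N : nat) (K : R) : (0 < N)%N -> (0 < B)%N -> N%:R^-1 <= r ->
  0 <= K -> 2 * A <= K ^+ 2 ->
  exists bad : set O, [/\ measurable bad,
    (P bad <= (chaining_constant * N%:R ^+ (2 * d) * expR (- (K ^+ 2 / (4 * A))))%:E)%E &
    forall w x, ~ bad w -> T x -> {for x, continuous (sample_path f w)} ->
      `|f (corner N x) w - f x w| <= 2 * K / N%:R].
Proof.
move=> N0 B0 Nr K0 KA; have NR : 0 < N%:R :> R by rewrite ltr0n.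
pose bad := \bigcup_k level_event N k K.
have mbad : measurable bad by apply: bigcup_measurable => k _; exact: measurable_level_event.
exists bad; split => //.
- set e := chaining_constant * _ * _.
  have e0 : 0 <= e.
    by rewrite !mulr_ge0 ?exprn_ge0 ?mulr_ge0 ?expR_ge0.
  apply: le_trans (generalized_Boole_inequality _ _ _) _ => //.
    by move=> k; exact: measurable_level_event.
  apply: le_trans (epsilon_trick0 xpredT e0).
  by apply: lee_nneseries => [k _ _|k _]; [exact: measure_ge0|exact: level_event_le].
- move=> w x nbad Tx cx.
  pose c k := corner (N * 4 ^ k) x.
  have M0 k : (0 < N * 4 ^ k)%N by rewrite muln_gt0 N0 expn_gt0.
  have le_N k : (N <= N * 4 ^ k)%N by rewrite leq_pmulr// expn_gt0.
  have inv_le k : (N * 4 ^ k)%:R^-1 <= N%:R^-1 :> R.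
    by rewrite lef_pV2 ?posrE ?ltr0n ?M0// ler_nat.
  have Uc k : U (c k).
    by apply: (room Tx); rewrite (le_trans (corner_dist _ (M0 k)))// (le_trans (inv_le k)).
  have cB k : `|c k| <= B%:R.
    apply: le_trans (TB Tx); rewrite -[c k](subrK x) (le_trans (ler_normD _ _))// addrC lerD2l.
    rewrite (le_trans (corner_dist _ (M0 k)))// invf_le1 ?ltr0n ?M0// ler1n; exact: M0.
  have step k : `|f (c k.+1) w - f (c k) w| <= K / (N * 2 ^ k)%:R.
    rewrite leNgt; apply/negP => big; apply: nbad; exists k => //.
    have [a1 E1] : exists a, c k.+1 = @grid_point _ _ B (N * 4 ^ k.+1) a.
      by apply: (grid_pointP (M0 _) _ (cB _)) => j; rewrite mxE.
    (* The coarse corner also belongs to the lattice of mesh [1 / (N 4^k.+1)]. *)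
    have [a2 E2] : exists a, c k = @grid_point _ _ B (N * 4 ^ k.+1) a.
      apply: (@grid_pointP _ _ _ _ _ (fun j => Num.ceil ((N * 4 ^ k)%:R * x ord0 j) * 4) (M0 _) _ (cB _)) => j.
      rewrite mxE intrM expnSr mulnA.
      move: (M0 k); move: (N * 4 ^ k)%N => m m0; rewrite natrM (_ : 4%:~R = 4 :> R)//.
      by field; rewrite pnatr_eq0 -lt0n.
    rewrite /level_event -bigcup_seq/=; exists (a1, a2); first by rewrite /= mem_enum.
    split; last by rewrite /= -E1 -E2.
    split; rewrite /= -?E1 -?E2//.
    apply: corner_corner_dist; first exact: M0.
    by rewrite leq_pmul2l// leq_exp2l.
  have tele k : `|f (c k) w - f (c 0%N) w| <= K / N%:R * (2 - 2 / (2 ^ k)%:R).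
    elim: k => [|k IH].
      by rewrite subrr normr0 expn0 divr1 subrr mulr0.
    rewrite -(subrKA (f (c k) w)) (le_trans (ler_normD _ _))//.
    apply: le_trans (lerD (step k) IH) _.
    rewrite le_eqVlt; apply/orP; left; apply/eqP.
    rewrite expnS !natrM; field.
    by rewrite ?pnatr_eq0 -?lt0n ?N0 ?expn_gt0.
  have c0E : c 0%N = corner N x by rewrite /c expn0 muln1.
  have cvg_c : c k @[k --> \oo] --> x.
    apply/cvgrPdist_le => e e0; near=> k.
    rewrite distrC (le_trans (corner_dist _ (M0 k)))//.
    rewrite -[leRHS]invrK lef_pV2 ?posrE ?ltr0n ?M0 ?invr_gt0//.
    apply: (@le_trans _ _ k%:R); last first.
      rewrite ler_nat (leq_trans _ (leq_pmull _ N0))//.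
      by apply: ltnW; exact: ltn_expl.
    by apply: ltW; near: k; exact: nbhs_infty_gtr.
  have cvg_f : f (c k) w @[k --> \oo] --> f x w.
    exact: (cvg_comp _ _ cvg_c cx).
  have cvg_d : `|f (c k) w - f (c 0%N) w| @[k --> \oo] --> `|f x w - f (c 0%N) w|.
    by apply: cvg_norm; apply: cvgB => //; exact: cvg_cst.
  rewrite -c0E distrC.
  apply: (@closed_cvg _ _ \oo _ (fun k => `|f (c k) w - f (c 0%N) w|) [set y | y <= 2 * K / N%:R] _ _ _ cvg_d).
    exact: closed_le.
  apply: nearW => k /=; apply: le_trans (tele k) _.
  have h : 0 <= K / N%:R * (2 / (2 ^ k)%:R) by rewrite mulr_ge0 ?divr_ge0.
  rewrite mulrBr; have -> : 2 * K / N%:R = K / N%:R * 2 by ring.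
  lra.
Unshelve. all: by end_near. Qed.

End chaining.

(** * Riemann sums over lattice cells *)

Section borel_rV.
Context {R : realType} {d : nat}.

Definition lattice_box (nz : nat * {ffun 'I_d -> int}) : set 'rV[R]_d :=
  [set x | forall j, (nz.2 j)%:~R / nz.1.+1%:R - nz.1.+1%:R^-1 < x ord0 j
                     <= (nz.2 j)%:~R / nz.1.+1%:R].

Lemma measurable_box (a b : 'I_d -> R) :
  measurable [set x : 'rV[R]_d | forall j, a j < x ord0 j <= b j].
Proof.
rewrite (_ : [set x | _] = \bigcap_(j in [set: 'I_d])
    ((fun x : 'rV[R]_d => x ord0 j : measurableTypeR R) @^-1` `]a j, b j])).
  apply: fin_bigcap_measurable => // j _; rewrite -[X in measurable X]setTI.
  by apply: measurable_rV_coord => //; exact: measurable_itv.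
apply/seteqP; split => x /= H j; first by move=> _; rewrite /= in_itv/=.
by have := H j Logic.I; rewrite /= in_itv.
Qed.

(** An open set is the union of the lattice boxes that it contains, and there are
    countably many of them. *)
Lemma open_measurable_rV (W : set 'rV[R]_d) : open W -> measurable W.
Proof.
move=> oW.
pose F k : set 'rV[R]_d := if @unpickle (nat * {ffun 'I_d -> int})%type k is Some nz
  then [set x | lattice_box nz `<=` W /\ lattice_box nz x] else set0.
rewrite (_ : W = \bigcup_k F k).
  apply: bigcup_measurable => k _; rewrite /F; case: unpickle => [nz|//].
  have [bW|nbW] := pselect (lattice_box nz `<=` W).
    rewrite (_ : [set x | _] = lattice_box nz); first exact: measurable_box.
    by apply/seteqP; split => x // [].
  rewrite (_ : [set x | _] = set0)//.
  by apply/seteqP; split => x // [].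
apply/seteqP; split => [x Wx|x [k _]]; last first.
  by rewrite /F; case: unpickle => [nz|//] [bW /bW].
have /nbhs_ballP[e /= e0 xW] : nbhs x W by apply: open_nbhs_nbhs.
have [n ne] : exists n : nat, n.+1%:R^-1 < e.
  exists (Num.truncn e^-1); rewrite -[ltRHS]invrK ltf_pV2 ?posrE ?invr_gt0//.
  exact: truncnS_gt.
pose nz := (n, [ffun j => Num.ceil (n.+1%:R * x ord0 j)]).
have bx : lattice_box nz x.
  move=> j; rewrite /nz /= ffunE.
  have := corner_itv x j (ltn0Sn n); rewrite mxE => /andP[h1 h2].
  by rewrite h1 andbT ltrBlDr.
exists (pickle nz) => //; rewrite /F pickleK; split => // y yb; apply: xW.
rewrite -ball_normE /=; apply: normr_rV_lt => // j; rewrite !mxE.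
have := yb j; have := bx j; rewrite /nz /=.
move: (n.+1%:R^-1 : R) ne => q ne; move: (_ * q) => c.
by move=> /andP[h1 h2] /andP[h3 h4]; rewrite ltr_norml; apply/andP; split; lra.
Qed.

Lemma compact_measurable_rV (T : set 'rV[R]_d) : compact T -> measurable T.
Proof.
move=> cT; rewrite -[T]setCK; apply: measurableC; apply: open_measurable_rV.
by apply: closed_openC; apply: compact_closed => //; exact: norm_hausdorff.
Qed.

Lemma continuous_measurable_rV (T : set 'rV[R]_d) (F : 'rV[R]_d -> R) :
  measurable T -> (forall x, T x -> {for x, continuous F}) -> measurable_fun T F.
Proof.
move=> mT cF; apply: (measurability _ (RGenOInfty.measurableE R)).
move=> _ [_ [c ->] <-].
rewrite (_ : T `&` _ = T `&` (F @^-1` `]c, +oo[)°).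
  by apply: measurableI => //; apply: open_measurable_rV; exact: open_interior.
apply/seteqP; split => x [Tx]; last by move=> /interior_subset.
move=> Fx; split => //; apply: (cF x Tx).
by apply: open_nbhs_nbhs; split => //; exact: interval_open.
Qed.

End borel_rV.

Section lattice_cells.
Context {R : realType} {d : nat}.
Variables (T : set 'rV[R]_d) (B : nat).
Hypothesis compactT : compact T.
Hypothesis TB : forall y, T y -> `|y| + 1 <= B%:R.
Local Notation mes := (@lebesgue_rV R d).

Lemma measurable_cell N t : measurable (cell T N t).
Proof.
rewrite (_ : cell T N t = T `&`
   [set s | forall j, t ord0 j - N%:R^-1 < s ord0 j <= t ord0 j])//.
apply: measurableI; first exact: compact_measurable_rV.
exact: measurable_box.
Qed.

(** Each point of [T] lies in exactly one cell, that of its corner. *)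
Lemma lattice_pointsE N : (0 < N)%N -> lattice_points T N = corner N @` T.
Proof.
move=> N0; have NR : 0 < N%:R :> R by rewrite ltr0n.
apply/seteqP; split => [t [lt [s cs]]|_ [s Ts <-]].
  by exists s; [case: cs|rewrite (cell_corner N0 lt cs)].
split; first by move=> j; exists (Num.ceil (N%:R * s ord0 j)); rewrite mxE.
exists s; split => // j; have /andP[h1 h2] := corner_itv s j N0.
by rewrite h1 andbT ltrBlDr.
Qed.

Lemma corner_cell N s : (0 < N)%N -> T s -> cell T N (corner N s) s.
Proof.
move=> N0 Ts; split => // j; have /andP[h1 h2] := corner_itv s j N0.
by rewrite h1 andbT ltrBlDr.
Qed.

Lemma finite_lattice_points N : (0 < N)%N -> finite_set (lattice_points T N).
Proof.
move=> N0.
apply: (@sub_finite_set _ _ ((@grid_point R d B N) @` setT)); last first.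
  exact: finite_image.
rewrite lattice_pointsE// => _ [s Ts <-].
have [a ->] : exists a, corner N s = @grid_point R d B N a; last by exists a.
apply: (grid_pointP N0) => [j|]; first by rewrite mxE.
apply: le_trans (TB Ts); rewrite -[corner N s](subrK s) (le_trans (ler_normD _ _))//.
by rewrite addrC lerD2l (le_trans (corner_dist _ N0))// invf_le1 ?ltr0n// ler1n.
Qed.

(** A list, so that sums over lattice points are ordinary finite sums. *)
Definition lattice_seq N : seq 'rV[R]_d := finmap.enum_fset (fset_set (lattice_points T N)).

Lemma lattice_seqP N : (0 < N)%N -> forall t, (t \in lattice_seq N) <-> lattice_points T N t.
Proof.
move=> N0 t; rewrite /lattice_seq -[X in _ <-> X t](fset_setK (finite_lattice_points N0)).
by [].
Qed.

Lemma uniq_lattice_seq N : uniq (lattice_seq N).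
Proof. exact: finmap.fset_uniq. Qed.

Lemma bigsetU_cells N : (0 < N)%N -> \big[setU/set0]_(t <- lattice_seq N) cell T N t = T.
Proof.
move=> N0; rewrite -bigcup_seq; apply/seteqP; split => [s [t _ []]//|s Ts].
exists (corner N s); last exact: corner_cell.
by apply/(lattice_seqP N0); rewrite lattice_pointsE//; exists s.
Qed.

Lemma trivIset_cells N : (0 < N)%N -> trivIset [set` lattice_seq N] (cell T N).
Proof.
move=> N0 t t' /(lattice_seqP N0)[lt _] /(lattice_seqP N0)[lt' _] [s [st st']].
by rewrite (cell_corner N0 lt st) (cell_corner N0 lt' st').
Qed.

Lemma mes_compact_lty : (mes T < +oo)%E.
Proof.
pose a : 'rV[R]_d := \row__ - (B%:R + 1); pose b : 'rV[R]_d := \row__ B%:R.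
apply: (@le_lt_trans _ _ (mes [set x : 'rV[R]_d | forall i, a ord0 i < x ord0 i <= b ord0 i])).
  apply: le_measure; rewrite ?inE//; [exact: compact_measurable_rV|exact: measurable_box|].
  move=> x Tx i; rewrite !mxE; have := TB Tx; have := normr_coord x i.
  by move=> h1 h2; have := le_trans h1 (_ : `|x| <= B%:R - 1); rewrite ler_norml lerBrDr => /(_ h2); lra.
rewrite lebesgue_rV_box ?ltry// => i; rewrite !mxE.
by have : 0 <= B%:R :> R by []; lra.
Qed.

Lemma mes_cell_fin N t : mes (cell T N t) \is a fin_num.
Proof.
rewrite ge0_fin_numE//; apply: le_lt_trans mes_compact_lty.
apply: le_measure; rewrite ?inE//; [exact: measurable_cell|exact: compact_measurable_rV|].
by move=> s [].
Qed.

Lemma mes_interior_gt0 : T° !=set0 -> (0 < mes T)%E.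
Proof.
move=> [x /nbhs_ballP[e /= e0 xT]].
pose a : 'rV[R]_d := \row_j (x ord0 j - e / 2); pose b : 'rV[R]_d := \row_j (x ord0 j + e / 2).
apply: (@lt_le_trans _ _ (mes [set x : 'rV[R]_d | forall i, a ord0 i < x ord0 i <= b ord0 i])).
  rewrite lebesgue_rV_box; last by move=> i; rewrite !mxE; lra.
  by rewrite lte_fin; apply: prodr_gt0 => i _; rewrite !mxE; lra.
apply: le_measure; rewrite ?inE//; [exact: measurable_box|exact: compact_measurable_rV|].
move=> y yab; apply: xT; rewrite -ball_normE /=; apply: normr_rV_lt => // j.
by rewrite !mxE; have := yab j; rewrite !mxE => /andP[h1 h2]; rewrite ltr_norml; apply/andP; split; lra.
Qed.

Definition cell_weight N t : R := fine (mes (cell T N t)).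

Lemma cell_weight_ge0 N t : 0 <= cell_weight N t.
Proof. exact: fine_ge0. Qed.

Lemma sum_cell_weight N : (0 < N)%N ->
  \sum_(t <- lattice_seq N) cell_weight N t = fine (mes T).
Proof.
move=> N0; apply: EFin_inj; rewrite fineK ?ge0_fin_numE// ?mes_compact_lty//.
rewrite -sumEFin; under eq_bigr do rewrite fineK ?mes_cell_fin//.
have /(_ 1%E) cst1 := integral_cst mes (compact_measurable_rV compactT).
rewrite -[RHS]mul1e -cst1 -{2}(bigsetU_cells N0) ge0_integral_bigsetU//.
- by apply: eq_bigr => t _; rewrite integral_cst ?mul1e//; exact: measurable_cell.
- by move=> t; exact: measurable_cell.
- exact: uniq_lattice_seq.
- exact: trivIset_cells.
Qed.

Section riemann.
Variables (N : nat) (F : 'rV[R]_d -> R) (delta : R).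
Hypothesis N0 : (0 < N)%N.
Hypothesis cF : forall x, T x -> {for x, continuous F}.
Hypothesis dF : forall x, T x -> `|F (corner N x) - F x| <= delta.
Let sum := \sum_(t <- lattice_seq N) cell_weight N t * expR (F t).

Let mexp : measurable_fun T (fun x => (expR (F x))%:E).
Proof.
apply/measurable_EFinP; apply: continuous_measurable_rV.
  exact: compact_measurable_rV.
by move=> x Tx; apply: (@continuous_comp _ _ _ F expR); [exact: cF|exact: continuous_expR].
Qed.

Let splitE : (\int[mes]_(x in T) (expR (F x))%:E =
  \sum_(t <- lattice_seq N) \int[mes]_(x in cell T N t) (expR (F x))%:E)%E.
Proof.
rewrite -{1}(bigsetU_cells N0) ge0_integral_bigsetU//.
- by move=> t; exact: measurable_cell.
- exact: uniq_lattice_seq.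
- exact: trivIset_cells.
- by rewrite bigsetU_cells.
Qed.

Let cell_near t x : t \in lattice_seq N -> cell T N t x -> `|F t - F x| <= delta.
Proof.
by move=> /(lattice_seqP N0)[lt _] tx; rewrite (cell_corner N0 lt tx) dF//; case: tx.
Qed.

Let mcell t : measurable_fun (cell T N t) (fun x => (expR (F x))%:E).
Proof.
by apply: measurable_funS mexp; [exact: compact_measurable_rV|move=> x []].
Qed.

Lemma riemann_sum_le : ((expR (- delta) * sum)%:E <= \int[mes]_(x in T) (expR (F x))%:E)%E.
Proof.
rewrite splitE /sum mulr_sumr -sumEFin big_seq [leRHS]big_seq.
apply: lee_sum => t tN.
rewrite mulrCA -expRD EFinM fineK ?mes_cell_fin// muleC -integral_cst; last exact: measurable_cell.
apply: ge0_le_integral => //.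
- exact: measurable_cell.
- by move=> x _; rewrite lee_fin expR_ge0.
- move=> x tx; rewrite lee_fin ler_expR.
  by have := cell_near tN tx; rewrite ler_norml => /andP[]; lra.
Qed.

Lemma riemann_sum_ge : (\int[mes]_(x in T) (expR (F x))%:E <= (expR delta * sum)%:E)%E.
Proof.
rewrite splitE /sum mulr_sumr -sumEFin big_seq [leRHS]big_seq.
apply: lee_sum => t tN.
rewrite mulrCA -expRD EFinM fineK ?mes_cell_fin// muleC -integral_cst; last exact: measurable_cell.
apply: ge0_le_integral => //.
- exact: measurable_cell.
- move=> x tx; rewrite lee_fin ler_expR.
  by have := cell_near tN tx; rewrite ler_norml => /andP[]; lra.
Qed.

End riemann.
End lattice_cells.

(** * Regularity of the drift *)

Section drift.
Context {R : realType} {d : nat}.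
Variables (T U : set 'rV[R]_d).
Hypothesis compactT : compact T.
Hypothesis openU : open U.
Hypothesis TU : T `<=` U.

(** A single radius and a single bound, [1 / (n + 1)] and [n], work near each
    point; compactness makes [n] uniform. *)
Lemma locally_bounded_near (G : 'rV[R]_d -> R) : (forall x, T x -> {for x, continuous G}) ->
  exists r M : R, [/\ 0 < r, 0 <= M & forall x z, T x -> `|z - x| <= r -> `|G z| <= M].
Proof.
move=> cG.
have nc := (compact_near_coveringP T).1 compactT.
have H : \forall n \near \oo, T `<=` (fun x => forall z, `|z - x| <= n.+1%:R^-1 -> `|G z| <= n%:R).
  apply: (nc nat \oo (fun n x => forall z, `|z - x| <= n.+1%:R^-1 -> `|G z| <= n%:R)) => x Tx.
  have : \forall z \near x, `|G z| < `|G x| + 1.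
    by apply: (cvgr_norm_lt _ (cG x Tx)); rewrite ltrDl.
  move=> /nbhs_ballP[e /= e0 He]; have e20 : 0 < e / 2 by rewrite divr_gt0.
  exists (ball x (e / 2), [set n | n.+1%:R^-1 < e / 2 /\ `|G x| + 1 <= n%:R]).
    split => /=; first by apply: nbhsx_ballx; rewrite divr_gt0.
    near=> n; split; last by near: n; exact: nbhs_infty_ger.
    near: n; have := @cvg_harmonic R; move/cvgrPdist_lt => /(_ _ e20).
    by apply: filterS => n; rewrite sub0r normrN ger0_norm// invr_ge0.
  move=> [y n] [/=]; rewrite -ball_normE /= => xy [ne Mn] z zy.
  apply: le_trans Mn; apply/ltW/He; rewrite -ball_normE /= -(subrKA y) (le_lt_trans (ler_normD _ _))//.
  by rewrite [ltRHS](splitr e) ltrD// distrC (le_lt_trans zy).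
have [n Hn] : exists n, T `<=` (fun x => forall z, `|z - x| <= n.+1%:R^-1 -> `|G z| <= n%:R).
  by near \oo => n; exists n; near: n.
exists n.+1%:R^-1, n%:R; split => // x z Tx; exact: Hn.
Unshelve. all: by end_near. Qed.

Lemma continuous_Rsum (I : Type) (s : seq I) (G : I -> 'rV[R]_d -> R) x :
  (forall i, {for x, continuous (G i)}) ->
  {for x, continuous (fun z => \sum_(i <- s) G i z)}.
Proof.
move=> cG; elim: s => [|i s IH].
  have -> : (fun z => \sum_(i <- [::]) G i z) = (fun=> 0).
    by apply/funext => z; rewrite big_nil.
  exact: (@cst_continuous _ _ (0 : R)).
have -> : (fun z => \sum_(j <- i :: s) G j z) = (fun z => G i z + \sum_(j <- s) G j z).
  by apply/funext => z; rewrite big_cons.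
by apply: (@cvgD R R _ (nbhs x) _ (G i) (fun z => \sum_(j <- s) G j z)); [exact: cG|exact: IH].
Qed.

Lemma derive_bound (g : 'rV[R]_d -> R) z v : differentiable g z ->
  `|'D_v g z| <= `|v| * \sum_i `|partial i g z|.
Proof.
move=> dg; rewrite deriveE//.
have -> : v = \sum_i v ord0 i *: delta_mx ord0 i.
  by rewrite [LHS]row_sum_delta.
rewrite linear_sum /= -row_sum_delta mulr_sumr.
apply: le_trans (ler_norm_sum _ _ _) _; apply: ler_sum => i _.
rewrite linearZ /= normrM ler_pM//; first exact: normr_coord.
by rewrite /partial deriveE.
Qed.

Lemma is_derive_line (g : 'rV[R]_d -> R) x v (s : R) : differentiable g (x + s *: v) ->
  is_derive s (1 : R) (fun u : R => g (x + u *: v)) ('D_v g (x + s *: v)).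
Proof.
move=> dg.
have E : (fun h : R => h^-1 *: (((fun u : R => g (x + u *: v)) \o shift s) (h *: (1 : R)) - g (x + s *: v))) =
   (fun h : R => h^-1 *: ((g \o shift (x + s *: v)) (h *: v) - g (x + s *: v))).
  apply/funext => h /=; congr (_ *: (g _ - _)).
  by rewrite /shift/= [h *: 1]mulr1 scalerDl addrCA.
have dv : derivable g (x + s *: v) v by exact: diff_derivable.
split; first by rewrite /derivable E; exact: dv.
by rewrite /derive E.
Qed.

(** The mean value theorem on the segment from [x] to [y], the partial derivatives
    being bounded near [T]. *)
Lemma lipschitz_near (g : 'rV[R]_d -> R) : (forall x, U x -> times_differentiable 2 g x) ->
  exists r L : R, [/\ 0 < r, 0 <= L &
    forall x y, T x -> `|y - x| <= r -> `|g y - g x| <= L * `|y - x|].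
Proof.
move=> dg.
have dg1 z : U z -> differentiable g z.
  by move=> Uz; have [/nbhs_singleton] := dg z Uz.
have [r1 [r10 room]] := compact_room compactT openU TU.
have [r2 [M [r20 M0 bound]]] : exists r M : R, [/\ 0 < r, 0 <= M & forall x z, T x ->
    `|z - x| <= r -> `|\sum_i `|partial i g z| | <= M].
  apply: locally_bounded_near => x Tx.
  have := @continuous_Rsum _ (index_enum 'I_d) (fun i z => `|partial i g z|) x; apply => i.
  have ci : {for x, continuous (partial i g)}.
    by apply: differentiable_continuous; have [_] := dg x (TU Tx).
  exact: (@cvg_norm _ _ _ (nbhs x) _ (partial i g) _ ci).
exists (Num.min r1 r2), M; split => //; first by rewrite lt_min r10 r20.
move=> x y Tx; rewrite le_min => /andP[xy1 xy2].
pose v := y - x; pose h (u : R) := g (x + u *: v).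
have near_s (s : R) : 0 <= s <= 1 -> `|x + s *: v - x| <= `|y - x|.
  move=> /andP[s0 s1]; rewrite [x + _]addrC addrK normrZ ger0_norm// ler_piMl//.
have dh (s : R) : 0 <= s <= 1 -> is_derive s (1 : R) h ('D_v g (x + s *: v)).
  move=> s01; apply: is_derive_line; apply: dg1; apply: (room x) => //.
  exact: le_trans (near_s _ s01) xy1.
have [c c01 hc] : exists2 c : R, c \in `]0, 1[ & h 1 - h 0 = 'D_v g (x + c *: v) * (1 - 0).
  apply: (@MVT R h (fun s => 'D_v g (x + s *: v)) 0 1 ltr01).
    by move=> s; rewrite in_itv/= => /andP[s0 s1]; apply: dh; rewrite !ltW.
  apply/continuous_within_itvP => //; split.
  - move=> s; rewrite in_itv/= => /andP[s0 s1].
    apply/differentiable_continuous/derivable1_diffP.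
    by case: (dh s); rewrite ?ltW.
  - apply: cvg_at_right_filter; apply/differentiable_continuous/derivable1_diffP.
    by case: (dh 0); rewrite ?lexx ?ler01.
  - apply: cvg_at_left_filter; apply/differentiable_continuous/derivable1_diffP.
    by case: (dh 1); rewrite ?lexx ?ler01.
have -> : g y - g x = h 1 - h 0.
  by rewrite /h scale1r scale0r addr0 /v [x + (y - x)]addrC subrK.
rewrite hc subr0 mulr1.
have c01' : 0 <= c <= 1 by move: c01; rewrite in_itv/= => /andP[*]; rewrite !ltW.
apply: le_trans (derive_bound _ _) _.
  by apply: dg1; apply: (room x) => //; exact: le_trans (near_s _ c01') xy1.
rewrite mulrC ler_wpM2r//; apply: le_trans (ler_norm _) _.
by apply: (bound x) => //; exact: le_trans (near_s _ c01') xy2.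
Qed.

Lemma drift_regular (mu : 'rV[R]_d -> R) delta0 : drift_condition T U delta0 mu ->
  exists r L : R, [/\ 0 < r, 0 <= L,
    forall x, T x -> {for x, continuous mu},
    forall x y, T x -> `|y - x| <= r -> `|mu y - mu x| <= L * `|y - x| &
    forall x y, T x -> `|y - x| <= r -> `|mu y| <= L].
Proof.
have [r1 [r10 room]] := compact_room compactT openU TU.
move=> [mu0|[dmu _]].
  have mu0' x : T x -> mu x = 0 by move=> Tx; apply: mu0; exact: TU.
  exists r1, 0; split => //.
  - move=> x Tx; have Ux : \forall z \near x, U z.
      by apply: open_nbhs_nbhs; split => //; exact: TU.
    have E : \forall z \near x, mu z = mu x.
      by move: Ux; apply: filterS => z Uz; rewrite (mu0' _ Tx) (mu0 _ Uz).
    exact: (@cvg_near_cst _ R (mu x) mu (nbhs x) _ E).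
  - move=> x y Tx xy; rewrite mu0; last exact: (room x).
    by rewrite mu0'// subrr normr0 mul0r.
  - by move=> x y Tx xy; rewrite mu0 ?normr0//; exact: (room x).
have d2 x : U x -> times_differentiable 2 mu x by move=> /dmu[].
have cmu x : T x -> {for x, continuous mu}.
  move=> Tx; apply: differentiable_continuous.
  by have [/nbhs_singleton] := d2 x (TU Tx).
have [r2 [L [r20 L0 lip]]] := lipschitz_near d2.
have [r3 [M [r30 M0 bnd]]] := locally_bounded_near cmu.
exists (Num.min r2 r3), (Num.max L M); split => //.
- by rewrite lt_min r20.
- by rewrite le_max L0.
- move=> x y Tx; rewrite le_min => /andP[xy _]; apply: le_trans (lip x y Tx xy) _.
  by rewrite ler_wpM2r// le_max lexx.
- move=> x y Tx; rewrite le_min => /andP[_ xy]; apply: le_trans (bnd x y Tx xy) _.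
  by rewrite le_max lexx orbT.
Qed.

End drift.

(** * Tails of exponential sums *)

Section exponential_sums.
Context {R : realType} {dO : measure_display} {O : measurableType dO}.
Variable P : probability O R.
Context {d : nat}.
Variables (U : set 'rV[R]_d) (f : 'rV[R]_d -> {RV P >-> R}) (C : 'rV[R]_d -> R).
Variables (sigma : R) (mu : 'rV[R]_d -> R).
Hypothesis gf : gaussian_field U f.
Hypothesis covf : covariance_function U f C.
Hypothesis mean0 : forall t, U t -> ('E_P[f t] = 0)%E.
Hypothesis var1 : forall t, U t -> ('E_P[(f t : O -> R) ^+ 2] = 1)%E.
Hypothesis sigma0 : 0 < sigma.
Local Notation gaussian := (@normal_prob R 0 1).

Definition exp_sum (L : seq 'rV[R]_d) (wt : 'rV[R]_d -> R) (w : O) : R :=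
  \sum_(t <- L) wt t * exp_field f sigma mu t w.

Lemma measurable_exp_sum L wt : measurable_fun setT (exp_sum L wt).
Proof.
apply: measurable_sum => t; apply: measurable_funM => //.
apply: measurableT_comp => //; apply: measurable_funD => //.
by apply: measurable_funM => //; exact: measurable_funP.
Qed.

Lemma measurable_exp_sum_gt L wt y : measurable [set w | (y < exp_sum L wt w)%R].
Proof.
rewrite (_ : [set w | _] = exp_sum L wt @^-1` `]y, +oo[); last first.
  by apply/seteqP; split => w /=; rewrite in_itv/= andbT.
rewrite -[X in measurable X]setTI.
by apply: measurable_exp_sum => //; exact: measurable_itv.
Qed.

Lemma exp_sum_nth L wt w (x0 : 'rV[R]_d) : exp_sum L wt w =
  \sum_(k < size L) wt (nth x0 L k) * exp_field f sigma mu (nth x0 L k) w.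
Proof. by rewrite /exp_sum (big_nth x0) big_mkord. Qed.

Section anticoncentration.
Variables (n : nat) (th : 'I_n -> 'rV[R]_d) (ah : 'I_n -> R) (c : R).
Hypothesis Uth : forall i, U (th i).
Hypothesis vh : cov_form C th ah = 1.
Variables (L : seq 'rV[R]_d) (wt : 'rV[R]_d -> R).
Hypothesis UL : forall t, t \in L -> U t.
Hypothesis hL : forall t, t \in L -> c <= \sum_j ah j * C (th j - t).
Hypothesis wt0 : forall t, 0 <= wt t.

Let m := size L.
(** The points carrying the direction and those of the sum are put in one vector,
    on which the direction acts through its first block only. *)
Let pts (i : 'I_(n + m)) : 'rV[R]_d :=
  match fintype.split i with inl j => th j | inr k => nth 0 L k end.
Let a0 : 'rV[R]_(n + m) :=
  \row_i match fintype.split i with inl j => ah j | inr _ => 0 end.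

Let ptsl j : pts (lshift m j) = th j. Proof. by rewrite /pts (unsplitK (inl j)). Qed.
Let ptsr k : pts (rshift n k) = nth 0 L k. Proof. by rewrite /pts (unsplitK (inr k)). Qed.
Let a0l j : a0 ord0 (lshift m j) = ah j. Proof. by rewrite mxE (unsplitK (inl j)). Qed.
Let a0r k : a0 ord0 (rshift n k) = 0. Proof. by rewrite mxE (unsplitK (inr k)). Qed.

Let Upts i : U (pts i).
Proof.
rewrite /pts; case: splitP => j _; first exact: Uth.
by apply: UL; exact: mem_nth.
Qed.

Let a0_var : quadform (covariance_matrix C pts) a0 = 1.
Proof.
rewrite quadform_covarianceE big_split_ord/= [X in _ + X]big1 ?addr0; last first.
  by move=> k _; rewrite big1// => j _; rewrite a0r !mul0r.
rewrite -vh; apply: eq_bigr => i _; rewrite big_split_ord/= [X in _ + X]big1 ?addr0; last first.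
  by move=> k _; rewrite a0r mulr0 mul0r.
by apply: eq_bigr => j _; rewrite !a0l !ptsl.
Qed.

Let a0_cov k : (a0 *m covariance_matrix C pts) ord0 (rshift n k) =
  \sum_j ah j * C (th j - nth 0 L k).
Proof.
rewrite mxE big_split_ord/= [X in _ + X]big1 ?addr0; last first.
  by move=> j _; rewrite a0r mul0r.
by apply: eq_bigr => j _; rewrite a0l mxE ptsl ptsr.
Qed.

Let sum_of (x : 'rV[R]_(n + m)) : R := \sum_(k < m)
  wt (nth 0 L k) * expR (sigma * x ord0 (rshift n k) + mu (nth 0 L k)).

Let measurable_sum_of y : measurable [set x | (y < sum_of x)%R].
Proof.
rewrite (_ : [set w | _] = sum_of @^-1` `]y, +oo[); last first.
  by apply/seteqP; split => w /=; rewrite in_itv/= andbT.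
rewrite -[X in measurable X]setTI.
have : measurable_fun setT sum_of; last by apply => //; exact: measurable_itv.
apply: measurable_sum => k; apply: measurable_funM => //.
apply: measurableT_comp => //; apply: measurable_funD => //.
by apply: measurable_funM => //; exact: measurable_rV_coord.
Qed.

Let sum_of_field w : sum_of (field_vector f pts w) = exp_sum L wt w.
Proof.
rewrite (exp_sum_nth L wt w 0); apply: eq_bigr => k _.
by rewrite /exp_field mxE ptsr.
Qed.

(** The Cameron-Martin shift adds at least [c s] to each value of the field in the
    sum, hence multiplies the sum by at least [exp (sigma c s)]. *)
Lemma exp_sum_anticoncentration (y s K : R) : 0 <= s ->
  (P [set w | (y * expR (- (sigma * c * s)) < exp_sum L wt w)%R] <=
   (expR (s * K))%:E * P [set w | (y < exp_sum L wt w)%R] + gaussian `](K - s)%R, +oo[)%E.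
Proof.
move=> s0.
have cm := cameron_martin_le (measurable_field_vector f pts)
  (covariance_matrix_sym covf mean0 Upts)
  (covariance_matrix_ge0 covf mean0 var1 Upts)
  (field_vector_gaussian gf covf mean0 var1 Upts) a0_var K s0 (measurable_sum_of y).
set h := a0 *m _ in cm.
have E : [set w | (y < exp_sum L wt w)%R] = field_vector f pts @^-1` [set x | (y < sum_of x)%R].
  by apply/seteqP; split => w /=; rewrite sum_of_field.
rewrite -E in cm; apply: le_trans cm.
apply: le_measure; rewrite ?inE.
- exact: measurable_exp_sum_gt.
- rewrite -[X in measurable X]setTI.
  have : measurable_fun setT (fun w => field_vector f pts w + s *: h).
    apply: measurable_fun_rVP => i; under eq_fun do rewrite !mxE.
    by apply: measurable_funD => //; exact: (measurable_funP (f (pts i))).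
  by apply => //; exact: measurable_sum_of.
- move=> w /= yw; apply: (@lt_le_trans _ _ (expR (sigma * c * s) * exp_sum L wt w)).
    by rewrite -ltr_pdivrMl ?expR_gt0// -expRN mulrC.
  rewrite -sum_of_field /sum_of mulr_sumr; apply: ler_sum => k _.
  rewrite mulrCA ler_wpM2l// -expRD ler_expR !mxE ptsr.
  have := a0_cov k; rewrite -/h !mxE => ->.
  have := ler_wpM2l (mulr_ge0 (ltW sigma0) s0) (hL (mem_nth 0 (ltn_ord k))).
  by move: (\sum_j _) => H; lra.
Qed.

End anticoncentration.

Section lower_bound.
Variables (L : seq 'rV[R]_d) (wt : 'rV[R]_d -> R) (W c D : R).
Hypothesis UL : forall t, t \in L -> U t.
Hypothesis wt0 : forall t, 0 <= wt t.
Hypothesis wtW : \sum_(t <- L) wt t = W.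
Hypothesis W0 : 0 < W.
Hypothesis c0 : 0 < c.
Hypothesis muD : forall t, t \in L -> `|mu t| <= D.
Hypothesis D0 : 0 <= D.
Hypothesis covL : forall n (t : 'I_n -> 'rV[R]_d) a, (forall i, t i \in L) ->
    (forall i, 0 <= a i) -> \sum_i a i = 1 -> c <= cov_form C t a.

Let m := size L.
Let pts (k : 'I_m) : 'rV[R]_d := nth 0 L k.
Let a : 'rV[R]_m := \row_k (wt (pts k) / W).
Let Lpts k : pts k \in L. Proof. exact: mem_nth. Qed.
Let sum_a : \sum_k a ord0 k = 1.
Proof.
under eq_bigr do rewrite mxE.
rewrite -mulr_suml (_ : \sum_(i < m) _ = W) ?divff ?gt_eqF//.
by rewrite -wtW (big_nth 0) big_mkord.
Qed.

(** Jensen's inequality, from the tangent [1 + (u - M) <= exp (u - M)] at the mean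
    [M]. *)
Let jensen w : W * expR (\sum_k a ord0 k * (sigma * f (pts k) w + mu (pts k))) <= exp_sum L wt w.
Proof.
rewrite (exp_sum_nth L wt w 0).
have wE k : wt (pts k) = W * a ord0 k by rewrite mxE mulrC divfK// gt_eqF.
under [leRHS]eq_bigr do rewrite -/(pts _) wE -mulrA.
rewrite -mulr_sumr ler_wpM2l ?(ltW W0)//.
set M := \sum_k _ * (_ + _).
rewrite -[leLHS]mulr1 -[X in _ * X](_ : \sum_k a ord0 k * (1 + ((sigma * f (pts k) w + mu (pts k)) - M)) = 1); last first.
  under eq_bigr do rewrite mulrDr mulrBr mulr1.
  by rewrite big_split/= sumrB -mulr_suml sum_a mul1r subrr addr0.
rewrite mulr_sumr; apply: ler_sum => k _.
rewrite mulrCA ler_wpM2l//; first by rewrite mxE divr_ge0 ?(ltW W0).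
rewrite /exp_field -[X in _ <= expR X](subrKC M) expRD ler_wpM2l ?expR_ge0//.
exact: expR_ge1Dx.
Qed.

(** By Jensen it is enough that a weighted mean of the field exceeds
    [(ln y + |ln W| + D) / sigma], and this mean is Gaussian of variance at least
    [c]. *)
Lemma exp_sum_lower_bound (y : R) : 1 <= y ->
  ((normal_peak 1 * expR (- (((ln y + (`|ln W| + D)) / (sigma * Num.sqrt c) + 1) ^+ 2 / 2)))%:E
   <= P [set w | (y < exp_sum L wt w)%R])%E.
Proof.
move=> y1; have y0 : 0 < y by lra.
have Upts k : U (pts k) by exact: UL.
pose v := quadform (covariance_matrix C pts) a.
have cv : c <= v.
  rewrite /v quadform_covarianceE; apply: covL => // i.
  by rewrite mxE divr_ge0 ?(ltW W0).
have v0 : 0 < v by exact: lt_le_trans cv.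
pose x := (ln y + (`|ln W| + D)) / sigma.
have x0 : 0 <= x by rewrite divr_ge0 ?(ltW sigma0)// !addr_ge0// ln_ge0.
have G := field_vector_gaussian gf covf mean0 var1 Upts a.
have mX : measurable_fun setT (fun w => dotv a (field_vector f pts w)).
  by apply: measurableT_comp; [exact: measurable_dotv|exact: measurable_field_vector].
have mG : measurable [set w | (x < dotv a (field_vector f pts w))%R].
  rewrite (_ : [set w | _] = (fun w => dotv a (field_vector f pts w)) @^-1` `]x, +oo[); last first.
    by apply/seteqP; split => w /=; rewrite in_itv/= andbT.
  by rewrite -[X in measurable X]setTI; apply: mX => //; exact: measurable_itv.
apply: (@le_trans _ _ (P [set w | (x < dotv a (field_vector f pts w))%R])); last first.
  apply: le_measure; rewrite ?inE//; first exact: measurable_exp_sum_gt.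
  move=> w /=; rewrite dotvE => xG; apply: lt_le_trans (jensen w).
  have -> : \sum_k a ord0 k * (sigma * f (pts k) w + mu (pts k)) =
      sigma * (\sum_i a ord0 i * field_vector f pts w ord0 i) + \sum_k a ord0 k * mu (pts k).
    rewrite mulr_sumr -big_split/=; apply: eq_bigr => k _.
    by rewrite mulrDr [field_vector _ _ _ _ _]mxE; ring.
  have muB : - D <= \sum_k a ord0 k * mu (pts k).
    rewrite -[- D]mulr1 -sum_a mulr_sumr; apply: ler_sum => k _.
    rewrite mulrC ler_wpM2l//; first by rewrite mxE divr_ge0 ?(ltW W0).
    by have := muD (Lpts k); rewrite ler_norml => /andP[].
  rewrite -ltr_pdivrMl// mulrC -[ltLHS]lnK ?posrE ?divr_gt0// ltr_expR ln_div ?posrE//.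
  have : x * sigma < sigma * \sum_i a ord0 i * field_vector f pts w ord0 i.
    by rewrite mulrC ltr_pM2l.
  rewrite /x divfK ?gt_eqF//; have := ler_norm (- ln W); rewrite normrN.
  move: muB; move: (\sum_k _) (\sum_i _) (`|ln W|) (ln W) (ln y) => a1 a2 a3 a4 a5; lra.
apply: le_trans (centered_gaussian_tail_ge G _ _) => //.
rewrite lee_fin ler_wpM2l ?normal_peak_ge0// ler_expR lerN2 ler_pM2r//.
have num0 : 0 <= ln y + (`|ln W| + D) by rewrite !addr_ge0// ln_ge0.
have h1 : 0 <= x / Num.sqrt v + 1 by rewrite addr_ge0// divr_ge0.
have h2 : 0 <= (ln y + (`|ln W| + D)) / (sigma * Num.sqrt c) + 1.
  by rewrite addr_ge0// divr_ge0// mulr_ge0// ltW.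
rewrite lerXn2r ?nnegrE//.
rewrite lerD2r invfM mulrA -/x ler_wpM2l// lef_pV2 ?posrE ?sqrtr_gt0//.
exact: ler_wsqrtr.
Qed.

End lower_bound.
End exponential_sums.

(** * Comparison of the integral with its lattice sum *)

Section comparison.
Context {R : realType} {dO : measure_display} {O : measurableType dO}.
Variable P : probability O R.
Context {d : nat}.
Variables (T U : set 'rV[R]_d) (f : 'rV[R]_d -> {RV P >-> R}) (C : 'rV[R]_d -> R).
Variables (sigma : R) (mu : 'rV[R]_d -> R).
Hypothesis gf : gaussian_field U f.
Hypothesis covf : covariance_function U f C.
Hypothesis mean0 : forall t, U t -> ('E_P[f t] = 0)%E.
Hypothesis var1 : forall t, U t -> ('E_P[(f t : O -> R) ^+ 2] = 1)%E.
Hypothesis sigma0 : 0 < sigma.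
Hypothesis TU : T `<=` U.
Hypothesis compactT : compact T.
Hypothesis diff2 : as_twice_differentiable U f.
Variables (r A Lmu : R) (B : nat).
Hypothesis A0 : 0 < A.
Hypothesis room : forall y x, T y -> `|x - y| <= r -> U x.
Hypothesis quadC : forall t, `|t| <= r -> 2 * (1 - C t) <= A * `|t| ^+ 2.
Hypothesis TB : forall y, T y -> `|y| + 1 <= B%:R.
Hypothesis B0 : (0 < B)%N.
Hypothesis cmu : forall x, T x -> {for x, continuous mu}.
Hypothesis Lmu0 : 0 <= Lmu.
Hypothesis lip : forall x y, T x -> `|y - x| <= r -> `|mu y - mu x| <= Lmu * `|y - x|.

Definition riemann_tail (N : nat) (y : R) : R :=
  fine (P [set w | (y < exp_sum f sigma mu (lattice_seq T N) (cell_weight T N) w)%R]).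

Lemma riemann_tailE N y : (riemann_tail N y)%:E =
  P [set w | (y < exp_sum f sigma mu (lattice_seq T N) (cell_weight T N) w)%R].
Proof. by rewrite fineK// fin_num_measure//; exact: measurable_exp_sum_gt. Qed.

Lemma lattice_sumE N w : (0 < N)%N -> lattice_sum T f sigma mu N w =
  (exp_sum f sigma mu (lattice_seq T N) (cell_weight T N) w)%:E.
Proof.
move=> N0; rewrite /lattice_sum fsbig_finite/=; last exact: (finite_lattice_points TB).
rewrite /exp_sum -sumEFin; apply: eq_bigr => t _.
by rewrite EFinM fineK//; exact: (mes_cell_fin compactT TB).
Qed.

Lemma lattice_tail_probE N b : (0 < N)%N ->
  lattice_tail_prob T f sigma mu N b = riemann_tail N b.
Proof.
move=> N0; rewrite /lattice_tail_prob /riemann_tail; congr (fine (P _)).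
by apply/seteqP; split => w /=; rewrite lattice_sumE// lte_fin.
Qed.

Let error N K := @chaining_constant R d B * N%:R ^+ (2 * d) * expR (- (K ^+ 2 / (4 * A))).
Let delta (N : nat) (K : R) := (2 * sigma * K + Lmu) / N%:R.

Let tail_fin b : mu_ext P [set w | (b%:E < exp_integral T f sigma mu w)%E] \is a fin_num.
Proof.
rewrite ge0_fin_numE ?mu_ext_ge0//.
apply: (@le_lt_trans _ _ (mu_ext P setT)); first exact: le_mu_ext.
by rewrite measurable_mu_extE//= probability_setT ltry.
Qed.

(** Off the event of [chaining] and the null set of irregular paths, the exponent
    varies by at most [delta] within each cell, so that sum and integral agree up
    to a factor [exp delta]. Outer measures of the integral events are bounded by
    subadditivity. *)
Lemma tail_comparison (N : nat) (K b : R) : (0 < N)%N -> N%:R^-1 <= r ->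
  0 <= K -> 2 * A <= K ^+ 2 -> 0 < b ->
  tail_prob T f sigma mu b <= riemann_tail N (b * expR (- delta N K)) + error N K /\
  riemann_tail N (b * expR (delta N K)) <= tail_prob T f sigma mu b + error N K.
Proof.
move=> N0 Nr K0 KA b0.
have NR : 0 < N%:R :> R by rewrite ltr0n.
have [bad [mbad Pbad Hbad]] :=
  chaining gf covf mean0 var1 A0 room quadC TB N0 B0 Nr K0 KA.
have [Z [mZ Z0 goodZ]] := diff2.
pose bad' := bad `|` Z.
have mbad' : measurable bad' by exact: measurableU.
have Pbad' : (P bad' <= (error N K)%:E)%E.
  apply: le_trans (measureU2 _ _ _) _ => //.
  by rewrite [X in (_ + X)%E](_ : _ = 0%E) ?adde0.
pose S w := exp_sum f sigma mu (lattice_seq T N) (cell_weight T N) w.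
have near w : ~ bad' w ->
    ((expR (- delta N K) * S w)%:E <= exp_integral T f sigma mu w)%E /\
    (exp_integral T f sigma mu w <= (expR (delta N K) * S w)%:E)%E.
  move=> nb.
  have good : forall t, U t -> times_differentiable 2 (sample_path f w) t.
    by apply: contrapT => nd; apply: nb; right; exact: goodZ.
  have cf x : T x -> {for x, continuous (sample_path f w)}.
    move=> Tx; apply: differentiable_continuous.
    by have [/nbhs_singleton] := good x (TU Tx).
  pose F x := sigma * f x w + mu x.
  have cF x : T x -> {for x, continuous F}.
    move=> Tx.
    have c1 : {for x, continuous (fun z => sigma * sample_path f w z)}.
      have cs : {for x, continuous (fun=> sigma)} by exact: cst_continuous.
      exact: (@cvgM _ _ (nbhs x) _ (fun=> sigma) (sample_path f w) _ _ cs (cf x Tx)).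
    exact: (@cvgD R R _ (nbhs x) _ (fun z => sigma * sample_path f w z) mu _ _ c1 (cmu Tx)).
  have dF x : T x -> `|F (corner N x) - F x| <= delta N K.
    move=> Tx; have h1 : `|f (corner N x) w - f x w| <= 2 * K / N%:R.
      by apply: Hbad => //; [move=> bw; apply: nb; left|exact: cf].
    have cd := corner_dist x N0.
    have h2 : `|mu (corner N x) - mu x| <= Lmu / N%:R.
      by apply: le_trans (lip Tx (le_trans cd Nr)) _; rewrite ler_wpM2l.
    rewrite /F (_ : _ - _ = sigma * (f (corner N x) w - f x w) + (mu (corner N x) - mu x)); last by ring.
    apply: le_trans (ler_normD _ _) _; rewrite normrM (gtr0_norm sigma0).
    rewrite /delta mulrDl lerD//.
    apply: le_trans (ler_wpM2l (ltW sigma0) h1) _.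
    by rewrite le_eqVlt; apply/orP; left; apply/eqP; ring.
  by split; [exact: (riemann_sum_le compactT TB N0 cF dF)|exact: (riemann_sum_ge compactT TB N0 cF dF)].
pose I := [set w | (b%:E < exp_integral T f sigma mu w)%E].
have mS y : measurable [set w | (y < S w)%R] by exact: measurable_exp_sum_gt.
split.
- rewrite -lee_fin EFinD riemann_tailE fineK; last exact: tail_fin.
  apply: (@le_trans _ _ (P ([set w | (b * expR (- delta N K) < S w)%R] `|` bad'))); last first.
    apply: le_trans (measureU2 _ _ _) _ => //.
    by apply: leeD.
  rewrite -measurable_mu_extE; last exact: measurableU.
  apply: le_mu_ext => w /= bI; have [bw|nbw] := pselect (bad' w); [by right|left].
  have [_ h] := near w nbw; have := lt_le_trans bI h.
  by rewrite lte_fin expRN ltr_pdivrMr ?expR_gt0// mulrC.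
- rewrite -lee_fin EFinD riemann_tailE fineK; last exact: tail_fin.
  apply: (@le_trans _ _ (mu_ext P I + P bad')%E); last by apply: leeD.
  rewrite -!measurable_mu_extE//.
  apply: (@le_trans _ _ (mu_ext P (I `|` bad'))).
    apply: le_mu_ext => w /= bI; have [bw|nbw] := pselect (bad' w); [by right|left].
    have [h _] := near w nbw; apply: lt_le_trans h.
    by rewrite lte_fin expRN -ltr_pdivrMl ?invr_gt0 ?expR_gt0// invrK mulrC.
  exact: outer_measureU2.
Qed.

End comparison.

(** * From tail estimates to the relative error *)

Section sample_size.
Context {R : realType}.

Lemma ln_gt2_ge (b : R) : 2 < b -> 2^-1 <= ln b.
Proof.
move=> b2; rewrite -ler_expR lnK ?posrE; last by lra.
apply: le_trans (ltW b2).
have := expR_ge1Dx (- 2^-1 : R); rewrite expRN => h.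
have e0 : 0 < expR (2^-1 : R) by exact: expR_gt0.
have : (1 + - 2^-1) * expR 2^-1 <= (expR 2^-1)^-1 * expR 2^-1 :> R by rewrite ler_wpM2r// ltW.
rewrite mulVf ?gt_eqF//; lra.
Qed.

(** In logarithms the condition on [N] bounds [eps N] below by a multiple of
    [eps^(- eps0)], of [(ln b)^2] and of a positive power of [N]; the first and the
    last dominate [ln (1 / eps)] and [ln N]. *)
Lemma sample_size (eps0 M : R) : 0 < eps0 -> 1 <= M ->
  exists kappa0 : R, forall (eps b : R) (N : nat),
    0 < eps -> eps < 1 -> 2 < b -> (0 < N)%N ->
    kappa0 * eps `^ (- 1 - eps0) * ln b `^ (2 + eps0) <= N%:R ->
    [/\ M <= eps * N%:R, M * ln b ^+ 2 <= eps * N%:R,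
        M * - ln eps <= eps * N%:R & M * ln N%:R <= eps * N%:R].
Proof.
move=> eps00 M1.
pose M' := M * (1 + eps0^-1).
have e0V : 0 < eps0^-1 by rewrite invr_gt0.
have MM' : M <= M' by rewrite ler_peMr; lra.
have M'0 : 0 < M' by lra.
have lM'0 : 0 <= ln M' by rewrite ln_ge0//; lra.
pose k := 2 + eps0 + (1 + eps0) * ln M'.
have eM' : expR (ln M') = M' by rewrite lnK.
exists (expR k) => eps b N e0 e1 b2 N0.
have Lhalf := ln_gt2_ge b2.
have L0 : 0 < ln b by lra.
have NR : 0 < N%:R :> R by rewrite ltr0n.
rewrite /powR !gt_eqF//.
set l := - ln eps; set lam := ln (ln b); set n := ln N%:R.
have l0 : 0 <= l by rewrite oppr_ge0 ln_le0// ltW.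
have n0 : 0 <= n by rewrite ln_ge0// ler1n.
have lamE : ln b = expR lam by rewrite lnK.
have lam1 : -1 <= lam.
  rewrite -ler_expR -lamE expRN; apply: le_trans Lhalf.
  rewrite lef_pV2 ?posrE ?expR_gt0//.
  by have := expR_ge1Dx (1 : R); lra.
have eN : eps * N%:R = expR (n - l).
  by rewrite /l opprK addrC expRD !lnK.
move=> kN; have nk : k + (1 + eps0) * l + (2 + eps0) * lam <= n.
  move: kN; rewrite -!expRD -[N%:R]lnK ?posrE// -/n ler_expR /l; lra.
have elam : eps0 * lam >= - eps0 by nra.
have el : 0 <= eps0 * l by rewrite mulr_ge0// ltW.
have eM : 0 <= eps0 * ln M' by rewrite mulr_ge0// ltW.
have nl : ln M' + eps0 * l <= n - l by move: nk; rewrite /k; lra.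
rewrite lamE eN; split.
- apply: le_trans MM' _; rewrite -eM' ler_expR; lra.
- rewrite -expRM_natl; apply: (@le_trans _ _ (M' * expR (2 * lam))).
    by rewrite ler_wpM2r ?expR_ge0.
  by rewrite -eM' -expRD ler_expR; move: nk; rewrite /k; lra.
- apply: (@le_trans _ _ (M' * expR (eps0 * l))); last by rewrite -eM' -expRD ler_expR.
  apply: (@le_trans _ _ (M * eps0^-1 * (eps0 * l))).
    by rewrite -mulrA mulKf// gt_eqF.
  apply: ler_pM => //.
  + by rewrite mulr_ge0//; lra.
  + by rewrite /M' ler_wpM2l//; lra.
  + by have := expR_ge1Dx (eps0 * l); lra.
(* Multiplied by [1 + eps0], the exponent [n - l] exceeds [eps0 n]. *)
- pose p := eps0 / (1 + eps0).
  have p1 : 0 < 1 + eps0 by lra.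
  have p0 : 0 < p by rewrite divr_gt0.
  have nl2 : ln M' + p * n <= n - l.
    rewrite -(ler_pM2l p1) !mulrDr mulrA [(1 + eps0) * p]mulrC divfK ?gt_eqF//.
    by move: nk; rewrite /k; lra.
  apply: (@le_trans _ _ (M' * expR (p * n))); last by rewrite -eM' -expRD ler_expR.
  apply: (@le_trans _ _ (M' * (p * n))).
    rewrite (_ : M' * (p * n) = M * n)//.
    by rewrite /M' /p; field; rewrite !gt_eqF.
  rewrite ler_wpM2l ?(ltW M'0)//.
  by have := expR_ge1Dx (p * n); lra.
Qed.

End sample_size.

Section relative_error.
Context {R : realType}.

Lemma expR_le_linear (x eps : R) : eps < 1 -> 0 <= x -> x <= eps / 16 ->
  expR x <= 1 + eps / 8.
Proof.
move=> e1 x0 xe; have e0 : 0 < expR x := expR_gt0 x.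
have : (1 - x) * expR x <= (expR x)^-1 * expR x.
  by rewrite ler_wpM2r ?(ltW e0)// -expRN; have := expR_ge1Dx (- x); lra.
rewrite mulVf ?gt_eqF//; nra.
Qed.

(** Chaining the four inequalities: [v] is at most [x p] and [p] is at most [x v],
    up to additive errors, each of them a small multiple of [eps v]. *)
Lemma relative_error (eps v p p1 p2 err tau x : R) : 0 < eps -> eps < 1 -> 0 < v ->
  1 <= x -> x <= 1 + eps / 8 -> 0 <= err -> err <= eps * v / 8 -> tau <= eps * v / 8 ->
  v <= p1 + err -> p1 <= x * p + tau -> p <= x * p2 + tau -> p2 <= v + err ->
  `|p - v| / v < eps.
Proof.
move=> e0 e1 v0 x1 xe er0 ere te vp1 p1p pp2 p2v; rewrite ltr_pdivrMr//.
have ev : 0 < eps * v by rewrite mulr_gt0.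
have xerr : x * err <= (1 + eps / 8) * (eps * v / 8) by apply: ler_pM => //; lra.
have xv : x * v <= (1 + eps / 8) * v by rewrite ler_wpM2r// ltW.
have eev : eps * (eps * v) <= eps * v by rewrite ler_piMl ?ltW.
have up : p <= v + eps * v * (13 / 32).
  have : x * p2 <= x * (v + err) by rewrite ler_wpM2l//; lra.
  by lra.
rewrite ltr_norml; apply/andP; split; last by lra.
have [p0|p0] := leP 0 p.
  have xp : x * p <= (1 + eps / 8) * p by rewrite ler_wpM2r.
  have pv : eps * p <= eps * (v + eps * v * (13 / 32)) by rewrite ler_wpM2l ?(ltW e0).
  by lra.
have : x * p <= 1 * p by rewrite ler_wnM2r// ltW.
by lra.
Qed.

Lemma shift_cost (A sigma Lmu a : R) : 0 <= A -> 0 <= sigma -> 0 <= Lmu -> 1 <= a ->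
  (2 * sigma * Num.sqrt (4 * A * a) + Lmu) * (1 + Num.sqrt (2 * a)) <=
  (4 * sigma * Num.sqrt A + Lmu) * 3 * a.
Proof.
move=> A0 sigma0 Lmu0 a1; have a0 : 0 <= a by lra.
have sa1 : 1 <= Num.sqrt a by rewrite -[leLHS]sqrtr1 ler_wsqrtr.
have saa : Num.sqrt a * Num.sqrt a = a by rewrite -expr2 sqr_sqrtr.
have -> : Num.sqrt (4 * A * a) = 2 * Num.sqrt A * Num.sqrt a.
  rewrite sqrtrM ?mulr_ge0// sqrtrM//.
  by rewrite (_ : 4 = 2 ^+ 2 :> R) ?sqrtr_sqr ?ger0_norm// -natrX.
have K'E : 1 + Num.sqrt (2 * a) <= 3 * Num.sqrt a.
  rewrite sqrtrM//.
  have s2 : Num.sqrt 2 <= 2 :> R.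
    by rewrite -[leRHS]ger0_norm// -sqrtr_sqr ler_wsqrtr// -natrX ler_nat.
  have : Num.sqrt 2 * Num.sqrt a <= 2 * Num.sqrt a by rewrite ler_wpM2r// sqrtr_ge0.
  by lra.
have Lsa : Lmu * 1 <= Lmu * Num.sqrt a by rewrite ler_wpM2l.
have -> : (4 * sigma * Num.sqrt A + Lmu) * 3 * a =
  (4 * sigma * Num.sqrt A + Lmu) * Num.sqrt a * (3 * Num.sqrt a).
  by rewrite -[in LHS]saa; ring.
apply: ler_pM => //; last by lra.
by rewrite addr_ge0// !mulr_ge0 ?sqrtr_ge0.
Qed.

End relative_error.

Section tail_estimate.
Context {R : realType}.
Variables (v : R -> R) (pN : nat -> R -> R).
Variables (r A sigma Lmu c Q pk D1 D2 : R) (m : nat).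
Hypotheses (r0 : 0 < r) (A0 : 0 < A) (sigma0 : 0 < sigma) (Lmu0 : 0 <= Lmu)
  (c0 : 0 < c) (Q0 : 0 < Q) (pk0 : 0 < pk) (D10 : 0 <= D1) (D20 : 0 < D2).

Let delta (N : nat) (K : R) := (2 * sigma * K + Lmu) / N%:R.
Let error (N : nat) (K : R) := Q * N%:R ^+ m * expR (- (K ^+ 2 / (4 * A))).

Hypothesis comparison : forall N K b, (0 < N)%N -> N%:R^-1 <= r ->
  0 <= K -> 2 * A <= K ^+ 2 -> 0 < b ->
  v b <= pN N (b * expR (- delta N K)) + error N K /\
  pN N (b * expR (delta N K)) <= v b + error N K.
Hypothesis anticoncentration : forall N s K y, (0 < N)%N -> N%:R^-1 <= r ->
  0 <= s -> s <= K ->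
  pN N (y * expR (- (sigma * c * s))) <= expR (s * K) * pN N y + expR (- ((K - s) ^+ 2 / 2)).
Hypothesis lower : forall N y, (0 < N)%N -> N%:R^-1 <= r -> 1 <= y ->
  pk * expR (- (((ln y + D1) / D2 + 1) ^+ 2 / 2)) <= pN N y.
Hypothesis pN_noninc : forall N y y', y <= y' -> pN N y' <= pN N y.

(** At the level [b] the comparison is used with a mesh of its own, so fine that
    [delta <= 1] and that the error is at most half of the lower bound for the
    sum at level [b exp 1]. *)
Lemma tail_lower_bound : exists c1 E : R, [/\ 0 < c1, 0 < E &
  forall b, 2 < b -> c1 * expR (- (E * ln b ^+ 2)) <= v b].
Proof.
have [D10' D20' Lmu0' A0'] : [/\ 0 <= D1, 0 < D2, 0 <= Lmu & 0 < A] by [].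
have pk0' : 0 < pk by [].
pose E1 := (1 + 2 * (1 + D1)) / D2 + 2.
have E10 : 0 < E1 by rewrite addr_gt0// divr_gt0//; lra.
exists (pk / 2), (E1 ^+ 2 / 2); split; [by rewrite divr_gt0|by rewrite divr_gt0// exprn_gt0|].
move=> b b2; have Lh := ln_gt2_ge b2; set L := ln b in Lh *.
have b0 : 0 < b by lra.
pose G := (L + 1 + D1) / D2 + 1.
have GE : 0 <= G <= E1 * L.
  apply/andP; split; first by rewrite addr_ge0// divr_ge0//; lra.
  rewrite /G /E1 [leRHS]mulrDl; apply: lerD; last by lra.
  rewrite [leRHS]mulrAC ler_pM2r ?invr_gt0//.
  have : 0 <= (1 + D1) * (2 * L - 1) by rewrite mulr_ge0//; lra.
  by lra.
pose ell := pk * expR (- (G ^+ 2 / 2)).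
have ell0 : 0 < ell by rewrite mulr_gt0// expR_gt0.
suff : ell / 2 <= v b.
  apply: le_trans; rewrite /ell [leRHS]mulrAC ler_wpM2l ?divr_ge0 ?(ltW pk0)//.
  rewrite ler_expR lerN2 [leRHS]mulrAC -exprMn ler_pM2r ?invr_gt0//.
  by case/andP: GE => *; rewrite lerXn2r ?nnegrE// mulr_ge0 ?(ltW E10)//; lra.
pose F : R := (m.+1)`!%:R * 2 ^+ m.+1.
have F0 : 0 <= F by rewrite mulr_ge0// exprn_ge0.
pose big := 1 + r^-1 + 2 * Lmu + 128 * A * sigma ^+ 2 + 2 * Q * F / ell.
pose N := (Num.truncn big).+1.
have NB : big < N%:R by exact: truncnS_gt.
have rV : 0 < r^-1 by rewrite invr_gt0.
have t1 : 0 <= 128 * A * sigma ^+ 2 by rewrite !mulr_ge0 ?sqr_ge0// ltW.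
have t2 : 0 <= 2 * Q * F / ell by rewrite !mulr_ge0 ?invr_ge0 ?(ltW Q0) ?(ltW ell0).
have N0 : (0 < N)%N by [].
have N1 : 1 <= N%:R :> R by rewrite ler1n.
have NR : 0 < N%:R :> R by lra.
have Nr : N%:R^-1 <= r.
  by rewrite -[leRHS]invrK lef_pV2 ?posrE//; rewrite /big in NB; lra.
(* The error is then [Q N^m exp (- 2 N)], and [delta] is of order
   [1 / sqrt N]. *)
pose K := Num.sqrt (8 * A * N%:R).
have K0 : 0 <= K by exact: sqrtr_ge0.
have AN : A <= A * N%:R by rewrite ler_peMr// ltW.
have K2 : K ^+ 2 = 8 * A * N%:R by rewrite sqr_sqrtr// !mulr_ge0// ltW.
have KA : 2 * A <= K ^+ 2 by rewrite K2; lra.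
have [_ cmp] := comparison N0 Nr K0 KA b0.
have d1 : delta N K <= 1.
  rewrite /delta ler_pdivrMr// mul1r.
  have : 2 * sigma * K <= N%:R / 2.
    have h1 : 0 <= N%:R / 2 :> R by lra.
    rewrite -(@ler_pXn2r _ 2) ?nnegrE ?mulr_ge0 ?(ltW sigma0)//.
    rewrite exprMn K2.
    have : 128 * A * sigma ^+ 2 * N%:R <= N%:R * N%:R by rewrite ler_pM2r//; rewrite /big in NB; lra.
    lra.
  by rewrite /big in NB; lra.
have err_le : error N K <= ell / 2.
  have := @power_exp_le R m 2 N%:R (ler1n _ _) N1.
  have -> : 2 * N%:R = K ^+ 2 / (4 * A) :> R by rewrite K2; field; rewrite gt_eqF.
  rewrite divff// -/F => pe.
  rewrite /error -mulrA; apply: le_trans (ler_wpM2l (ltW Q0) pe) _.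
  have e1 : expR (-1) <= 1 :> R by rewrite -[leRHS]expR0 ler_expR; lra.
  apply: (@le_trans _ _ (Q * (F * 1 / N%:R))).
    by rewrite ler_wpM2l ?(ltW Q0)// ler_wpM2r ?invr_ge0// ler_wpM2l.
  rewrite mulr1 mulrA ler_pdivrMr// [leRHS]mulrC -ler_pdivrMr ?divr_gt0//.
  have -> : Q * F / (ell / 2) = 2 * Q * F / ell by field; rewrite gt_eqF.
  by rewrite /big in NB; lra.
have e0 : 1 <= b * expR 1 by have := expR_ge1Dx (1 : R); nra.
have low := lower N0 Nr e0.
have ple : pN N (b * expR 1) <= pN N (b * expR (delta N K)).
  by apply: pN_noninc; rewrite ler_wpM2l ?ler_expR// ltW.
rewrite lnM ?posrE ?expR_gt0// expRK -/L -/G -/ell in low.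
lra.
Qed.

(** The parameter [a] gathers all that the error terms have to beat: with
    [K^2 = 4 A a] the chaining error is [Q N^m exp (- a)], and with
    [K' = 1 + sqrt (2 a)] the Gaussian tail beyond [K' - s] is at most
    [exp (- a)]. *)
Theorem tail_estimate (eps0 : R) : 0 < eps0 ->
  exists kappa0 : R, forall (eps b : R) (N : nat),
    0 < eps -> eps < 1 -> 2 < b -> (0 < N)%N ->
    kappa0 * eps `^ (- 1 - eps0) * ln b `^ (2 + eps0) <= N%:R ->
    0 < v b /\ `|pN N b - v b| / v b < eps.
Proof.
move=> eps00; have [c1 [E [c10 E0 vlow]]] := tail_lower_bound.
have [Lmu0' A0'] : 0 <= Lmu /\ 0 < A by [].
(* So that [Q exp (- q0)] and [exp (- q0)] are at most [c1 / 8]. *)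
pose q0 := Num.max 1 (Num.max (ln (8 * Q / c1)) (ln (8 / c1))).
have q01 : 1 <= q0 by rewrite le_max lexx.
have q0Q : ln (8 * Q / c1) <= q0 by rewrite !le_max lexx orbT.
have q08 : ln (8 / c1) <= q0 by rewrite !le_max lexx !orbT.
pose F := (4 * sigma * Num.sqrt A + Lmu) * 3 / (sigma * c).
have F0 : 0 <= F.
  by rewrite divr_ge0 ?mulr_ge0 ?addr_ge0 ?mulr_ge0 ?sqrtr_ge0 ?(ltW sigma0) ?(ltW c0).
pose M := 1 + r^-1 + 64 * F * (m%:R + q0 + 1 + E).
have rV : 0 < r^-1 by rewrite invr_gt0.
have mR : 0 <= m%:R :> R by [].
have FM x : 0 <= x -> x <= m%:R + q0 + 1 + E -> 64 * F * x <= M.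
  move=> x0 xm; have := ler_wpM2l (mulr_ge0 (ler0n R 64) F0) xm; rewrite /M; lra.
have M0 : 0 <= 64 * F * (m%:R + q0 + 1 + E).
  by apply: mulr_ge0; [exact: mulr_ge0|lra].
have M1 : 1 <= M by rewrite /M; lra.
have rM : r^-1 <= M by rewrite /M; lra.
have [kappa0 Hk] := sample_size eps00 M1.
exists kappa0 => eps b N e0 e1 b2 N0 /(Hk _ _ _ e0 e1 b2 N0)[hM hL hl hn].
have Lh := ln_gt2_ge b2; set L := ln b in Lh hL.
set l := - ln eps in hl; set n := ln N%:R in hn.
have l0 : 0 <= l by rewrite oppr_ge0 ln_le0// ltW.
have n0 : 0 <= n by rewrite ln_ge0// ler1n.
have NR : 0 < N%:R :> R by rewrite ltr0n.
have b0 : 0 < b by lra.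
have Nr : N%:R^-1 <= r.
  rewrite -[leRHS]invrK lef_pV2 ?posrE//; apply: le_trans rM _; apply: le_trans hM _.
  by rewrite ler_piMl ?ltW.
have vb := vlow _ b2; rewrite -/L in vb.
have EL : 0 <= E * L ^+ 2 by rewrite mulr_ge0 ?sqr_ge0// ltW.
have w0 : 0 < c1 * expR (- (E * L ^+ 2)) by rewrite mulr_gt0// expR_gt0.
have v0 : 0 < v b by exact: lt_le_trans vb.
split => //.
pose a := m%:R * n + q0 + l + E * L ^+ 2.
have mn : 0 <= m%:R * n by rewrite mulr_ge0.
have a1 : 1 <= a by rewrite /a; lra.
(* [a] is a sum of four terms, each of them at most [eps N / (64 F)]. *)
have aN : F * a / N%:R <= eps / 16.
  rewrite ler_pdivrMr//.
  have x1 : 64 * F * m%:R * n <= eps * N%:R.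
    by apply: le_trans hn; apply: ler_wpM2r => //; apply: FM => //; lra.
  have x2 : 64 * F * q0 <= eps * N%:R by apply: le_trans hM; apply: FM; lra.
  have x3 : 64 * F * 1 * l <= eps * N%:R.
    by apply: le_trans hl; apply: ler_wpM2r => //; apply: FM; lra.
  have x4 : 64 * F * E * L ^+ 2 <= eps * N%:R.
    by apply: le_trans hL; apply: ler_wpM2r; rewrite ?sqr_ge0//; apply: FM; lra.
  by rewrite /a; lra.
pose K := Num.sqrt (4 * A * a); pose K' := 1 + Num.sqrt (2 * a).
have a0 : 0 <= a by lra.
have K2 : K ^+ 2 = 4 * A * a by rewrite sqr_sqrtr// !mulr_ge0// ltW.
have K0 : 0 <= K by exact: sqrtr_ge0.
have KA : 2 * A <= K ^+ 2.
  have : A * 1 <= A * a by rewrite ler_pM2l.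
  by rewrite K2; lra.
(* The shift that compensates a change of level by the factor [exp delta]. *)
pose s := delta N K / (sigma * c).
have sc0 : 0 < sigma * c by rewrite mulr_gt0.
have d0 : 0 <= delta N K.
  by rewrite divr_ge0// addr_ge0// !mulr_ge0// ltW.
have s0 : 0 <= s by rewrite divr_ge0// ltW.
have K'1 : 1 <= K' by rewrite lerDl sqrtr_ge0.
have sK' : s * K' <= F * a / N%:R.
  have -> : s * K' = (2 * sigma * K + Lmu) * K' * ((sigma * c)^-1 * N%:R^-1).
    by rewrite /s /delta; ring.
  have -> : F * a / N%:R =
    (4 * sigma * Num.sqrt A + Lmu) * 3 * a * ((sigma * c)^-1 * N%:R^-1) by rewrite /F; ring.
  by rewrite ler_wpM2r ?shift_cost ?mulr_ge0 ?invr_ge0 ?(ltW sc0) ?(ltW NR) ?(ltW A0) ?(ltW sigma0).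
have sK16 : s * K' <= eps / 16 by exact: le_trans aN.
have s1 : s <= 1.
  have : s * 1 <= s * K' by rewrite ler_wpM2l.
  by lra.
have sleK : s <= K' by lra.
set x := expR (s * K').
have sK'0 : 0 <= s * K' by rewrite mulr_ge0 ?(le_trans ler01 K'1).
have x1 : 1 <= x by rewrite -expR0 ler_expR.
have xle : x <= 1 + eps / 8 by exact: expR_le_linear.
set err := error N K.
have ea : expR (- a) = expR (- (m%:R * n)) * expR (- q0) * eps * expR (- (E * L ^+ 2)).
  rewrite /a !opprD !expRD; congr (_ * _ * _).
  by rewrite /l opprK lnK.
have q0b z : 0 < z -> ln (8 * z / c1) <= q0 -> z * expR (- q0) <= c1 / 8.
  move=> z0 zq; rewrite expRN ler_pdivrMr ?expR_gt0//.
  have : 8 * z / c1 <= expR q0 by rewrite -[leLHS]lnK ?posrE ?divr_gt0 ?mulr_gt0// ler_expR.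
  rewrite ler_pdivrMr//; lra.
have ev0 : 0 <= eps * expR (- (E * L ^+ 2)) by rewrite mulr_ge0 ?expR_ge0// ltW.
have small : c1 / 8 * (eps * expR (- (E * L ^+ 2))) <= eps * v b / 8.
  by have := ler_wpM2l (ltW e0) vb; lra.
have err_le : err <= eps * v b / 8.
  apply: le_trans small; rewrite /err /error K2.
  have -> : 4 * A * a / (4 * A) = a by field; rewrite gt_eqF.
  have nE : N%:R ^+ m = expR (m%:R * n) :> R by rewrite expRM_natl lnK.
  rewrite ea nE expRN.
  have en0 : expR (m%:R * n) != 0 by rewrite gt_eqF ?expR_gt0.
  have -> : Q * expR (m%:R * n) * ((expR (m%:R * n))^-1 * expR (- q0) * eps * expR (- (E * L ^+ 2))) =
     Q * expR (- q0) * (eps * expR (- (E * L ^+ 2))) by field.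
  by rewrite ler_wpM2r// q0b.
set tau := expR (- ((K' - s) ^+ 2 / 2)).
have tau_le : tau <= eps * v b / 8.
  apply: le_trans small; apply: (@le_trans _ _ (expR (- a))).
    rewrite ler_expR lerN2 ler_pdivlMr//.
    rewrite -[a * 2]sqr_sqrtr; last by rewrite mulr_ge0.
    have sq0 : 0 <= Num.sqrt (a * 2) by exact: sqrtr_ge0.
    have le1 : Num.sqrt (a * 2) <= K' - s by rewrite /K' [2 * a]mulrC; lra.
    by rewrite lerXn2r ?nnegrE//; lra.
  rewrite ea; have := q0b 1 ltr01; rewrite mulr1 mul1r => /(_ q08) h.
  have em : expR (- (m%:R * n)) <= 1 by rewrite -[leRHS]expR0 ler_expR; lra.
  have -> : expR (- (m%:R * n)) * expR (- q0) * eps * expR (- (E * L ^+ 2)) =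
    expR (- (m%:R * n)) * expR (- q0) * (eps * expR (- (E * L ^+ 2))) by ring.
  rewrite ler_wpM2r//; apply: le_trans h.
  by rewrite ler_piMl ?expR_ge0.
have [cmp1 cmp2] := comparison N0 Nr K0 KA b0.
have scd : sigma * c * s = delta N K by rewrite /s mulrC divfK// gt_eqF.
have ac1 := anticoncentration b N0 Nr s0 sleK.
have ac2 := anticoncentration (b * expR (delta N K)) N0 Nr s0 sleK.
rewrite scd -mulrA -expRD subrr expR0 mulr1 in ac2.
rewrite scd in ac1.
rewrite -/x -/tau in ac1 ac2; rewrite -/err in cmp1 cmp2.
have er0 : 0 <= err by rewrite mulr_ge0 ?expR_ge0// mulr_ge0 ?exprn_ge0 ?(ltW Q0).
exact: relative_error e0 e1 v0 x1 xle er0 err_le tau_le cmp1 ac1 ac2 cmp2.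
Qed.

End tail_estimate.

(** * The lattice approximation *)

Theorem theorem10 (R : realType) (d : nat) (dO : measure_display)
    (O : measurableType dO) (P : probability O R)
    (T U : set 'rV[R]_d) (f : 'rV[R]_d -> {RV P >-> R}) (C : 'rV[R]_d -> R)
    (sigma : R) (mu : 'rV[R]_d -> R) (delta0 : R) :
  (0 < d)%N -> open U -> T `<=` U ->
  gaussian_field U f -> covariance_function U f C ->
  (forall t, U t -> nondegenerate_law P (jet2 f t)) ->
  0 < sigma -> 0 < delta0 ->
  centered_unit_stationary U f -> as_twice_differentiable U f -> full_dim_piecewise_smooth T -> covariance_expansion delta0 C -> radially_nonincreasing C -> drift_condition T U delta0 mu ->
  forall eps0 : R, 0 < eps0 ->
  exists kappa0 : R, forall (eps b : R) (N : nat),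
    0 < eps -> eps < 1 -> 2 < b -> (0 < N)%N ->
    kappa0 * eps `^ (- 1 - eps0) * ln b `^ (2 + eps0) <= N%:R ->
    0 < tail_prob T f sigma mu b /\
    `|lattice_tail_prob T f sigma mu N b - tail_prob T f sigma mu b|
      / tail_prob T f sigma mu b < eps.
Proof.
move=> d0 openU TU gf covf _ sigma0 delta00 [_ mean0 var1] diff2 [compactT intT _].
move=> expC radC driftmu eps0 eps00.
have T0 : T !=set0 by case: intT => x /interior_subset Tx; exists x.
have C0 : C 0 = 1 by case: T0 => x Tx; exact: (covariance0 covf mean0 var1 (TU _ Tx)).
have Csym s t : U s -> U t -> C (s - t) = C (t - s) by exact: covarianceN covf _ _.
have psd n (t : 'I_n -> 'rV[R]_d) a : (forall i, U (t i)) -> 0 <= cov_form C t a.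
  move=> Ut; have := covariance_matrix_ge0 covf mean0 var1 Ut (\row_i a i).
  rewrite quadform_covarianceE; under eq_bigr do under eq_bigr do rewrite !mxE.
  by [].
have [ra [c [ra0 c0 room [n [th [ah [Uth vh hh]]]]]]] :=
  positive_direction d0 openU TU compactT T0 delta00 expC radC psd Csym C0.
have [rb [cb [rb0 cb0 _ covb]]] :=
  cov_form_lower_bound d0 openU TU compactT delta00 expC radC psd Csym C0.
have [A [rc [A0 rc0 quadC]]] := covariance_quadratic delta00 expC.
have [re [Lmu [re0 Lmu0 cmu lip muD]]] := drift_regular compactT openU TU driftmu.
have [B B0 TB] : exists2 B : nat, (0 < B)%N & forall y, T y -> `|y| + 1 <= B%:R.
  have [M [_ HM]] := compact_bounded compactT.
  exists (Num.truncn (`|M| + 2)).+1 => // y Ty; have := HM (`|M| + 1).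
  have := truncnS_gt (`|M| + 2).
  have M1 : M < `|M| + 1 by have := ler_norm M; lra.
  by move=> h /(_ M1 y Ty) /=; lra.
(* One radius for all the local estimates. *)
pose r := Num.min (Num.min ra rb) (Num.min rc re).
have [rra rrb rrc rre] : [/\ r <= ra, r <= rb, r <= rc & r <= re].
  by rewrite /r !ge_min !lexx !orbT.
have r0 : 0 < r by rewrite !lt_min ra0 rb0 rc0 re0.
have mesT : (0 < lebesgue_rV d T < +oo)%E.
  by rewrite mes_interior_gt0//= (mes_compact_lty compactT TB).
set W := fine (lebesgue_rV d T).
have W0 : 0 < W by rewrite fine_gt0.
have near_T N t : (0 < N)%N -> N%:R^-1 <= r -> t \in lattice_seq T N ->
    exists2 y, T y & `|t - y| <= r.
  move=> N0 Nr /(lattice_seqP TB N0).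
  rewrite lattice_pointsE// => -[y Ty <-]; exists y => //.
  exact: le_trans (corner_dist _ N0) Nr.
have tailE := riemann_tailE T f sigma mu.
have roomr y x : T y -> `|x - y| <= r -> U x.
  by move=> Ty xy; apply: room Ty _; exact: le_trans rra.
have UL N : (0 < N)%N -> N%:R^-1 <= r -> forall t, t \in lattice_seq T N -> U t.
  by move=> N0 Nr t /(near_T _ _ N0 Nr)[y Ty]; exact: roomr.
have wt0 N t : 0 <= cell_weight T N t by exact: cell_weight_ge0.
have Q0 : 0 < @chaining_constant R d B.
  by rewrite /chaining_constant !mulr_gt0 ?exprn_gt0 ?mulr_gt0 ?ltr0n ?fact_gt0.
have pk0 : 0 < normal_peak (1 : R) by rewrite normal_peak_gt0// oner_neq0.
have D10 : 0 <= `|ln W| + Lmu by rewrite addr_ge0.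
have D20 : 0 < sigma * Num.sqrt cb by rewrite mulr_gt0// sqrtr_gt0.
have [||||kappa0 Hk] := @tail_estimate R (tail_prob T f sigma mu) (riemann_tail T f sigma mu)
  r A sigma Lmu c (@chaining_constant R d B) (normal_peak 1) (`|ln W| + Lmu)
  (sigma * Num.sqrt cb) (2 * d) r0 A0 sigma0 Lmu0 c0 Q0 pk0 D10 D20 _ _ _ _ eps0 eps00.
- move=> N K b N0 Nr K0 KA b0.
  apply: (tail_comparison gf covf mean0 var1 sigma0 TU compactT diff2 A0 roomr _ TB B0 cmu Lmu0 _ N0 Nr K0 KA b0).
  + by move=> t tr; apply: quadC; exact: le_trans rrc.
  + by move=> x y Tx xy; apply: lip => //; exact: le_trans rre.
- move=> N s K y N0 Nr s0 sK.
  rewrite -lee_fin EFinD EFinM !tailE.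
  have anti := exp_sum_anticoncentration mu gf covf mean0 var1 sigma0 Uth vh
    (UL N N0 Nr) _ (wt0 N) y K s0.
  have hp t : t \in lattice_seq T N -> c <= \sum_j ah j * C (th j - t).
    by move=> /(near_T _ _ N0 Nr)[z Tz tz]; apply: hh; exists z => //; exact: le_trans rra.
  apply: le_trans (anti _ hp) _.
  by apply: leeD2l; apply: gaussian_tail_le; rewrite subr_ge0.
- move=> N y N0 Nr y1; rewrite -lee_fin tailE.
  apply: (@exp_sum_lower_bound _ _ _ _ _ _ _ _ _ mu gf covf mean0 var1 sigma0 _ _ W cb Lmu) => //.
  + exact: UL N0 Nr.
  + exact: (sum_cell_weight compactT TB N0).
  + by move=> t /(near_T _ _ N0 Nr)[z Tz tz]; apply: muD Tz _; exact: le_trans rre.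
  + move=> n' t a tL; apply: covb => i.
    by have [z Tz tz] := near_T _ _ N0 Nr (tL i); exists z => //; exact: le_trans rrb.
- move=> N y y' yy'; rewrite -lee_fin !tailE le_measure ?inE//; try exact: measurable_exp_sum_gt.
  by move=> w /=; exact: le_lt_trans.
exists kappa0 => eps b N e0 e1 b2 N0 hN.
by rewrite (lattice_tail_probE _ _ _ compactT TB)//; exact: Hk.
Qed.
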